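(* Let $1\le p\le q\le\infty$ and let $X$ be a Banach space with $\mathrm{GL}(p,q)$. If $L$ is a $p$-convex and $q$-concave Banach lattice, then the Banach space $L(X)$ has $\mathrm{GL}(p,q)$ with $$\mathrm{GL}_{p,q}(L(X))\le \mathrm{GL}_{p,q}(X)\,K^p(L)\,K_q(L).$$
   Context: For Banach spaces $Z,X$, $Z^*\otimes X$ is identified with the space of bounded finite rank operators from $Z$ to $X$. Norms. For $1\le p<\infty$, $\pi_p$ is the $p$-summing norm; $\pi_\infty$ is the operator norm. For $1\le q<\infty$, $i_q$ is the (strictly) $q$-integral norm: $T:Z\to X$ is $q$-integral if $T=BjA$ with $A:Z\to L_\infty(\mu)$, $B:L_q(\mu)\to X$ bounded, $\mu$ a probability measure and $j:L_\infty(\mu)\to L_q(\mu)$ the formal inclusion (the factorization ends in $X$, not in $X^{**}$), and $i_q(T)=\inf\|A\|\|B\|$ over all such factorizations. $i_\infty=\gamma_\infty$, where $\gamma_\infty(T)=\inf\{\|A\|\|B\|: T=BA,\ A\in B(Z,L_\infty(\mu)),\ B\in B(L_\infty(\mu),X)\}$ over all measures $\mu$. Property $\mathrm{GL}(p,q)$. A Banach space $X$ has $\mathrm{GL}(p,q)$ ($1\le p,q\le\infty$) if there is a constant $C$ such that $i_q(T)\le C\,\pi_p(T^* )$ for all Banach spaces $Z$ and all $T\in Z^*\otimes X$. The smallest such $C$ is denoted $\mathrm{GL}_{p,q}(X)$. Lattices. A Banach lattice $L$ is $p$-convex if there is $K$ with $\|(\sum_i|x_i|^p)^{1/p}\|\le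 K(\sum_i\|x_i\|^p)^{1/p}$ for all finite families in $L$, and $q$-concave if there is $K$ with $(\sum_i\|x_i\|^q)^{1/q}\le K\|(\sum_i|x_i|^q)^{1/q}\|$ (sums replaced by maxima/suprema if the exponent is $\infty$); the smallest constants are $K^p(L)$ and $K_q(L)$. The space $L(X)$. For a Banach lattice $L$ and a Banach space $X$, and $\sum_{j=1}^n x_j\otimes y_j\in X\otimes L$, the supremum $\sup_{\|x^*\|\le1}|\sum_{j=1}^n x^*(x_j)y_j|$ exists in $L$ and one sets $\|\sum_{j=1}^n x_j\otimes y_j\|_m=\big\|\sup_{\|x^*\|\le 1}|\sum_{j=1}^n x^*(x_j)y_j|\big\|_L$, the supremum being over $x^*$ in the unit ball of $X^*$. $L(X)$ is the completion of $X\otimes L$ in the norm $\|\cdot\|_m$. *)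

(* Defs.v *)
From HB Require Import structures.
From mathcomp Require Import all_boot all_order all_algebra.
From mathcomp Require Import all_classical all_reals all_analysis.
From mathcomp Require Import measurable_realfun ess_sup_inf.
From mathcomp Require Import lra.
Set Implicit Arguments.
Unset Strict Implicit.
Unset Printing Implicit Defensive.
Import Order.TTheory GRing.Theory Num.Theory.
Import numFieldNormedType.Exports.
Local Open Scope classical_set_scope.
Local Open Scope ring_scope.
Local Open Scope quotient_scope.

Record seminorm (R : realType) (E : lmodType R) := Seminorm {
  seminorm_fun :> E -> R;
  seminormD : forall x y, seminorm_fun (x + y) <= seminorm_fun x + seminorm_fun y;
  seminormZ : forall (a : R) x, seminorm_fun (a *: x) = `|a| * seminorm_fun x
}.

Section SeminormQuotient.
Variables (R : realType) (E : lmodType R) (s : seminorm E).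

Lemma seminorm0 : s 0 = 0.
Proof. by rewrite -(scale0r 0) seminormZ normr0 mul0r. Qed.

Lemma seminormN x : s (- x) = s x.
Proof. by rewrite -scaleN1r seminormZ normrN1 mul1r. Qed.

Lemma seminorm_ge0 x : 0 <= s x.
Proof.
have := seminormD s x (- x).
by rewrite subrr seminorm0 seminormN -mulr2n pmulrn_lge0.
Qed.

Lemma seminorm_distC x y : s (x - y) = s (y - x).
Proof. by rewrite -seminormN opprB. Qed.

Lemma seminorm_eq x y : s (x - y) = 0 -> s x = s y.
Proof.
move=> xy0; apply/le_anti/andP; split.
  by rewrite -[in leLHS](subrK y x) (le_trans (seminormD _ _ _))// xy0 add0r.
rewrite -[in leLHS](subrK x y) (le_trans (seminormD _ _ _))//.
by rewrite seminorm_distC xy0 add0r.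
Qed.

Definition seminorm_equiv (x y : E) := s (x - y) == 0.

Lemma seminorm_equiv_refl : reflexive seminorm_equiv.
Proof. by move=> x; rewrite /seminorm_equiv subrr seminorm0. Qed.

Lemma seminorm_equiv_sym : symmetric seminorm_equiv.
Proof. by move=> x y; rewrite /seminorm_equiv seminorm_distC. Qed.

Lemma seminorm_equiv_trans : transitive seminorm_equiv.
Proof.
move=> y x z /eqP xy /eqP yz; apply/eqP/le_anti; rewrite seminorm_ge0 andbT.
by rewrite -(subrKA y x) (le_trans (seminormD _ _ _))// xy yz addr0.
Qed.

Canonical seminorm_equiv_rel := EquivRel seminorm_equiv seminorm_equiv_refl
  seminorm_equiv_sym seminorm_equiv_trans.

Definition snquot : Type := {eq_quot seminorm_equiv}.
HB.instance Definition _ := Choice.on snquot.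
HB.instance Definition _ := EqQuotient.on snquot.

Definition snpi (x : E) : snquot := \pi_snquot x.

Lemma snpi_eq x y : s (x - y) = 0 -> snpi x = snpi y.
Proof. by move=> xy; apply/eqmodP/eqP. Qed.

Lemma snpi_inj x y : snpi x = snpi y -> s (x - y) = 0.
Proof. by move=> /eqmodP/eqP. Qed.

Lemma snpiP (a : snquot) : exists x, a = snpi x.
Proof. by exists (repr a); rewrite /snpi reprK. Qed.

Lemma snpi_repr x : s (repr (snpi x) - x) = 0.
Proof. by apply: snpi_inj; rewrite /snpi reprK. Qed.

Let add (a b : snquot) := snpi (repr a + repr b).
Let opp (a : snquot) := snpi (- repr a).
Let scale (l : R) (a : snquot) := snpi (l *: repr a).

Let addE x y : add (snpi x) (snpi y) = snpi (x + y).
Proof.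
apply/snpi_eq/le_anti; rewrite seminorm_ge0 andbT opprD addrACA.
by rewrite (le_trans (seminormD _ _ _))// !snpi_repr addr0.
Qed.

Let oppE x : opp (snpi x) = snpi (- x).
Proof. by apply/snpi_eq; rewrite -opprD seminormN snpi_repr. Qed.

Let scaleE l x : scale l (snpi x) = snpi (l *: x).
Proof. by apply/snpi_eq; rewrite -scalerBr seminormZ snpi_repr mulr0. Qed.

Let addA : associative add.
Proof.
move=> a b c; have [[x ->] [y ->] [z ->]] := And3 (snpiP a) (snpiP b) (snpiP c).
by rewrite !addE addrA.
Qed.

Let addC : commutative add.
Proof.
by move=> a b; have [[x ->] [y ->]] := (snpiP a, snpiP b); rewrite !addE addrC.
Qed.

Let add0 : left_id (snpi 0) add.
Proof. by move=> a; have [x ->] := snpiP a; rewrite addE add0r. Qed.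

Let addN : left_inverse (snpi 0) opp add.
Proof. by move=> a; have [x ->] := snpiP a; rewrite oppE addE addNr. Qed.

HB.instance Definition _ := GRing.isZmodule.Build snquot addA addC add0 addN.

Let scaleA a b v : scale a (scale b v) = scale (a * b) v.
Proof. by have [x ->] := snpiP v; rewrite !scaleE scalerA. Qed.

Let scale1 : left_id 1 scale.
Proof. by move=> a; have [x ->] := snpiP a; rewrite scaleE scale1r. Qed.

Let scaleDr : right_distributive scale +%R.
Proof.
move=> l a b; have [[x ->] [y ->]] := (snpiP a, snpiP b).
by rewrite /GRing.add/= addE !scaleE addE scalerDr.
Qed.

Let scaleDl v : {morph scale^~ v : a b / a + b}.
Proof.
move=> a b; have [x ->] := snpiP v.
by rewrite {2}/GRing.add/= !scaleE addE scalerDl.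
Qed.

HB.instance Definition _ := GRing.Zmodule_isLmodule.Build R snquot
  scaleA scale1 scaleDr scaleDl.

Lemma snpiD x y : snpi (x + y) = snpi x + snpi y.
Proof. by rewrite -addE. Qed.

Lemma snpiZ l x : snpi (l *: x) = l *: snpi x.
Proof. by rewrite -scaleE. Qed.

Lemma snpi_is_linear : linear snpi.
Proof. by move=> l x y; rewrite snpiD snpiZ. Qed.

HB.instance Definition _ := GRing.isLinear.Build R E snquot _ snpi snpi_is_linear.

Let norm (a : snquot) : R := s (repr a).

Let normE x : norm (snpi x) = s x.
Proof. exact/seminorm_eq/snpi_repr. Qed.

Let normD a b : norm (a + b) <= norm a + norm b.
Proof.
have [[x ->] [y ->]] := (snpiP a, snpiP b).
by rewrite -snpiD !normE seminormD.
Qed.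

Let normZ (l : R) a : norm (l *: a) = `|l| * norm a.
Proof. by have [x ->] := snpiP a; rewrite -snpiZ !normE seminormZ. Qed.

Let norm_eq0 a : norm a = 0 -> a = 0.
Proof.
have [x ->] := snpiP a; rewrite normE => sx0.
by apply: snpi_eq; rewrite subr0.
Qed.

HB.instance Definition _ := Lmodule_isNormed.Build R snquot normD normZ norm_eq0.

Lemma snpi_norm x : `|snpi x| = s x.
Proof. exact: normE. Qed.

End SeminormQuotient.

Section BoundedOperators.
Variables (R : realType) (V W : normedModType R).

Definition bounded_linear (f : V -> W) :=
  linear f /\ exists M, forall x, `|f x| <= M * `|x|.

Definition bop_pred : {pred V -> W} := mem [set f | bounded_linear f].

Record bop := Bop { bop_fun :> V -> W; bopP : bop_fun \in bop_pred }.

HB.instance Definition _ := [isSub for bop_fun].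
HB.instance Definition _ := gen_eqMixin bop.
HB.instance Definition _ := gen_choiceMixin bop.

Lemma bop_submod_closed : submod_closed bop_pred.
Proof.
have E0 x : (0 : V -> W) x = 0 by [].
have EP a (f g : V -> W) x : (a *: f + g) x = a *: f x + g x by [].
split.
  rewrite inE; split; first by move=> a x y /=; rewrite !E0 scaler0 addr0.
  by exists 0 => x; rewrite E0 mul0r normr0.
move=> a f g /[!inE] -[lf [M fM]] [lg [N gN]]; split.
  move=> b x y; rewrite !EP lf lg !scalerDr !scalerA addrACA.
  by rewrite [b * a]mulrC.
exists (`|a| * M + N) => x; rewrite EP (le_trans (ler_normD _ _))//.
by rewrite mulrDl normrZ lerD// -mulrA ler_wpM2l.
Qed.

HB.instance Definition _ := GRing.isSubmodClosed.Build R (V -> W) bop_pred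
  bop_submod_closed.
HB.instance Definition _ := [SubChoice_isSubLmodule of bop by <:].

Lemma bop_addE (f g : bop) x : (f + g) x = f x + g x. Proof. by []. Qed.
Lemma bop_scaleE a (f : bop) x : (a *: f) x = a *: f x. Proof. by []. Qed.
Lemma bopE (f g : bop) : (forall x, f x = g x) -> f = g.
Proof. by move=> fg; apply/val_inj/funext. Qed.

Lemma bop_linear (f : bop) : linear f.
Proof. by have := bopP f; rewrite inE => -[]. Qed.

HB.instance Definition _ (f : bop) :=
  GRing.isLinear.Build R V W _ f (bop_linear f).

Lemma bop_bounded (f : bop) : exists M, forall x, `|f x| <= M * `|x|.
Proof. by have := bopP f; rewrite inE => -[]. Qed.

Definition opnorm (f : V -> W) : R := sup [set `|f x| | x in [set x | `|x| <= 1]].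

Let opnorm_has_sup (f : bop) :
  has_sup [set `|f x| | x in [set x | `|x| <= 1]].
Proof.
split; first by exists `|f 0|, 0 => //=; rewrite normr0.
have [M fM] := bop_bounded f.
exists `|M| => _ [x /= x1 <-]; rewrite (le_trans (fM x))//.
by rewrite (le_trans (ler_wpM2r _ (ler_norm M)))// ler_piMr.
Qed.

Lemma opnorm_ball (f : bop) x : `|x| <= 1 -> `|f x| <= opnorm f.
Proof. by move=> x1; apply: sup_upper_bound => //; exists x. Qed.

Lemma opnorm_le (f : bop) x : `|f x| <= opnorm f * `|x|.
Proof.
have [->|x0] := eqVneq x 0; first by rewrite linear0 !normr0 mulr0.
have nx : 0 < `|x| by rewrite normr_gt0.
have := @opnorm_ball f (`|x|^-1 *: x).
rewrite normrZ normfV normr_id mulVf ?gt_eqF// => /(_ (lexx _)).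
by rewrite linearZ/= normrZ normfV normr_id mulrC ler_pdivrMr.
Qed.

Lemma opnorm_lub (f : bop) M : 0 <= M -> (forall x, `|f x| <= M * `|x|) ->
  opnorm f <= M.
Proof.
move=> M0 fM; apply: ge_sup; first by case: (opnorm_has_sup f).
by move=> _ [x /= x1 <-]; rewrite (le_trans (fM x))// ler_piMr.
Qed.

Lemma opnorm_ge0 (f : bop) : 0 <= opnorm f.
Proof. by apply: le_trans (opnorm_ball f (x := 0) _); rewrite ?normr0. Qed.

Let opnormD (f g : bop) : opnorm (f + g) <= opnorm f + opnorm g.
Proof.
apply: opnorm_lub => [|x]; first by rewrite addr_ge0// opnorm_ge0.
by rewrite mulrDl (le_trans (ler_normD _ _))// lerD// opnorm_le.
Qed.

Let opnormZ_le a (f : bop) : opnorm (a *: f) <= `|a| * opnorm f.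
Proof.
apply: opnorm_lub => [|x]; first by rewrite mulr_ge0// opnorm_ge0.
by rewrite bop_scaleE normrZ -mulrA ler_wpM2l// opnorm_le.
Qed.

Let opnormZ a (f : bop) : opnorm (a *: f) = `|a| * opnorm f.
Proof.
apply/le_anti; rewrite opnormZ_le andTb.
have [->|a0] := eqVneq a 0; first by rewrite normr0 mul0r; exact: opnorm_ge0.
rewrite -ler_pdivlMl ?normr_gt0// -normfV.
by rewrite -[in leLHS](scalerK a0 f); exact: opnormZ_le.
Qed.

Let opnorm_eq0 (f : bop) : opnorm f = 0 -> f = 0.
Proof.
move=> f0; apply: bopE => x; apply/eqP; rewrite -normr_le0.
by rewrite (le_trans (opnorm_le f x))// f0 mul0r.
Qed.

HB.instance Definition _ :=
  Lmodule_isNormed.Build R bop opnormD opnormZ opnorm_eq0.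

Lemma bop_normE (f : bop) : `|f| = opnorm f. Proof. by []. Qed.

Lemma bop_norm_le (f : bop) x : `|f x| <= `|f| * `|x|.
Proof. exact: opnorm_le. Qed.

Lemma bop_norm_lub (f : bop) M : 0 <= M -> (forall x, `|f x| <= M * `|x|) ->
  `|f| <= M.
Proof. exact: opnorm_lub. Qed.

(* membership in V^* (x) W *)
Definition finite_rank (f : bop) := exists n (e : 'I_n -> W),
  forall x, exists c : 'I_n -> R, f x = \sum_i c i *: e i.

End BoundedOperators.

Definition dual (R : realType) (V : normedModType R) := bop V R.
HB.instance Definition _ (R : realType) (V : normedModType R) :=
  NormedModule.on (dual V).

Section Adjoint.
Variables (R : realType) (V W : normedModType R) (T : bop V W).

Lemma adjoint_subproof1 (phi : dual W) : (phi \o T) \in @bop_pred R V R.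
Proof.
rewrite inE; split; first by move=> a x y /=; rewrite !linearP.
exists (`|phi| * `|T|) => x /=.
by rewrite (le_trans (bop_norm_le _ _))// -mulrA ler_wpM2l// bop_norm_le.
Qed.

Definition adjoint_fun (phi : dual W) : dual V := Bop (adjoint_subproof1 phi).

Lemma adjoint_subproof2 : adjoint_fun \in @bop_pred R (dual W) (dual V).
Proof.
rewrite inE; split; first by move=> a x y; exact: bopE.
exists `|T| => phi; apply: bop_norm_lub => [|x]; first exact: mulr_ge0.
by rewrite [`|T| * _]mulrC -mulrA (le_trans (bop_norm_le phi _))// ler_wpM2l// bop_norm_le.
Qed.

Definition adjoint : bop (dual W) (dual V) := Bop adjoint_subproof2.

End Adjoint.

Section Completion.
Variables (R : realType) (V : normedModType R).

Let half_gt0 (e : R) : 0 < e -> 0 < e / 2.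
Proof. by move=> e0; rewrite divr_gt0. Qed.

Definition is_cauchy_seq (u : nat -> V) := forall e : R, 0 < e ->
  exists N, forall m n, (N <= m)%N -> (N <= n)%N -> `|u m - u n| <= e.

Definition cauchy_seq_pred : {pred nat -> V} := mem [set u | is_cauchy_seq u].

Record cauchy_seq := CauchySeq {
  cauchy_seq_fun :> nat -> V; cauchy_seqP : cauchy_seq_fun \in cauchy_seq_pred }.

HB.instance Definition _ := [isSub for cauchy_seq_fun].
HB.instance Definition _ := gen_eqMixin cauchy_seq.
HB.instance Definition _ := gen_choiceMixin cauchy_seq.

Lemma cauchy_seq_submod_closed : submod_closed cauchy_seq_pred.
Proof.
have EP a (f g : nat -> V) x : (a *: f + g) x = a *: f x + g x by [].
split.
  rewrite inE => e e0; exists 0%N => m n _ _.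
  by rewrite [X in `|X|](_ : _ = 0 - 0 :> V)// subr0 normr0 ltW.
move=> a u v /[!inE] cu cv e e0.
have e2 : 0 < e / 2 by rewrite divr_gt0.
have a1 : 0 < `|a| + 1 by rewrite ltr_wpDl.
have [N Nu] := cu _ (divr_gt0 e2 a1).
have [N' Nv] := cv _ e2.
exists (maxn N N') => m n; rewrite !geq_max => /andP[Nm N'm] /andP[Nn N'n].
rewrite !EP opprD addrACA -scalerBr (le_trans (ler_normD _ _))//.
rewrite [leRHS]splitr lerD ?Nv// normrZ.
rewrite (@le_trans _ _ ((`|a| + 1) * `|u m - u n|))//.
  by rewrite ler_wpM2r// lerDl.
by rewrite mulrC -ler_pdivlMr// Nu.
Qed.

HB.instance Definition _ := GRing.isSubmodClosed.Build R (nat -> V)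
  cauchy_seq_pred cauchy_seq_submod_closed.
HB.instance Definition _ := [SubChoice_isSubLmodule of cauchy_seq by <:].

Lemma cauchy_seq_is_cauchy (u : cauchy_seq) : is_cauchy_seq u.
Proof. by have := cauchy_seqP u; rewrite inE. Qed.

Let normseq_cvg (u : cauchy_seq) : cvgn (fun n => `|u n|).
Proof.
apply/cauchy_cvgP/cauchy_exP => e e0.
have [N Nu] := cauchy_seq_is_cauchy u (half_gt0 e0).
exists `|u N|; exists N => // n /= Nn.
rewrite /ball/= (le_lt_trans (ler_dist_dist _ _))//.
by rewrite (le_lt_trans (Nu _ _ _ _))// ltr_pdivrMr// ltr_pMr// ltr1n.
Qed.

Let limnorm (u : cauchy_seq) : R := limn (fun n => `|u n|).

Let limnormD u v : limnorm (u + v) <= limnorm u + limnorm v.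
Proof.
rewrite /limnorm -limD; [|exact: normseq_cvg..].
apply: ler_lim; first exact: normseq_cvg.
  by apply: is_cvgD; exact: normseq_cvg.
by apply: nearW => n; exact: ler_normD.
Qed.

Let limnormZ (a : R) u : limnorm (a *: u) = `|a| * limnorm u.
Proof.
rewrite /limnorm.
have -> : (fun n => `|(a *: u : cauchy_seq) n|) = (fun n => `|a| *: `|u n|).
  by apply/funext => n; exact: normrZ.
by rewrite limZl_tmp//; exact: normseq_cvg.
Qed.

Definition cauchy_seminorm := Seminorm limnormD limnormZ.

Lemma cauchy_seminorm_le (u : cauchy_seq) (e : R) N :
  (forall n, (N <= n)%N -> `|u n| <= e) -> cauchy_seminorm u <= e.
Proof.
move=> ue; apply: limr_le; first exact: normseq_cvg.
by exists N => // n /= /ue.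
Qed.

Definition completion := snquot cauchy_seminorm.
HB.instance Definition _ := NormedModule.on completion.

Let cst_cauchy x : (fun=> x) \in cauchy_seq_pred.
Proof.
by rewrite inE => e e0; exists 0%N => m n _ _; rewrite subrr normr0 ltW.
Qed.

Definition completion_incl (x : V) : completion :=
  snpi cauchy_seminorm (CauchySeq (cst_cauchy x)).

Lemma completion_incl_linear : linear completion_incl.
Proof.
move=> a x y; rewrite /completion_incl -linearP; congr snpi.
exact: val_inj.
Qed.

HB.instance Definition _ :=
  GRing.isLinear.Build R V completion _ completion_incl completion_incl_linear.

Lemma completion_incl_norm x : `|completion_incl x| = `|x|.
Proof.
rewrite snpi_norm; apply: cvg_lim; first exact: norm_hausdorff.
by apply: cvg_near_cst; apply: nearW.
Qed.

Lemma completion_approx (c : completion) (e : R) : 0 < e ->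
  exists x, `|c - completion_incl x| <= e.
Proof.
move=> e0; have [u ->] := snpiP c.
have [N Nu] := cauchy_seq_is_cauchy u e0.
exists (u N); rewrite -linearB snpi_norm.
by apply: (@cauchy_seminorm_le _ _ N) => n Nn; exact: Nu.
Qed.

Lemma completion_incl_dense : closure (range completion_incl) = setT.
Proof.
apply/seteqP; split=> // c _ B /nbhs_ballP[e /= e0 eB].
have [x xe] := completion_approx c (half_gt0 e0).
exists (completion_incl x); split; first by exists x.
apply: eB; rewrite -ball_normE /ball_/= (le_lt_trans xe)//.
by rewrite ltr_pdivrMr// ltr_pMr// ltr1n.
Qed.

Lemma completion_complete (F : set_system completion) :
  ProperFilter F -> cauchy F -> cvg F.
Proof.
move=> FF Fcauchy; have Fc : cauchy_ex F by exact/cauchyP.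
have FN n : exists x, F (ball (completion_incl x) (2 / n.+1%:R)).
  have n0 : 0 < n.+1%:R^-1 :> R by rewrite invr_gt0.
  have [c Fcn] := Fc _ n0.
  have [x xc] := completion_approx c n0.
  exists x; apply: filterS Fcn => y; rewrite -!ball_normE /ball_/= => cy.
  rewrite -(subrKA c) (le_lt_trans (ler_normD _ _))//.
  by rewrite mulrDl mul1r ler_ltD// distrC.
have [v Fv] := choice FN.
have vv m n : `|v m - v n| <= 2 / m.+1%:R + 2 / n.+1%:R.
  have [y [/=]] := filter_ex (filterI (Fv m) (Fv n)).
  rewrite -!ball_normE /ball_/= => my ny.
  rewrite -completion_incl_norm linearB/= -(subrKA y).
  by rewrite (le_trans (ler_normD _ _))// lerD// ltW// distrC.
have inv_small (e : R) : 0 < e -> exists N, forall n, (N <= n)%N -> 2 / n.+1%:R <= e.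
  move=> e0; exists (Num.truncn (2 / e)) => n Nn.
  rewrite ler_pdivrMr// mulrC -ler_pdivrMr//.
  by rewrite (le_trans (ltW (truncnS_gt _)))// ler_nat ltnS.
have cv : v \in cauchy_seq_pred.
  rewrite inE => e e0; have [N Ne] := inv_small _ (half_gt0 e0).
  exists N => m n Nm Nn; rewrite (le_trans (vv _ _))// [leRHS]splitr.
  by rewrite lerD// Ne.
apply/cvg_ex; exists (snpi cauchy_seminorm (CauchySeq cv)).
apply/cvgrPdist_le => e e0.
have [N Ne] := inv_small _ (half_gt0 (half_gt0 e0)).
near=> y.
rewrite -(subrKA (completion_incl (v N))) (le_trans (ler_normD _ _))//.
rewrite [leRHS]splitr lerD//.
  rewrite -linearB snpi_norm; apply: (@cauchy_seminorm_le _ _ N) => n Nn.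
  by rewrite (le_trans (vv _ _))// [leRHS]splitr lerD// Ne.
rewrite (@le_trans _ _ (2 / N.+1%:R))//.
  near: y; apply: filterS (Fv N) => y; rewrite -ball_normE /ball_/=.
  exact: ltW.
by rewrite (le_trans (Ne _ _))// ler_pdivrMr// ler_pMr ?divr_gt0// ler1n.
Unshelve. all: by end_near. Qed.

HB.instance Definition _ := Uniform_isComplete.Build completion
  completion_complete.

End Completion.

Section Lebesgue.
Context d (T : measurableType d) (R : realType).

Section Lspace.
Variables (mu : {measure set T -> \bar R}) (p : \bar R) (p1 : (1 <= p)%E).

Lemma Lnorm_ae0 (h : T -> R) : measurable_fun setT h ->
  (\forall x \ae mu, h x = 0) -> ('N[mu]_p[EFin \o h] = 0)%E.
Proof.
move=> mh h0; rewrite unlock /Lnorm; case: p p1 => [r|_|//].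
  rewrite lee_fin => r1; have r0 : 0 < r by rewrite (lt_le_trans ltr01).
  rewrite (ae_eq_integral (cst 0%E)) ?integral0 ?poweR0r ?invr_eq0 ?gt_eqF//.
    apply/measurable_EFinP/(measurableT_comp (measurable_powR _)) => //.
    exact: measurableT_comp.
  by apply: filterS h0 => x /= -> _; rewrite normr0 powR0// gt_eqF.
case: ifPn => // mu0; apply: ess_sup_ae_cst => //.
by apply: filterS h0 => x /= ->; rewrite normr0.
Qed.

Let nm (f : LfunType mu p1) : R := fine ('N[mu]_p[EFin \o f])%E.

Let nmZ (a : R) f : nm (a *: f) = `|a| * nm f.
Proof.
apply/EFin_inj; rewrite EFinM !finite_norm_fine -LnormZ.
by apply: eq_Lnorm.
Qed.

Definition Lnorm_seminorm : seminorm (LfunType mu p1) :=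
  Seminorm (@ler_LnormD d T R mu p p1) nmZ.

(* 'N[mu]_p[f] = 0 iff f = 0 mu-a.e., so the classes are the a.e. classes;
   mu.-Lspace carries no vector space structure in the library. *)
Definition Lq := snquot Lnorm_seminorm.
HB.instance Definition _ := NormedModule.on Lq.

Definition Lclass (f : LfunType mu p1) : Lq := snpi Lnorm_seminorm f.

Lemma Lclass_norm f : `|Lclass f|%:E = ('N[mu]_p[EFin \o f])%E.
Proof. by rewrite snpi_norm finite_norm_fine. Qed.

Lemma Lclass_eq f g : Lclass f = Lclass g <-> (f = g %[ae mu]).
Proof.
split.
  move=> /snpi_inj /(@fine_Lnormr_eq0 _ _ _ _ _ p1).
  by apply: filterS => x /(_ I) /eqP; rewrite subr_eq0 => /eqP + _.
move=> fg; apply: snpi_eq; apply/EFin_inj; rewrite finite_norm_fine.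
apply: Lnorm_ae0 => //.
apply: filterS fg => x /(_ I) fgx.
by rewrite [LHS](_ : _ = f x - g x)// fgx subrr.
Qed.

End Lspace.

Variable mu : probability T R.
Variables (q : \bar R) (q1 : (1 <= q)%E).

Let Linf_sub (f : LfunType mu (leey 1)) : (f : T -> R) \in Lfun mu q.
Proof.
by apply: (Lfun_subset q1 (leey 1) _ (leey q) (LfunP f)); exact: fin_num_measure.
Qed.

(* the formal inclusion of L_oo(mu) into L_q(mu), on a.e. classes *)
Definition formal_incl (a : Lq mu (leey 1)) : Lq mu q1 :=
  Lclass (Lfun_Sub q1 (Linf_sub (repr a))).

Lemma formal_inclE (f : LfunType mu (leey 1)) (g : LfunType mu q1) :
  (f = g :> (T -> R)) -> formal_incl (Lclass f) = Lclass g.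
Proof.
move=> fg; apply/Lclass_eq => /=; rewrite -fg.
by apply/Lclass_eq; rewrite /Lclass/snpi reprK.
Qed.

End Lebesgue.

HB.mixin Record isBanachLattice (R : realType) L & CompleteNormedModule R L := {
  bl_le : rel L;
  bl_join : L -> L -> L;
  bl_le_refl : reflexive bl_le;
  bl_le_anti : antisymmetric bl_le;
  bl_le_trans : transitive bl_le;
  bl_leUx : forall x y z, bl_le (bl_join x y) z = bl_le x z && bl_le y z;
  bl_leD : forall z x y, bl_le x y -> bl_le (x + z) (y + z);
  bl_leZ : forall (a : R) x y, 0 <= a -> bl_le x y -> bl_le (a *: x) (a *: y);
  bl_le_norm : forall x y,
    bl_le (bl_join x (- x)) (bl_join y (- y)) -> `|x| <= `|y|
}.

(* HB does not allow BanachLattice to inherit from Order.Lattice (this would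
   clash with the realDomainType hierarchy), so the order is declared in the
   mixin and the order.v instances are added afterwards. *)
#[short(type="banachLatticeType")]
HB.structure Definition BanachLattice (R : realType) :=
  {L of CompleteNormedModule R L & isBanachLattice R L}.

HB.instance Definition _ (R : realType) (L : banachLatticeType R) :=
  Order.Le_isPOrder.Build ring_display (BanachLattice.sort L)
    (@bl_le_refl R L) (@bl_le_anti R L) (@bl_le_trans R L).

Section LatticeInstance.
Variables (R : realType) (L : banachLatticeType R).
Implicit Types x y z : L.

Lemma bl_lerN2 x y : x <= y -> - y <= - x.
Proof.
by move=> /(bl_leD (- x - y)); rewrite addrA subrr sub0r [- x - y]addrC addNKr.
Qed.

Let meet x y : L := - bl_join (- x) (- y).

Let lexI x y z : (x <= meet y z) = (x <= y) && (x <= z).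
Proof.
have N2 (u v : L) : (u <= - v) = (v <= - u).
  by apply/idP/idP => /bl_lerN2; rewrite opprK.
have joinP (u v w : L) : (bl_join u v <= w) = (u <= w) && (v <= w) := bl_leUx u v w.
by rewrite N2 joinP -[y in RHS]opprK -[z in RHS]opprK (N2 x) (N2 x).
Qed.

HB.instance Definition _ := Order.POrder_MeetJoin_isLattice.Build ring_display
  (BanachLattice.sort L) lexI (@bl_leUx R L).

End LatticeInstance.

Section BanachLatticeTheory.
Variables (R : realType) (L : banachLatticeType R).
Implicit Types x y z : L.

Definition labs x : L := Order.join x (- x).

Lemma bl_lerD x y z t : x <= y -> z <= t -> x + z <= y + t.
Proof.
move=> /(bl_leD z) xy /(bl_leD y); rewrite [z + y]addrC [t + y]addrC.
exact: le_trans.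
Qed.

Lemma bl_subr_le0 x y : (x - y <= 0) = (x <= y).
Proof.
apply/idP/idP => [/(bl_leD y)|/(bl_leD (- y))]; first by rewrite subrK add0r.
by rewrite subrr.
Qed.

Lemma bl_ler_sum n (F G : 'I_n -> L) :
  (forall i, F i <= G i) -> \sum_i F i <= \sum_i G i.
Proof.
move=> FG; elim/big_ind2 : _ => // *; exact: bl_lerD.
Qed.

Lemma bl_sumr_ge0 n (F : 'I_n -> L) :
  (forall i, 0 <= F i) -> 0 <= \sum_i F i.
Proof.
move=> F0; elim/big_ind : _ => // u v u0 v0.
by rewrite -[leLHS]addr0 bl_lerD.
Qed.

Lemma bl_ler_wZ (a : R) x y : 0 <= a -> x <= y -> a *: x <= a *: y.
Proof. exact: bl_leZ. Qed.

Lemma bl_scale_ge0 (a : R) x : 0 <= a -> 0 <= x -> 0 <= a *: x.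
Proof. by move=> a0 /(bl_leZ a _ _ a0); rewrite scaler0. Qed.

Lemma bl_lerZr (a b : R) x : a <= b -> 0 <= x -> a *: x <= b *: x.
Proof.
move=> ab x0; rewrite -bl_subr_le0 -scalerBl -opprB scaleNr -oppr0.
by apply/bl_lerN2/bl_scale_ge0; rewrite ?subr_ge0.
Qed.

Lemma labs_ge x : x <= labs x. Proof. exact: leUl. Qed.
Lemma labs_geN x : - x <= labs x. Proof. exact: leUr. Qed.

Lemma labs_le x y : (labs x <= y) = (x <= y) && (- x <= y).
Proof. exact: leUx. Qed.

Lemma labs_ge0 x : 0 <= labs x.
Proof.
have h2 : 0 <= 2^-1 :> R by rewrite invr_ge0.
have := bl_lerD (labs_ge x) (labs_geN x); rewrite subrr -mulr2n -scaler_nat.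
by move=> /(bl_leZ _ _ _ h2); rewrite scaler0 scalerA mulVf// scale1r.
Qed.

Lemma ger0_labs x : 0 <= x -> labs x = x.
Proof.
move=> x0; apply/le_anti; rewrite labs_ge andbT labs_le lexx/=.
by rewrite (le_trans _ x0)// -[leRHS]oppr0 bl_lerN2.
Qed.

Lemma labsN x : labs (- x) = labs x.
Proof. by rewrite /labs opprK joinC. Qed.

Lemma ler_labs_norm x y : labs x <= labs y -> `|x| <= `|y|.
Proof. exact: bl_le_norm. Qed.

Lemma labs_norm x : `|labs x| = `|x|.
Proof.
have xx : labs (labs x) = labs x by rewrite ger0_labs ?labs_ge0.
by apply/le_anti/andP; split; apply: ler_labs_norm; rewrite xx.
Qed.

Lemma labs_le_norm x y : labs x <= y -> `|x| <= `|y|.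
Proof.
move=> xy; apply: ler_labs_norm.
by rewrite (le_trans xy)// labs_ge.
Qed.

Lemma bl_norm_mono x y : 0 <= x -> x <= y -> `|x| <= `|y|.
Proof. by move=> x0 xy; apply: labs_le_norm; rewrite ger0_labs. Qed.

Lemma ler_labsD x y : labs (x + y) <= labs x + labs y.
Proof.
rewrite labs_le bl_lerD ?labs_ge//= opprD.
by rewrite bl_lerD ?labs_geN.
Qed.

Lemma labsZ_le (a : R) x : labs (a *: x) <= `|a| *: labs x.
Proof.
wlog a0 : a x / 0 <= a => [h|].
  have [|/ltW a0] := leP 0 a; first exact: h.
  rewrite -normrN -[x]opprK scalerN -scaleNr [labs (- - x)]labsN.
  by apply: h; rewrite oppr_ge0.
by rewrite ger0_norm// labs_le -scalerN !bl_ler_wZ ?labs_ge ?labs_geN.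
Qed.

Lemma ler_labs_sum n (a : 'I_n -> R) (y : 'I_n -> L) :
  labs (\sum_i a i *: y i) <= \sum_i `|a i| *: labs (y i).
Proof.
elim/big_ind2 : _ => [|u v s t uv st|i _]; last exact: labsZ_le.
  by rewrite ger0_labs.
by rewrite (le_trans (ler_labsD _ _))// bl_lerD.
Qed.

Lemma bl_le0_approx x :
  (forall e : R, 0 < e -> exists2 d, x <= d & `|d| <= e) -> x <= 0.
Proof.
move=> xd; suff : Order.join x 0 = 0 by move=> <-; exact: leUl.
apply/eqP; rewrite -normr_le0; apply/ler_addgt0Pl => e e0; rewrite addr0.
have [d xled] := xd _ e0; apply: le_trans.
rewrite -(labs_norm d) bl_norm_mono ?leUr// leUx labs_ge0 andbT.
exact: le_trans (labs_ge d).
Qed.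

End BanachLatticeTheory.

Section LatticeSupremum.
Variables (R : realType) (L : banachLatticeType R).

Lemma finite_net n (K : set ('I_n -> R)) (M e : R) :
  K !=set0 -> (forall k, K k -> forall i, `|k i| <= M) -> 0 < e ->
  exists s : seq ('I_n -> R), (forall k, List.In k s -> K k) /\
    forall k, K k -> exists2 k', List.In k' s & forall i, `|k i - k' i| <= e.
Proof.
move=> [k0 Kk0] KM e0.
pose N := Num.truncn (2 * M / e).
pose cell (k : 'I_n -> R) : {ffun 'I_n -> 'I_N.+1} :=
  [ffun i => inord (Num.truncn ((k i + M) / e))].
pose pick c := xget k0 [set k | K k /\ cell k = c].
exists (map pick (enum {ffun 'I_n -> 'I_N.+1})); split.
  elim: (enum _) => //= c s IH k [<-|/IH//].
  by rewrite /pick; case: xgetP => // y _ [].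
move=> k Kk; exists (pick (cell k)).
  have : cell k \in enum {ffun 'I_n -> 'I_N.+1} by rewrite mem_enum.
  elim: (enum _) => //= c s IH; rewrite inE => /predU1P[->|/IH]; first by left.
  by right.
rewrite /pick; case: xgetP => [k' _ [Kk' kk'] i|/(_ k)[]//].
have pos k1 : K k1 -> 0 <= (k1 i + M) / e.
  move=> Kk1; rewrite divr_ge0 ?(ltW e0)// -lerBlDr sub0r.
  by have := KM _ Kk1 i; rewrite ler_norml => /andP[].
have small k1 : K k1 -> (Num.truncn ((k1 i + M) / e) < N.+1)%N.
  move=> Kk1; rewrite ltnS; apply: le_truncn.
  rewrite ler_pM2r ?invr_gt0// mulr2n mulrDl mul1r lerD2r.
  by have := KM _ Kk1 i; rewrite ler_norml => /andP[].
have : Num.truncn ((k i + M) / e) = Num.truncn ((k' i + M) / e).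
  move/ffunP/(_ i) : kk'; rewrite !ffunE => /(congr1 val).
  by rewrite /= !inordK ?small// => ->.
move=> tt; have := truncn_itv (pos _ Kk); have := truncn_itv (pos _ Kk').
rewrite -tt => /andP[a1 a2] /andP[b1 b2].
have -> : k i - k' i = e * ((k i + M) / e - (k' i + M) / e).
  by rewrite -mulrBl mulrCA divff ?gt_eqF// mulr1 opprD addrACA subrr addr0.
rewrite normrM (gtr0_norm e0) ler_piMr ?(ltW e0)//.
rewrite ler_norml; move: a1 a2 b1 b2; rewrite -!natr1; lra.
Qed.

Lemma supremums_exist n (K : set ('I_n -> R)) (M : R)
    (h : ('I_n -> R) -> L) (y : 'I_n -> L) :
  K !=set0 -> (forall k, K k -> forall i, `|k i| <= M) ->
  (forall k k', K k -> K k' ->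
     h k <= h k' + \sum_i `|k i - k' i| *: labs (y i)) ->
  supremums (h @` K) !=set0.
Proof.
move=> K0 KM hK; have [k0 Kk0] := K0.
pose w := \sum_i labs (y i).
pose e m : R := m.+1%:R^-1.
have e0 m : 0 < e m by rewrite invr_gt0.
have [s sK] := choice (fun m => finite_net K0 KM (e0 m)).
pose g m := foldr (fun k z => Order.join (h k) z) (h k0) (s m).
have gE m u : (g m <= u) <-> (h k0 <= u /\ forall k, List.In k (s m) -> h k <= u).
  rewrite /g; elim: (s m) => [|k t IH] /=; first by split => [|[]].
  rewrite leUx; split.
    by move=> /andP[hk /IH[h0 ht]]; split => // k' [<-|/ht].
  move=> [h0 ht]; rewrite ht; last by left.
  by apply/IH; split => // k' k't; apply: ht; right.
have g_ub m k : K k -> h k <= g m + e m *: w.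
  move=> Kk; have [sKm /(_ _ Kk)[k' k's kk']] := sK m.
  rewrite (le_trans (hK k k' Kk (sKm _ k's)))// bl_lerD//.
    by have /gE[_] := lexx (g m); exact.
  rewrite scaler_sumr; apply: bl_ler_sum => i.
  by rewrite bl_lerZr ?labs_ge0.
have g_lub m u : ubound (h @` K) u -> g m <= u.
  move=> uK; apply/gE; split=> [|k /(sK m).1 Kk]; apply: uK.
    by exists k0.
  by exists k.
have w0 : 0 <= w by apply: bl_sumr_ge0 => i; exact: labs_ge0.
have gg m j : g m - g j <= (e m + e j) *: w.
  rewrite -bl_subr_le0 -[_ - _]addrA -opprD bl_subr_le0.
  rewrite (@le_trans _ _ (g j + e j *: w))//.
    by apply: g_lub => _ [k Kk <-]; exact: g_ub.
  by rewrite bl_lerD// bl_lerZr// lerDr ltW.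
have gg_norm m j : `|g m - g j| <= (e m + e j) * `|w|.
  rewrite -[e m + e j]ger0_norm ?addr_ge0 ?(ltW (e0 _))// -normrZ.
  by apply: labs_le_norm; rewrite labs_le opprB gg andTb [e m + _]addrC; exact: gg.
have e_small (r : R) : 0 < r -> exists N, forall m, (N <= m)%N -> e m * `|w| <= r.
  move=> r0; exists (Num.truncn (`|w| / r)) => m Nm.
  rewrite /e mulrC ler_pdivrMr// mulrC -ler_pdivrMr//.
  by rewrite (le_trans (ltW (truncnS_gt _)))// ler_nat ltnS.
have half (r : R) : 0 < r -> 0 < r / 2 by move=> r0; rewrite divr_gt0.
have : cvgn g.
  apply/cauchy_cvgP/cauchy_exP => r r0; have [N Nr] := e_small _ (half _ (half _ r0)).
  exists (g N); exists N => // m /= Nm.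
  rewrite -ball_normE /ball_/= (le_lt_trans (gg_norm _ _))// mulrDl.
  rewrite (le_lt_trans (lerD (Nr _ (leqnn _)) (Nr _ Nm)))// -splitr.
  by rewrite ltr_pdivrMr// ltr_pMr// ltr1n.
move=> /cvg_ex[l gl].
have near_l (r : R) : 0 < r -> exists m, `|g m - l| <= r /\ e m * `|w| <= r.
  move=> r0; have [N Nr] := e_small _ r0.
  have /cvgrPdist_le/(_ _ r0)[N' _ N'r] := gl.
  exists (maxn N N'); split; last by rewrite Nr// leq_maxl.
  by rewrite distrC N'r//= leq_maxr.
exists l; split.
  move=> _ [k Kk <-]; rewrite -bl_subr_le0; apply: bl_le0_approx => r r0.
  have [m [ml mw]] := near_l _ (half _ r0).
  exists ((g m - l) + e m *: w).
    by rewrite addrAC bl_lerD// g_ub.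
  rewrite (le_trans (ler_normD _ _))// [leRHS]splitr lerD//.
  by rewrite normrZ gtr0_norm.
move=> u uK; rewrite -bl_subr_le0; apply: bl_le0_approx => r r0.
have [m [ml mw]] := near_l _ r0.
exists (l - g m); last by rewrite distrC.
by rewrite bl_lerD// bl_lerN2// g_lub.
Qed.

Lemma supremumP (A : set L) :
  A !=set0 -> supremums A !=set0 -> supremums A (supremum 0 A).
Proof.
move=> A0 [l Al]; rewrite /supremum; case: ifPn => [/eqP AE|_].
  by case: A0; rewrite AE.
by case: xgetP => // /(_ l).
Qed.

End LatticeSupremum.

Section FiniteSums.
Variable R : realType.

Definition lpnorm (p : \bar R) n (a : 'I_n -> R) : R :=
  match p with
  | r%:E => (\sum_i `|a i| `^ r) `^ r^-1
  | _ => \big[Num.max/0]_i `|a i|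
  end.

Lemma lpnorm_coord (p : \bar R) n (a : 'I_n -> R) i :
  (1 <= p)%E -> `|a i| <= lpnorm p a.
Proof.
case: p => [r|_|//] /=; last exact: le_bigmax.
rewrite lee_fin => r1; have r0 : 0 < r by rewrite (lt_le_trans ltr01).
rewrite -[leLHS]powRr1// -[X in _ `^ X](@mulfV _ r) ?gt_eqF// powRrM.
rewrite ge0_ler_powR ?nnegrE ?powR_ge0 ?invr_ge0 ?(ltW r0)//.
  by rewrite sumr_ge0// => j _; exact: powR_ge0.
by rewrite (bigD1 i)//= lerDl sumr_ge0// => j _; exact: powR_ge0.
Qed.

Variable L : banachLatticeType R.

(* (\sum_i |x_i|^p)^(1/p) in L. For p < oo it is given by Krivine's formula,
   the least upper bound of the \sum_i a_i x_i with (\sum_i |a_i|^p')^(1/p') <= 1,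
   1/p + 1/p' = 1; this supremum exists by lattice_lp_supremums. *)
Definition lattice_lp_set (p : \bar R) n (x : 'I_n -> L) : set L :=
  [set \sum_i a i *: x i | a in [set a : 'I_n -> R |
    lpnorm (hoelder_conjugate p) a <= 1]].

Definition lattice_lp (p : \bar R) n (x : 'I_n -> L) : L :=
  match p with
  | r%:E => supremum 0 (lattice_lp_set r%:E x)
  | _ => \big[Order.join/0]_i labs (x i)
  end.

Lemma lattice_lp_supremums (p : \bar R) n (x : 'I_n -> L) :
  (1 <= p)%E -> supremums (lattice_lp_set p x) (supremum 0 (lattice_lp_set p x)).
Proof.
move=> p1; have q1 := hoelder_conj_ge1 p1.
have K0 : [set a : 'I_n -> R | lpnorm (hoelder_conjugate p) a <= 1] !=set0.
  exists (fun=> 0) => /=; case: (hoelder_conjugate p) q1 => [r|_|//] /=.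
    rewrite lee_fin => r1; have r0 : r != 0 by rewrite gt_eqF// (lt_le_trans ltr01).
    by rewrite big1 ?powR0 ?invr_eq0// => i _; rewrite normr0 powR0.
  by apply: bigmax_le => // i _; rewrite normr0.
apply: supremumP; first by case: K0 => a Ka; exists (\sum_i a i *: x i), a.
apply: (supremums_exist (M := 1) (y := x) K0) => [a /= Ka i|a b Ka Kb].
  exact: le_trans (lpnorm_coord _ _ q1) Ka.
have -> : \sum_i a i *: x i = \sum_i b i *: x i + \sum_i (a i - b i) *: x i.
  by rewrite -big_split/=; apply: eq_bigr => i _; rewrite -scalerDl addrC subrK.
by rewrite bl_lerD// (le_trans (labs_ge _))// ler_labs_sum.
Qed.

End FiniteSums.

Section LatticeTensor.
Variables (R : realType) (L : banachLatticeType R) (X : normedModType R).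

(* X (x) L, realised inside the operators from X^* to L: \sum_j x_j (x) y_j is
   the map phi |-> \sum_j phi(x_j) y_j. This identification is injective because
   X^* separates the points of X. *)
Definition tensor_pred : {pred dual X -> L} := mem [set u |
  exists n (x : 'I_n -> X) (y : 'I_n -> L),
    u = fun phi => \sum_j (phi : dual X) (x j) *: y j].

Record tensor := Tensor {
  tensor_fun :> dual X -> L; tensorP : tensor_fun \in tensor_pred }.

HB.instance Definition _ := [isSub for tensor_fun].
HB.instance Definition _ := gen_eqMixin tensor.
HB.instance Definition _ := gen_choiceMixin tensor.

Lemma tensor_submod_closed : submod_closed tensor_pred.
Proof.
split.
  rewrite inE; exists 0%N, (fun=> 0), (fun=> 0); apply/funext => phi.
  by rewrite big_ord0.
move=> a u v /[!inE] -[n [x [y ->]]] [m [x' [y' ->]]].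
exists (n + m)%N, (fun i => match fintype.split i with inl j => x j | inr j => x' j end),
  (fun i => match fintype.split i with inl j => a *: y j | inr j => y' j end).
apply/funext => phi; rewrite big_split_ord/=.
rewrite [LHS](_ : _ = a *: (\sum_j phi (x j) *: y j) + \sum_j phi (x' j) *: y' j)//.
congr (_ + _); last first.
  by apply: eq_bigr => j _; rewrite (unsplitK (inr j)).
rewrite scaler_sumr; apply: eq_bigr => j _.
by rewrite (unsplitK (inl j)) !scalerA mulrC.
Qed.

HB.instance Definition _ := GRing.isSubmodClosed.Build R (dual X -> L)
  tensor_pred tensor_submod_closed.
HB.instance Definition _ := [SubChoice_isSubLmodule of tensor by <:].

Let elem_tensor (x : X) (y : L) :
  (fun phi : dual X => phi x *: y) \in tensor_pred.
Proof.
rewrite inE; exists 1%N, (fun=> x), (fun=> y); apply/funext => phi.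
by rewrite big_ord1.
Qed.

Definition tens (x : X) (y : L) : tensor := Tensor (elem_tensor x y).

Lemma tens_sumE n (x : 'I_n -> X) (y : 'I_n -> L) (phi : dual X) :
  (\sum_j tens (x j) (y j)) phi = \sum_j phi (x j) *: y j.
Proof.
pose ev := fun u : tensor => u phi.
by apply: (big_morph ev) => // u v.
Qed.

Lemma tensorE (u : tensor) : exists n (x : 'I_n -> X) (y : 'I_n -> L),
  u = \sum_j tens (x j) (y j).
Proof.
have := tensorP u; rewrite inE => -[n [x [y uE]]]; exists n, x, y.
by apply/val_inj/funext => phi; rewrite [RHS]tens_sumE [LHS]/= uE.
Qed.

Definition tensor_set (u : dual X -> L) : set L :=
  [set labs (u phi) | phi in [set phi : dual X | `|phi| <= 1]].

Lemma tensor_supremums (u : tensor) :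
  supremums (tensor_set u) (supremum 0 (tensor_set u)).
Proof.
apply: supremumP; first by exists (labs (u 0)), 0 => //=; rewrite normr0.
have [n [x [y ->]]] := tensorE u.
pose K := [set k : 'I_n -> R | exists2 phi : dual X, `|phi| <= 1 &
  k = fun j => phi (x j)].
have -> : tensor_set (\sum_j tens (x j) (y j)) =
    (fun k : 'I_n -> R => labs (\sum_j k j *: y j)) @` K.
  apply/seteqP; split => z.
    by move=> [phi p1 <-]; rewrite tens_sumE; exists (fun j => phi (x j)) => //; exists phi.
  by move=> [_ [phi p1 ->] <-]; exists phi => //; rewrite tens_sumE.
apply: (supremums_exist (M := \sum_j `|x j|) (y := y)).
- by exists (fun=> 0), 0 => //; rewrite normr0.
- move=> _ [phi p1 ->] i; rewrite (le_trans (bop_norm_le _ _))//.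
  rewrite (@le_trans _ _ `|x i|) ?ler_piMl//.
  by rewrite (bigD1 i)//= lerDl sumr_ge0.
- move=> k k' _ _.
  have -> : \sum_i k i *: y i = \sum_i k' i *: y i + \sum_i (k i - k' i) *: y i.
    by rewrite -big_split/=; apply: eq_bigr => i _; rewrite -scalerDl addrC subrK.
  by rewrite (le_trans (ler_labsD _ _))// bl_lerD// ler_labs_sum.
Qed.

(* The supremum exists by tensor_supremums; tensor_normE spells the norm out. *)
Definition tensor_sup (u : tensor) : L := supremum 0 (tensor_set u).
Definition tensor_norm (u : tensor) : R := `|tensor_sup u|.

Let sup_ge (u : tensor) phi : `|phi| <= 1 -> labs (u phi) <= tensor_sup u.
Proof. by move=> p1; apply: (tensor_supremums u).1; exists phi. Qed.

Let sup_le (u : tensor) z :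
  (forall phi, `|phi| <= 1 -> labs (u phi) <= z) -> tensor_sup u <= z.
Proof. by move=> uz; apply: (tensor_supremums u).2 => _ [phi /uz + <-]. Qed.

Let sup_ge0 u : 0 <= tensor_sup u.
Proof.
by apply: le_trans (labs_ge0 _) (sup_ge u (phi := 0) _); rewrite normr0.
Qed.

Let tensor_normD u v : tensor_norm (u + v) <= tensor_norm u + tensor_norm v.
Proof.
apply: le_trans (ler_normD _ _); apply: bl_norm_mono => //.
apply: sup_le => phi p1.
by rewrite (le_trans (ler_labsD (u phi) (v phi)))// bl_lerD// sup_ge.
Qed.

Let tensor_normZ_le (a : R) u : tensor_norm (a *: u) <= `|a| * tensor_norm u.
Proof.
rewrite -[`|a|]normr_id -normrZ; apply: bl_norm_mono => //.
apply: sup_le => phi p1.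
by rewrite (le_trans (labsZ_le a (u phi)))// bl_ler_wZ// sup_ge.
Qed.

Let tensor_normZ (a : R) u : tensor_norm (a *: u) = `|a| * tensor_norm u.
Proof.
apply/le_anti; rewrite tensor_normZ_le andTb.
have [->|a0] := eqVneq a 0; first by rewrite normr0 mul0r; exact: normr_ge0.
rewrite -ler_pdivlMl ?normr_gt0// -normfV.
by rewrite -[in leLHS](scalerK a0 u); exact: tensor_normZ_le.
Qed.

Let tensor_norm_eq0 u : tensor_norm u = 0 -> u = 0.
Proof.
move=> /eqP; rewrite normr_eq0 => /eqP s0.
have u0 phi : `|phi| <= 1 -> u phi = 0.
  move=> /(sup_ge u); rewrite s0 => u0.
  by apply/eqP; rewrite -normr_le0 -[leRHS](@normr0 _ L) labs_le_norm.
have [n [x [y uE]]] := tensorE u.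
apply/val_inj/funext => phi; rewrite [RHS](_ : _ = 0)//.
have p0 : 0 < 1 + `|phi| by rewrite ltr_pwDl.
pose c : R := 1 + `|phi|.
have uc : u (c^-1 *: phi) = 0.
  apply: u0; rewrite normrZ normfV gtr0_norm// ler_pdivrMl// mulr1.
  by rewrite lerDr.
suff uphi : u phi = c *: u (c^-1 *: phi) by rewrite uc scaler0 in uphi.
rewrite uE !tens_sumE scaler_sumr; apply: eq_bigr => j _.
by rewrite bop_scaleE !scalerA mulrA mulfV ?gt_eqF// mul1r.
Qed.

HB.instance Definition _ :=
  Lmodule_isNormed.Build R tensor tensor_normD tensor_normZ tensor_norm_eq0.

Lemma tensor_normE n (x : 'I_n -> X) (y : 'I_n -> L) :
  `|\sum_j tens (x j) (y j)| =
  `|supremum 0 [set labs (\sum_j phi (x j) *: y j) |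
     phi in [set phi : dual X | `|phi| <= 1]]|.
Proof.
have <- : tensor_set (\sum_j tens (x j) (y j)) =
    [set labs (\sum_j phi (x j) *: y j) |
      phi in [set phi : dual X | `|phi| <= 1]].
  by apply: eq_imagel => phi _; rewrite tens_sumE.
by [].
Qed.

(* the Banach space L(X) *)
Definition lattice_ext := completion tensor.
HB.instance Definition _ := CompleteNormedModule.on lattice_ext.

End LatticeTensor.

Section SummingNorm.
Variables (R : realType) (U V : normedModType R).

Definition weak_lpnorm (p : \bar R) n (u : 'I_n -> U) : \bar R :=
  ereal_sup [set (lpnorm p (fun i => phi (u i)))%:E |
    phi in [set phi : dual U | `|phi| <= 1]].

(* +oo when S is not p-summing; the operator norm for p = +oo *)
Definition summing_norm (p : \bar R) (S : bop U V) : \bar R :=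
  match p with
  | r%:E => ereal_inf [set K%:E | K in [set K : R | 0 <= K /\
      forall n (u : 'I_n -> U),
        ((lpnorm r%:E (fun i => `|S (u i)|))%:E <= K%:E * weak_lpnorm r%:E u)%E]]
  | _ => `|S|%:E
  end.

End SummingNorm.

Section IntegralNorm.
Variables (R : realType) (Z X : normedModType R).

Definition gamma_infty (T : bop Z X) : \bar R :=
  ereal_inf [set c | exists d (S : measurableType d)
    (mu : {measure set S -> \bar R})
    (A : bop Z (Lq mu (leey 1))) (B : bop (Lq mu (leey 1)) X),
    (forall z, T z = B (A z)) /\ c = (`|A| * `|B|)%:E].

(* +oo when T is not strictly q-integral *)
Definition integral_norm (q : \bar R) (q1 : (1 <= q)%E) (T : bop Z X) : \bar R :=
  if q == +oo%E then gamma_infty T else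
  ereal_inf [set c | exists d (S : measurableType d) (mu : probability S R)
    (A : bop Z (Lq mu (leey 1))) (B : bop (Lq mu q1) X),
    (forall z, T z = B (formal_incl q1 (A z))) /\ c = (`|A| * `|B|)%:E].

End IntegralNorm.

Section GordonLewis.
Variables (R : realType) (p q : \bar R) (q1 : (1 <= q)%E).

(* The condition 0 <= C only matters for X = 0. *)
Definition GL_bound (X : completeNormedModType R) : set R :=
  [set C | 0 <= C /\
    forall (Z : completeNormedModType R) (T : bop Z X), finite_rank T ->
      (integral_norm q1 T <= C%:E * summing_norm p (adjoint T))%E].

Definition has_GL (X : completeNormedModType R) := exists C, GL_bound X C.

Definition GL_const (X : completeNormedModType R) : \bar R :=
  ereal_inf [set C%:E | C in GL_bound X].

End GordonLewis.

Section ConvexityConcavity.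
Variables (R : realType) (p : \bar R) (L : banachLatticeType R).

Definition convexity_bound : set R :=
  [set K | 0 <= K /\ forall n (x : 'I_n -> L),
    `|lattice_lp p x| <= K * lpnorm p (fun i => `|x i|)].

Definition concavity_bound : set R :=
  [set K | 0 <= K /\ forall n (x : 'I_n -> L),
    lpnorm p (fun i => `|x i|) <= K * `|lattice_lp p x|].

Definition convex_lattice := exists K, convexity_bound K.
Definition concave_lattice := exists K, concavity_bound K.

Definition convexity_const : \bar R := ereal_inf [set K%:E | K in convexity_bound].
Definition concavity_const : \bar R := ereal_inf [set K%:E | K in concavity_bound].

End ConvexityConcavity.

(* Main.v *)
Require Import Defs.
From HB Require Import structures.
From mathcomp Require Import all_boot all_order all_algebra.
From mathcomp Require Import all_classical all_reals all_analysis.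
From mathcomp Require Import measurable_realfun ess_sup_inf lra ring.
Import Order.TTheory GRing.Theory Num.Theory.
Import numFieldNormedType.Exports.
Set Implicit Arguments.
Unset Strict Implicit.
Unset Printing Implicit Defensive.
Local Open Scope classical_set_scope.
Local Open Scope ring_scope.

(** Let T be a finite rank operator from Z to L(X); up to a small perturbation
    its values are finite sums of x_j (x) y_j.  In the C(K)-representation of
    the ideal of e = \sum_j |y_j| one may regard T as a function s |-> T_s with
    values in the operators from Z to X.  A partition of unity (g_k) of e,
    fine enough that the y_j are nearly equal to constants t_kj near the support
    of g_k, gives T ~ \sum_k T_k (x) g_k with T_k = \sum_j t_kj zeta_j (x) x_j.

    Put w = \sum_k C pi_p(T_k^* ) g_k.  If T_k = B_k j A_k with A_k of norm 1 and
    |B_k| <= C pi_p(T_k^* ), these factorizations are glued on the disjoint union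
    of the measure spaces, the weights being supplied by a Maurey factorization
    of a |-> \sum_k a_k C pi_p(T_k^* ) g_k from l_oo^n to the q-concave lattice L;
    this gives i_q(T) <= K_q |w|.

    Conversely |w| = lam(w) for a positive functional lam of norm 1, which splits
    as \sum_k lam_k with lam_k concentrated where T ~ T_k.  Testing pi_p(T^* ) on
    the functionals x^* (x) lam_k, a minimax argument yields u_l in the unit ball
    of L(X) and weights c_l with
      pi_p(T_k^* ) lam_k(e) <= lam_k((\sum_l c_l |u_l|^p)^(1/p)) pi_p(T^* )
    up to a small error, and p-convexity gives |w| <= C K^p pi_p(T^* ).  The points
    of K are only needed to prove inequalities in L; they are obtained as lattice
    homomorphisms from a Hahn-Banach theorem preserving suprema. *)


(** * Hahn-Banach theorems *)

(** The property [GL(p, q)] concerns one operator into X at a time, and factorizations chosen at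
    different points s need not fit together measurably; hence the reduction to finitely many T_k.
    On an abstract lattice, concentration of lam_k is imposed by a penalty: lam is split so as to
    attain its value at the supremum of the elements phi_k e - M err_k, where phi_k = C pi_p(T_k^* )
    + eta and err_k = \sum_j |y_j - t_kj e|. Comparing this value with lam(w) >= 0, while the phi_k
    are bounded independently of the partition, gives \sum_k lam_k(err_k) = O(1 / M). The minimax is
    forced by the need for one element of L that serves all k, so that p-convexity is used once. It
    and the Maurey factorization both follow from the same theorem of the alternative for cones in
    R^n. *)

Section HahnBanach.
Variables (R : realType) (V : lmodType R).
Implicit Types (P : V -> R) (v w x : V).

Definition sublinear P :=
  (forall v w, P (v + w) <= P v + P w) /\
  (forall (c : R) v, 0 < c -> P (c *: v) <= c * P v).

Lemma sublinearZ P c v : sublinear P -> 0 < c -> P (c *: v) = c * P v.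
Proof.
move=> [_ PZ] c0; apply/le_anti; rewrite PZ//=.
rewrite -ler_pdivlMl//.
by rewrite -{1}(scalerK (lt0r_neq0 c0) v) PZ// invr_gt0.
Qed.

Lemma sublinear0 P : sublinear P -> P 0 = 0.
Proof.
move=> sP; have := sublinearZ 0 sP (ltr0n R 2); rewrite scaler0; lra.
Qed.

Lemma sublinearZ0 P c v : sublinear P -> 0 <= c -> P (c *: v) = c * P v.
Proof.
move=> sP; rewrite le_eqVlt => /predU1P[<-|]; last exact: sublinearZ.
by rewrite scale0r mul0r sublinear0.
Qed.

Lemma sublinear_ge P v : sublinear P -> - P (- v) <= P v.
Proof.
move=> sP; have := sP.1 v (- v).
by rewrite subrr sublinear0//; lra.
Qed.

(** The largest sublinear functional below [P] whose value at [- x] is at most [- P x]. *)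
Definition shift P x v :=
  inf [set P (v + t *: x) - t * P x | t in [set t : R | 0 <= t]].

Section Shift.
Variables (P : V -> R) (x : V).
Hypothesis sP : sublinear P.

Let shift_lb v : has_lbound [set P (v + t *: x) - t * P x | t in [set t : R | 0 <= t]].
Proof.
exists (- P (- v)) => _ [t /= t0 <-].
have := sP.1 (v + t *: x) (- v); rewrite addrAC subrr add0r sublinearZ0//; lra.
Qed.

Let shift_ne v : [set P (v + t *: x) - t * P x | t in [set t : R | 0 <= t]] !=set0.
Proof. by exists (P (v + 0 *: x) - 0 * P x), 0 => /=. Qed.

Lemma shift_le t v : 0 <= t -> shift P x v <= P (v + t *: x) - t * P x.
Proof. by move=> t0; apply: ge_inf => //; exists t. Qed.

Lemma le_shift a v : (forall t, 0 <= t -> a <= P (v + t *: x) - t * P x) ->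
  a <= shift P x v.
Proof. by move=> h; apply: lb_le_inf => // _ [t /= /h + <-]. Qed.

Lemma shift_lt a v : shift P x v < a ->
  exists2 t, 0 <= t & P (v + t *: x) - t * P x < a.
Proof.
by move=> h; have [_ [t t0 <-] ta] := inf_lt (shift_ne v) h; exists t.
Qed.

Lemma shift_le_self v : shift P x v <= P v.
Proof.
by have := shift_le v (lexx 0); rewrite scale0r addr0 mul0r subr0.
Qed.

Lemma shift_opp : shift P x (- x) <= - P x.
Proof.
have := shift_le (- x) ler01.
by rewrite scale1r addNr sublinear0// mul1r add0r.
Qed.

(** Subadditivity applied to [(s - t) *: x]. Near-minimisers for several vectors can thus be
    replaced by a common larger [t]. *)
Lemma shift_mono t s v : t <= s ->
  P (v + s *: x) - s * P x <= P (v + t *: x) - t * P x.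
Proof.
move=> ts; have := sP.1 (v + t *: x) ((s - t) *: x).
rewrite -addrA -scalerDl [t + _]addrC subrK sublinearZ0 ?subr_ge0//; lra.
Qed.

Lemma shift_sublinear : sublinear (shift P x).
Proof.
split=> [v w|c v c0].
  rewrite -lerBlDr; apply: le_shift => t t0; rewrite lerBlDr -lerBlDl.
  apply: le_shift => s s0; rewrite lerBlDr.
  apply: le_trans (shift_le _ (addr_ge0 t0 s0)) _.
  have := sP.1 (v + t *: x) (w + s *: x).
  rewrite addrACA -scalerDl; lra.
rewrite -ler_pdivrMl//; apply: le_shift => t t0.
rewrite ler_pdivrMl// mulrBr -(sublinearZ _ sP c0) scalerDr scalerA mulrA.
by apply: shift_le; rewrite mulr_ge0// ltW.
Qed.

End Shift.

Variable J : V -> V -> V -> Prop.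
Hypothesis Jshift : forall f g m x, J f g m -> J (f + x) (g + x) (m + x).

(** [J f g m] stands for [m] being the join of [f] and [g]; translation invariance is all that is
    asked of it. The empty relation gives the ordinary Hahn-Banach theorem. *)
Definition join_compat P := forall f g m, J f g m -> P m <= Num.max (P f) (P g).

(** With [t] for [f] and [s] for [g], both strict bounds persist at [Num.max t s], and there
    [Jshift] reduces the claim to the inequality for [P]. *)
Lemma shift_join P x : sublinear P -> join_compat P -> join_compat (shift P x).
Proof.
move=> sP JP f g m Jm; rewrite leNgt; apply/negP; rewrite gt_max => /andP[].
move=> /shift_lt[t t0 tf] /shift_lt[s s0 sg].
have u0 : 0 <= Num.max t s by rewrite le_max t0.
have := shift_le x sP m u0.
have tm : t <= Num.max t s by rewrite le_max lexx.
have sm : s <= Num.max t s by rewrite le_max lexx orbT.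
have := shift_mono x sP f tm; have := shift_mono x sP g sm.
have := JP _ _ _ (Jshift (Num.max t s *: x) Jm).
rewrite le_max => /orP[]; lra.
Qed.

(** Zorn's lemma among the join-compatible sublinear functionals below [P0]: both properties survive
    [shift] and infima of chains. A minimal one equals each of its shifts, hence is odd, hence
    linear. The bound at [- x0], kept along the way, forces [F x0 = P0 x0]. *)
Theorem hahn_banach_join P0 x0 : sublinear P0 -> join_compat P0 ->
  exists F : V -> R, [/\ linear F, forall v, F v <= P0 v, F x0 = P0 x0 &
    join_compat F].
Proof.
move=> sP0 JP0.
pose good P := [/\ sublinear P, join_compat P, forall v, P v <= P0 v &
  P (- x0) <= - P0 x0].
have good0 : good (shift P0 x0).
  split; [exact: shift_sublinear|exact: shift_join|exact: shift_le_self|].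
  exact: shift_opp.
pose T := {P | good P}.
(* The order is reversed, so that a maximal element is a minimal functional. *)
pose le (P Q : T) := `[< forall v, sval Q v <= sval P v >].
have [||A Atot|[P Pgood] Pmax] := @ZL_preorder T (exist _ _ good0) le.
- by move=> P; apply/asboolP.
- move=> P Q S /asboolP PQ /asboolP QS; apply/asboolP => v.
  exact: le_trans (QS v) (PQ v).
- have [[Q AQ]|A0] := pselect (A !=set0); last first.
    by exists (exist _ _ good0) => s As; case: A0; exists s.
  pose E v := [set sval P v | P in A].
  have E0 v : E v !=set0 by exists (sval Q v), Q.
  have Elb v : has_lbound (E v).
    exists (- P0 (- v)) => _ [[S [sS JS S0 Sx]] AS <-] /=.
    by apply: le_trans (sublinear_ge v sS); rewrite lerN2.
  have Ele S v : A S -> inf (E v) <= sval S v.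
    by move=> AS; apply: ge_inf => //; exists S.
  have le_infE a v : (forall S, A S -> a <= sval S v) -> a <= inf (E v).
    by move=> h; apply: lb_le_inf => // _ [S /h + <-].
  have dir S S' : A S -> A S' -> exists2 U, A U &
      (forall v, sval U v <= sval S v) /\ (forall v, sval U v <= sval S' v).
    move=> AS AS'; have [/asboolP h|/asboolP h] := Atot _ _ AS AS'.
      by exists S'.
    by exists S.
  have goodE : good (fun v => inf (E v)).
    split.
    + split=> [v w|c v c0] /=.
        rewrite -lerBlDr; apply/le_infE => S AS; rewrite lerBlDr -lerBlDl.
        apply/le_infE => S' AS'; rewrite lerBlDr.
        have [U AU [US US']] := dir _ _ AS AS'.
        apply: le_trans (Ele _ _ AU) _; have [[sU _] _ _ _] := svalP U.
        rewrite addrC; apply: le_trans (sU _ _) _.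
        by rewrite lerD.
      rewrite -ler_pdivrMl//; apply/le_infE => S AS; rewrite ler_pdivrMl//.
      apply: le_trans (Ele _ _ AS) _; have [[_ sS] _ _ _] := svalP S.
      exact: sS.
    + move=> f g m Jm; rewrite leNgt; apply/negP; rewrite gt_max => /andP[].
      move=> /(inf_lt (E0 f))[_ [S AS <-] Sf] /(inf_lt (E0 g))[_ [S' AS' <-] Sg].
      have [U AU [US US']] := dir _ _ AS AS'; have [_ JU _ _] := svalP U.
      have := Ele _ m AU; have := JU _ _ _ Jm; have := US f; have := US' g.
      rewrite le_max => h1 h2 /orP[]; lra.
    + by move=> v; apply: le_trans (Ele _ _ AQ) _; have [_ _ +] := svalP Q.
    + by apply: le_trans (Ele _ _ AQ) _; have [_ _ +] := svalP Q.
  by exists (exist _ _ goodE) => S AS; apply/asboolP => v; apply: Ele.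
case: (Pgood) => sP JP PP0 Px.
have Podd x : P (- x) = - P x.
  have gs : good (shift P x).
    split; [exact: shift_sublinear|exact: shift_join| |].
      by move=> v; apply: le_trans (shift_le_self _ sP v) _.
    exact: le_trans (shift_le_self _ sP _) Px.
  have sh : le (exist _ _ Pgood) (exist _ _ gs).
    by apply/asboolP => v; exact: shift_le_self.
  have /asboolP/(_ (- x)) h := Pmax _ sh.
  apply/le_anti/andP; split.
    exact: le_trans h (shift_opp _ sP).
  by have := sublinear_ge (- x) sP; rewrite opprK.
have PD v w : P (v + w) = P v + P w.
  apply/le_anti; rewrite sP.1/=.
  have := sP.1 (v + w) (- w); rewrite addrK Podd; lra.
exists P; split=> //.
- move=> c v w; rewrite PD; congr (_ + _).
  have [c0|/ltW c0] := leP 0 c; first exact: sublinearZ0.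
  have nc0 : 0 <= - c by rewrite oppr_ge0.
  by have := sublinearZ0 v sP nc0; rewrite scaleNr Podd mulNr => /oppr_inj.
- by apply/le_anti; rewrite PP0/=; move: Px; rewrite Podd; lra.
Qed.

End HahnBanach.

Theorem hahn_banach (R : realType) (V : lmodType R) (P0 : V -> R) x0 :
  sublinear P0 ->
  exists F : V -> R, [/\ linear F, forall v, F v <= P0 v & F x0 = P0 x0].
Proof.
move=> sP0.
have JF : join_compat (fun _ _ _ => False) P0 by [].
have [F [lF FP Fx _]] := @hahn_banach_join R V (fun _ _ _ => False)
  (fun _ _ _ _ => id) P0 x0 sP0 JF.
by exists F.
Qed.

Lemma linear_sumE (R : realType) (V W : lmodType R) (F : V -> W) : linear F ->
  forall (I : Type) (r : seq I) (P : pred I) (f : I -> V),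
  F (\sum_(i <- r | P i) f i) = \sum_(i <- r | P i) F (f i).
Proof.
move=> lF I r P f; pose G := GRing.isLinear.Build R V W _ F lF.
pose F' : {linear V -> W} := HB.pack F G.
exact: (linear_sum F').
Qed.

Lemma linear_scaleE (R : realType) (V W : lmodType R) (F : V -> W) : linear F ->
  forall c v, F (c *: v) = c *: F v.
Proof.
move=> lF c v; pose G := GRing.isLinear.Build R V W _ F lF.
pose F' : {linear V -> W} := HB.pack F G.
exact: (linearZZ F').
Qed.

Lemma linear_addE (R : realType) (V W : lmodType R) (F : V -> W) : linear F ->
  forall u v, F (u + v) = F u + F v.
Proof. by move=> lF u v; rewrite -[u]scale1r lF !scale1r. Qed.

Lemma linear_oppE (R : realType) (V W : lmodType R) (F : V -> W) : linear F ->
  forall v, F (- v) = - F v.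
Proof. by move=> lF v; rewrite -scaleN1r (linear_scaleE lF) scaleN1r. Qed.

Lemma linear_subE (R : realType) (V W : lmodType R) (F : V -> W) : linear F ->
  forall u v, F (u - v) = F u - F v.
Proof. by move=> lF u v; rewrite (linear_addE lF) (linear_oppE lF). Qed.

(* Ville's theorem of the alternative, for an arbitrary convex cone. *)
Lemma cone_weights (R : realType) (I : finType) (C : set (I -> R)) :
  C 0 -> (forall c d, C c -> C d -> C (c + d)) ->
  (forall (a : R) c, 0 < a -> C c -> C (a *: c)) ->
  (forall c, C c -> exists k, 0 <= c k) ->
  exists b : I -> R, [/\ forall k, 0 <= b k, \sum_k b k = 1 &
    forall c, C c -> 0 <= \sum_k b k * c k].
Proof.
move=> C0 CD CZ Cge.
(* [P v] is the infimum over [c] in [C] of the largest coordinate of [v + c], finite because every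
   such [c] has a coordinate [c k >= 0]. A linear minorant has nonnegative coefficients of sum 1 and
   is nonnegative on [C]. *)
pose E (v : I -> R) := [set r : R | exists2 c, C c & forall k, v k + c k <= r].
pose P v := inf (E v).
have E0 v : E v !=set0.
  exists (\sum_k `|v k|), 0 => // k; rewrite addr0 (bigD1 k)//=.
  by rewrite (le_trans (ler_norm _))// lerDl sumr_ge0.
have Elb v a : (forall k, a <= v k) -> lbound (E v) a.
  move=> av r [c /Cge[k ck] /(_ k)]; apply: le_trans.
  by rewrite -[a]addr0 lerD.
have Ehlb v : has_lbound (E v).
  exists (- \sum_k `|v k|); apply: Elb => k; rewrite lerNl (bigD1 k)//=.
  by rewrite (le_trans (ler_norm _))// normrN lerDl sumr_ge0.
have Ple v r c : C c -> (forall k, v k + c k <= r) -> P v <= r.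
  by move=> Cc cr; apply: ge_inf => //; exists c.
have leP a v : lbound (E v) a -> a <= P v by exact: lb_le_inf.
have sP : sublinear P.
  split=> [v w|a v a0].
    rewrite -lerBlDr; apply/leP => r [c Cc cr]; rewrite lerBlDr -lerBlDl.
    apply/leP => s [d Cd ds]; rewrite lerBlDr.
    apply: (Ple _ _ (c + d)); first exact: CD.
    by move=> k; rewrite [(v + w) k]/(v k + w k) [(c + d) k]/(c k + d k) addrACA [s + r]addrC lerD.
  rewrite -ler_pdivrMl//; apply/leP => r [c Cc cr]; rewrite ler_pdivrMl//.
  apply: (Ple _ _ (a *: c)); first exact: CZ.
  by move=> k; rewrite -[(a *: v) k + _]/(a * v k + a * c k) -mulrDr ler_pM2l.
have [F [lF FP _]] := hahn_banach 0 sP.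
pose dl (k : I) : I -> R := fun j => (j == k)%:R.
have dlE v : v = \sum_k v k *: dl k.
  apply/funext => j.
  have -> : (\sum_k v k *: dl k) j = \sum_k (v k *: dl k) j.
    by elim/big_ind2 : _ => // x1 x2 y1 y2 <- <-.
  rewrite (bigD1 j)//= big1 ?addr0; last first.
    move=> k kj; rewrite -[LHS]/(v k * (j == k)%:R).
    by rewrite eq_sym (negbTE kj) mulr0.
  by rewrite -[RHS]/(v j * (j == j)%:R) eqxx mulr1.
have FE v : F v = \sum_k F (dl k) * v k.
  rewrite {1}(dlE v) (linear_sumE lF); apply: eq_bigr => k _.
  by rewrite (linear_scaleE lF) mulrC.
have Fneg v r : (forall k, v k <= r) -> F v <= r.
  move=> vr; apply: le_trans (FP v) _; apply: (Ple _ _ 0) => // k.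
  by rewrite addr0.
exists (fun k => F (dl k)); split.
- move=> k; rewrite -lerN2 oppr0 -(linear_oppE lF); apply: Fneg => j.
  by rewrite oppr_le0.
- have -> : \sum_k F (dl k) = F (fun=> 1).
    by rewrite FE; apply: eq_bigr => k _; rewrite mulr1.
  apply/le_anti; rewrite Fneg//= -lerN2 -(linear_oppE lF).
  by apply: Fneg => k.
- move=> c Cc; rewrite -FE -lerN2 oppr0 -(linear_oppE lF).
  apply: le_trans (FP _) _; apply: (Ple _ _ c) => // k.
  by rewrite -[(- c) k]/(- c k) addNr.
Qed.

Section NormingFunctionals.
Variables (R : realType) (V : normedModType R).

Lemma bop_ex (W : normedModType R) (F : V -> W) (M : R) : 0 <= M -> linear F ->
  (forall v, `|F v| <= M * `|v|) ->
  exists f : bop V W, (forall v, f v = F v) /\ `|f| <= M.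
Proof.
move=> M0 lF FM.
have Fb : F \in @bop_pred R V W by rewrite inE; split => //; exists M.
by exists (Bop Fb); split => //; apply: bop_norm_lub.
Qed.

Lemma norming_functional (u : V) :
  exists phi : dual V, `|phi| <= 1 /\ phi u = `|u|.
Proof.
have sN : sublinear (fun v : V => `|v|).
  by split=> [v w|c v c0]; rewrite ?ler_normD// normrZ gtr0_norm.
have [F [lF FN Fu]] := hahn_banach u sN.
have [|phi [phiE phi1]] := @bop_ex R F 1 ler01 lF.
  move=> v; rewrite mul1r ler_norml FN andbT lerNl -(linear_oppE lF).
  by rewrite -normrN FN.
by exists phi; rewrite phiE.
Qed.

End NormingFunctionals.

(** * Lattice homomorphisms on a principal ideal *)

Section Ideal.
Variables (R : realType) (L : banachLatticeType R) (e : L).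

Definition ideal_pred : {pred L} := mem [set x | exists c : R, labs x <= c *: e].

Lemma ideal_submod_closed : submod_closed ideal_pred.
Proof.
split; first by rewrite inE; exists 0; rewrite ger0_labs// scale0r.
move=> a x y /[!inE] -[c xc] [d yd]; exists (`|a| * c + d).
rewrite (le_trans (ler_labsD _ _))// scalerDl bl_lerD//.
by rewrite (le_trans (labsZ_le _ _))// -scalerA bl_ler_wZ.
Qed.

HB.instance Definition _ := GRing.isSubmodClosed.Build R L ideal_pred
  ideal_submod_closed.

Record ideal := Ideal { ideal_val :> L; idealP : ideal_val \in ideal_pred }.

HB.instance Definition _ := [isSub for ideal_val].
HB.instance Definition _ := gen_eqMixin ideal.
HB.instance Definition _ := gen_choiceMixin ideal.
HB.instance Definition _ := [SubChoice_isSubLmodule of ideal by <:].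

Lemma ideal_join x y : x \in ideal_pred -> y \in ideal_pred ->
  Order.join x y \in ideal_pred.
Proof.
move=> /[!inE] -[c xc] [d yd]; exists (c + d); rewrite scalerDl.
apply: (@le_trans _ _ (labs x + labs y)); last exact: bl_lerD.
rewrite labs_le leUx; apply/andP; split.
  apply/andP; split; first by rewrite -[leLHS]addr0 bl_lerD ?labs_ge ?labs_ge0.
  by rewrite -[leLHS]add0r bl_lerD ?labs_ge ?labs_ge0.
rewrite -[leLHS]addr0 bl_lerD ?labs_ge0// (le_trans _ (labs_geN x))//.
by rewrite bl_lerN2// leUl.
Qed.

Lemma ideal_between x c : labs x <= c *: e -> x \in ideal_pred.
Proof. by move=> xc; rewrite inE; exists c. Qed.

(* The lattice homomorphisms on the principal ideal of e, normalised at e: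
   the points of Kakutani's representation space. *)
Definition ideal_hom (h : L -> R) :=
  [/\ forall x y, x \in ideal_pred -> y \in ideal_pred -> h (x + y) = h x + h y,
      forall (a : R) x, x \in ideal_pred -> h (a *: x) = a * h x,
      forall x y, x \in ideal_pred -> y \in ideal_pred ->
        h (Order.join x y) = Num.max (h x) (h y) &
      h e = 1].

Hypothesis e0 : 0 <= e.

Lemma ideal_unit : e \in ideal_pred.
Proof. by rewrite inE; exists 1; rewrite scale1r ger0_labs. Qed.

(** The positive cone is norm closed, so the infimum of the admissible [c] is itself admissible. *)
Lemma archimedean_le (x : L) c :
  (forall d : R, 0 < d -> x <= (c + d) *: e) -> x <= c *: e.
Proof.
move=> xd; rewrite -bl_subr_le0; apply: bl_le0_approx => r r0.
have ne : 0 < `|e| + 1 by rewrite ltr_wpDl.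
exists ((r / (`|e| + 1)) *: e).
  have /(bl_leD (- (c *: e))) := xd _ (divr_gt0 r0 ne).
  by rewrite scalerDl [c *: e + _]addrC addrK.
rewrite normrZ gtr0_norm ?divr_gt0// mulrAC ler_pdivrMr// ler_wpM2l ?(ltW r0)//.
by rewrite lerDl.
Qed.

(** The gauge [p x], the least [c] with [x <= c *: e], is sublinear and join-compatible, so
    [hahn_banach_join] yields a minorant [F] that agrees with it at [x0]. Being below [p] makes [F]
    monotone, which is the other half of preserving joins; [p e <= 1] and [p (- e) <= - 1] normalise
    it. *)
Lemma ideal_hom_ex (x0 : L) : e != 0 -> x0 \in ideal_pred ->
  exists2 h, ideal_hom h & x0 <= h x0 *: e.
Proof.
move=> en0 Ix0.
pose E (x : L) := [set c : R | x <= c *: e].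
pose p x := inf (E x).
have E0 x : x \in ideal_pred -> E x !=set0.
  by rewrite inE => -[c xc]; exists c; exact: le_trans (labs_ge x) xc.
have scale_e (c : R) : 0 <= c *: e -> 0 <= c.
  move=> ce; rewrite leNgt; apply/negP => c0; case/negP: en0.
  apply/eqP/le_anti; rewrite e0 andbT.
  have := bl_ler_wZ (a := - c^-1) _ ce; rewrite scaler0 scalerA mulNr mulVf ?lt_eqF//.
  rewrite oppr_ge0 invr_le0 (ltW c0) => /(_ isT).
  by rewrite scaleN1r => /bl_lerN2; rewrite opprK oppr0.
have mono (c d : R) : c *: e <= d *: e -> c <= d.
  move=> /(bl_leD (- (c *: e))); rewrite subrr -scalerBl => /scale_e.
  by rewrite subr_ge0.
have Elb x : x \in ideal_pred -> has_lbound (E x).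
  rewrite inE => -[c xc]; exists (- c) => d /= xd; apply: mono.
  apply: le_trans xd; rewrite scaleNr -[leRHS]opprK bl_lerN2//.
  exact: le_trans (labs_geN x) xc.
have px x : x \in ideal_pred -> x <= p x *: e.
  move=> Ix; apply: archimedean_le => d d0.
  have [c /= xc cd] := inf_adherent d0 (conj (E0 _ Ix) (Elb _ Ix)).
  by rewrite (le_trans xc)// bl_lerZr// ltW.
have ple x c : x \in ideal_pred -> x <= c *: e -> p x <= c.
  by move=> Ix xc; apply: ge_inf => //; exact: Elb.
pose P (x : ideal) := p x.
have sP : sublinear P.
  split=> [v w|a v a0]; apply: ple; try exact: idealP.
    by rewrite scalerDl bl_lerD// px// idealP.
  by rewrite -scalerA bl_ler_wZ ?(ltW a0)// px// idealP.
pose J (f g m : ideal) := ideal_val m = Order.join (ideal_val f) (ideal_val g).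
have Jshift f g m x : J f g m -> J (f + x) (g + x) (m + x).
  rewrite /J => Jm.
  rewrite -[LHS]/(ideal_val m + ideal_val x).
  rewrite -[RHS]/(Order.join (ideal_val f + ideal_val x) (ideal_val g + ideal_val x)).
  rewrite Jm; apply/le_anti/andP; split; last first.
    by rewrite leUx !bl_lerD ?leUl ?leUr.
  have : Order.join (ideal_val f) (ideal_val g) <=
      Order.join (ideal_val f + ideal_val x) (ideal_val g + ideal_val x) - ideal_val x.
    rewrite leUx -{1}(addrK (ideal_val x) (ideal_val f)).
    by rewrite -{2}(addrK (ideal_val x) (ideal_val g)) !bl_lerD ?leUl ?leUr.
  by move=> /(bl_leD (ideal_val x)); rewrite subrK.
have JP : join_compat J P.
  move=> f g m Jm; apply: ple; first exact: idealP.
  rewrite Jm leUx; apply/andP; split.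
    rewrite (le_trans (px _ (idealP f)))// bl_lerZr// le_max lexx//.
  by rewrite (le_trans (px _ (idealP g)))// bl_lerZr// le_max lexx orbT.
have [F [lF FP Fx JF]] := hahn_banach_join Jshift (Ideal Ix0) sP JP.
have Fmono (x y : ideal) : ideal_val x <= ideal_val y -> F x <= F y.
  move=> xy; rewrite -subr_le0 -(linear_subE lF).
  apply: le_trans (FP _) _; apply: ple; first exact: idealP.
  by rewrite scale0r bl_subr_le0.
(* The value 0 outside the ideal is a dummy; [ideal_hom] constrains [h] on the ideal only. *)
pose h (x : L) := if insub x is Some x' then F x' else 0.
have hE (x : L) (Ix : x \in ideal_pred) : h x = F (Ideal Ix).
  by rewrite /h insubT.
have Ie := ideal_unit.
exists h; last first.
  by rewrite (hE _ Ix0) Fx; exact: px.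
split.
- move=> x y Ix Iy; rewrite (hE _ Ix) (hE _ Iy) (hE _ (rpredD Ix Iy)).
  by rewrite -(linear_addE lF); congr F; exact: val_inj.
- move=> a x Ix; rewrite (hE _ Ix) (hE _ (rpredZ a Ix)).
  transitivity (F (a *: Ideal Ix)); last exact: linear_scaleE.
  by congr F; exact: val_inj.
- move=> x y Ix Iy; have Ixy := ideal_join Ix Iy.
  rewrite (hE _ Ix) (hE _ Iy) (hE _ Ixy); apply/le_anti; rewrite JF//=.
  by rewrite ge_max !Fmono//= ?leUl ?leUr.
- rewrite (hE _ Ie); apply/le_anti/andP; split.
    by apply: le_trans (FP _) _; apply: ple => //=; rewrite scale1r.
  rewrite -lerN2 -(linear_oppE lF); apply: le_trans (FP _) _.
  by apply: ple; [exact: idealP|rewrite scaleN1r].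
Qed.

(** If [h] attains the gauge of [x - y], then [x - y <= h (x - y) *: e <= 0]. For [e = 0] no
    normalised homomorphism exists, so that case is treated apart. *)
Lemma ideal_le (x y : L) : x \in ideal_pred -> y \in ideal_pred ->
  (forall h, ideal_hom h -> h x <= h y) -> x <= y.
Proof.
move=> Ix Iy hxy; have [e00|en0] := eqVneq e 0.
  have I0 z : z \in ideal_pred -> z = 0.
    rewrite inE => -[c]; rewrite e00 scaler0 => z0.
    by apply/eqP; rewrite -normr_le0 -[leRHS](@normr0 _ L) labs_le_norm.
  by rewrite (I0 _ Ix) (I0 _ Iy).
have Ixy : x - y \in ideal_pred by rewrite rpredB.
have [h hh xyh] := ideal_hom_ex en0 Ixy; have [hD hZ hJ h1] := hh.
rewrite -bl_subr_le0; apply: le_trans xyh _.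
rewrite -scaleN1r hD ?hZ ?rpredZ// mulN1r.
have : 0 <= - (h x - h y) by rewrite oppr_ge0 subr_le0 hxy.
move=> /(bl_scale_ge0) /(_ e0) /bl_lerN2.
by rewrite scaleNr opprK oppr0.
Qed.

End Ideal.

(** * Localization in a Banach lattice and positive functionals *)

Section HomTheory.
Variables (R : realType) (L : banachLatticeType R) (e : L) (h : L -> R).
Hypotheses (e0 : 0 <= e) (hh : ideal_hom e h).
Local Notation I := (ideal_pred e).

Let hD x y : x \in I -> y \in I -> h (x + y) = h x + h y. Proof. by case: hh => + _ _ _; apply. Qed.
Lemma homZ a x : x \in I -> h (a *: x) = a * h x. Proof. by case: hh => _ + _ _; apply. Qed.
Lemma homJ x y : x \in I -> y \in I -> h (Order.join x y) = Num.max (h x) (h y).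
Proof. by case: hh => _ _ + _; apply. Qed.
Lemma hom1 : h e = 1. Proof. by case: hh. Qed.

Lemma hom0 : h 0 = 0.
Proof. by rewrite -(scale0r e) homZ ?ideal_unit// mul0r. Qed.

Lemma homN x : x \in I -> h (- x) = - h x.
Proof. by move=> Ix; rewrite -scaleN1r homZ// mulN1r. Qed.

Lemma homB x y : x \in I -> y \in I -> h (x - y) = h x - h y.
Proof. by move=> Ix Iy; rewrite hD ?rpredN// homN. Qed.

Lemma hom_sum (T : Type) (r : seq T) (P : pred T) (F : T -> L) :
  (forall i, F i \in I) -> h (\sum_(i <- r | P i) F i) = \sum_(i <- r | P i) h (F i).
Proof.
move=> IF; elim: r => [|i r IH]; first by rewrite !big_nil hom0.
by rewrite !big_cons; case: ifP => // _; rewrite hD ?IH// rpred_sum.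
Qed.

Lemma hom_mono x y : x \in I -> y \in I -> x <= y -> h x <= h y.
Proof.
move=> Ix Iy xy; have := homJ Ix Iy; rewrite (join_idPr xy) => ->.
by rewrite le_max lexx.
Qed.

Lemma ideal_labs x : x \in I -> labs x \in I.
Proof. by move=> Ix; rewrite ideal_join ?rpredN. Qed.

Lemma hom_labs x : x \in I -> h (labs x) = `|h x|.
Proof.
move=> Ix; rewrite /labs homJ ?rpredN// homN//.
have [x0|x0] := leP 0 (h x).
  by rewrite ger0_norm//; apply/max_idPl; lra.
by rewrite ltr0_norm//; apply/max_idPr; lra.
Qed.

End HomTheory.

Section BigJoin.
Variables (R : realType) (L : banachLatticeType R) (n : nat).
Implicit Types f g : 'I_n.+1 -> L.

(** A lattice need not have a least element, so the family is nonempty and the join starts from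
    [f ord0]. *)
Definition bigjoin f : L := \big[Order.join/f ord0]_k f k.

Lemma bigjoin_le f z : bigjoin f <= z <-> forall k, f k <= z.
Proof.
split=> [fz k|fz].
  apply: le_trans fz; rewrite /bigjoin.
  have : k \in index_enum 'I_n.+1 by rewrite mem_index_enum.
  elim: (index_enum _) => //= i s IH; rewrite inE big_cons => /predU1P[->|/IH].
    exact: leUl.
  by move=> /le_trans; apply; exact: leUr.
by rewrite /bigjoin; elim/big_ind : _ => // x y xz yz; rewrite leUx xz.
Qed.

Lemma le_bigjoin f k : f k <= bigjoin f.
Proof. exact: (bigjoin_le _ _).1 (lexx _) k. Qed.

Lemma bigjoinD f g : bigjoin (fun k => f k + g k) <= bigjoin f + bigjoin g.
Proof. by apply/bigjoin_le => k; rewrite bl_lerD// le_bigjoin. Qed.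

Lemma bigjoinZ f (a : R) : 0 <= a -> bigjoin (fun k => a *: f k) <= a *: bigjoin f.
Proof. by move=> a0; apply/bigjoin_le => k; rewrite bl_ler_wZ// le_bigjoin. Qed.

Lemma ideal_bigjoin e f : (forall k, f k \in ideal_pred e) ->
  bigjoin f \in ideal_pred e.
Proof.
by move=> If; rewrite /bigjoin; elim/big_ind : _ => // x y; exact: ideal_join.
Qed.

End BigJoin.

Lemma net_ord (R : realType) m (d : R) : 0 < d ->
  exists n (t : 'I_n.+1 -> 'I_m -> R), (forall k j, `|t k j| <= 1) /\
    forall s : 'I_m -> R, (forall j, `|s j| <= 1) ->
      exists k, forall j, `|s j - t k j| <= d.
Proof.
move=> d0; pose K := [set s : 'I_m -> R | forall j, `|s j| <= 1].
have K0 : K (fun=> 0) by move=> j; rewrite normr0.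
have [|r [rK Kr]] := @finite_net R m K 1 d (ex_intro _ _ K0) _ d0; first by [].
have nthIn i : (i < size r)%N -> List.In (nth (fun=> 0) r i) r.
  elim: r i {rK Kr} => // x r IH [|i] /=; first by left.
  by rewrite ltnS => /IH; right.
have Innth k : List.In k r -> exists2 i, (i < size r)%N & nth (fun=> 0) r i = k.
  elim: r {rK Kr nthIn} => // x r IH /= [->|/IH[i ir <-]]; first by exists 0%N.
  by exists i.+1.
have [k0 /Innth[i0 i0r _] _] := Kr _ K0.
have sr : (size r).-1.+1 = size r by rewrite prednK// (leq_trans _ i0r).
exists (size r).-1, (fun k => nth (fun=> 0) r k); split.
  by move=> k; apply: rK; apply: nthIn; rewrite (leq_trans (ltn_ord k))// sr.
move=> s Ks; have [_ /Innth[i ir <-] kd] := Kr _ Ks.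
have ir' : (i < (size r).-1.+1)%N by rewrite sr.
by exists (Ordinal ir').
Qed.

Section Localization.
Variables (R : realType) (L : banachLatticeType R) (e : L) (m : nat) (y : 'I_m -> L).
Hypotheses (e0 : 0 <= e) (ye : forall j, labs (y j) <= e).
Local Notation I := (ideal_pred e).

(** Under a normalised homomorphism [h] this becomes the l_1 distance from the point with
    coordinates [h (y j)] to [t]. *)
Definition loc_err (t : 'I_m -> R) : L := \sum_j labs (y j - t j *: e).

Let Ie : e \in I. Proof. exact: ideal_unit. Qed.
Let Iy j : y j \in I. Proof. by rewrite (@ideal_between _ _ _ _ 1)// scale1r. Qed.

Let Ierr t : loc_err t \in I.
Proof. by rewrite rpred_sum// => j _; rewrite ideal_labs// rpredB// rpredZ. Qed.

Let herr h t : ideal_hom e h -> h (loc_err t) = \sum_j `|h (y j) - t j|.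
Proof.
move=> hh; rewrite (hom_sum e0 hh) => [|j]; last by rewrite ideal_labs// rpredB// rpredZ.
apply: eq_bigr => j _; rewrite (hom_labs hh) ?rpredB ?rpredZ//.
by rewrite (homB hh) ?rpredZ// (homZ hh)// (hom1 hh) mulr1.
Qed.

(* Every point of [-1, 1]^m is at distance at most 1 / N of some t k; the
   function theta k is at least 1 near t k and vanishes far from it, and the
   g k are the increments of the truncations of the partial sums of theta. *)
Lemma localization (N M : R) : 0 < N -> 0 <= M ->
  exists n (t : 'I_n.+1 -> 'I_m -> R) (g : 'I_n.+1 -> L),
  [/\ forall k j, `|t k j| <= 1,
      forall k, 0 <= g k,
      forall j, labs (y j - \sum_k t k j *: g k) <= (2 / N) *: e &
      forall phi : 'I_n.+1 -> R, (forall k, 0 <= phi k) ->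
        \sum_k phi k *: g k <=
        bigjoin (fun k => phi k *: e - M *: loc_err (t k)) + (M * (2 / N)) *: e].
Proof.
move=> N0 M0.
have m1 : 0 < m.+1%:R :> R by rewrite ltr0n.
(* With this mesh the [m] coordinates add up to an l_1 distance of at most [1 / N], so the nearest
   [theta k] is at least 1; [m.+1] also covers [m = 0]. *)
have [n [t [t1 tnet]]] := net_ord m (d := (N * m.+1%:R)^-1) (ltac:(by rewrite invr_gt0 mulr_gt0)).
pose theta k : L := Order.join (2 *: e - N *: loc_err (t k)) 0.
pose S (i : nat) : L := \sum_(k < n.+1 | (k < i)%N) theta k.
(* This is the meet of [s] and [e]. *)
pose tr (s : L) : L := e - Order.join (e - s) 0.
pose g (k : 'I_n.+1) := tr (S k.+1) - tr (S k).
have Itheta k : theta k \in I by rewrite ideal_join ?rpredB ?rpredZ ?rpred0.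
have IS i : S i \in I by rewrite rpred_sum.
have Itr s : s \in I -> tr s \in I.
  by move=> Is; rewrite rpredB// ideal_join ?rpredB ?rpred0.
have Ig k : g k \in I by rewrite rpredB// Itr.
pose th h k : R := Num.max (2 - N * \sum_j `|h (y j) - t k j|) 0.
have hth h k : ideal_hom e h -> h (theta k) = th h k.
  move=> hh; rewrite (homJ hh) ?rpredB ?rpredZ ?rpred0//.
  by rewrite (homB hh) ?rpredZ// !(homZ hh)// (hom1 hh) (hom0 e0 hh) herr// mulr1.
pose Sh h i : R := \sum_(k < n.+1 | (k < i)%N) th h k.
have hS h i : ideal_hom e h -> h (S i) = Sh h i.
  by move=> hh; rewrite (hom_sum e0 hh)//; apply: eq_bigr => k _; exact: hth.
have htr h s : ideal_hom e h -> s \in I -> h (tr s) = Num.min (h s) 1.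
  move=> hh Is; rewrite (homB hh)// ?ideal_join ?rpredB ?rpred0//.
  rewrite (homJ hh) ?rpredB ?rpred0// (homB hh)// (hom1 hh) (hom0 e0 hh).
  rewrite /Num.max /Num.min; case: ifPn; case: ifPn; rewrite -?leNgt; lra.
have hg h k : ideal_hom e h ->
    h (g k) = Num.min (Sh h k.+1) 1 - Num.min (Sh h k) 1.
  by move=> hh; rewrite (homB hh) ?Itr// !htr// !hS.
have th0 h k : 0 <= th h k by rewrite le_max lexx orbT.
have ShS h (k : 'I_n.+1) : Sh h k.+1 = Sh h k + th h k.
  rewrite /Sh (bigD1 k)//= addrC; congr (_ + _); apply: eq_bigl => i.
  by rewrite ltnS [in RHS]ltn_neqAle andbC.
have hg0 h k : ideal_hom e h -> 0 <= h (g k).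
  move=> hh; rewrite hg// ShS; have := th0 h k.
  rewrite /Num.min; case: ifPn; case: ifPn; rewrite -?leNgt; lra.
(* A truncated partial sum can increase only where [theta k] is positive. *)
have hgpos h k : ideal_hom e h -> 0 < h (g k) ->
    \sum_j `|h (y j) - t k j| <= 2 / N.
  move=> hh; rewrite hg// ShS => gp; rewrite ler_pdivlMr// mulrC leNgt.
  apply/negP => h2; move: gp; rewrite /th (max_idPr _) ?addr0 ?subrr ?ltxx//; lra.
have hy1 h j : ideal_hom e h -> `|h (y j)| <= 1.
  by move=> hh; rewrite -(hom_labs hh)// -(hom1 hh) (hom_mono hh)// ideal_labs.
(* The increments telescope to the last truncated sum, which is 1 because some [theta k] is at least
   1. *)
have hgsum h : ideal_hom e h -> \sum_k h (g k) = 1.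
  move=> hh; transitivity (\sum_(k < n.+1) (Num.min (Sh h k.+1) 1 - Num.min (Sh h k) 1)).
    by apply: eq_bigr => k _; exact: hg.
  rewrite -(big_mkord xpredT (fun k => Num.min (Sh h k.+1) 1 - Num.min (Sh h k) 1)).
  rewrite telescope_sumr//.
  have -> : Sh h 0%N = 0 by rewrite /Sh big_pred0.
  rewrite (min_idPl (@ler01 R)) subr0; apply/min_idPr.
  have [k kd] := tnet (h \o y) (fun j => hy1 h j hh).
  apply: (@le_trans _ _ (th h k)); last first.
    rewrite /Sh (bigD1 k)//= ?ltn_ord// lerDl; apply: sumr_ge0 => i _; exact: th0.
  rewrite le_max; apply/orP; left.
  have : \sum_j `|h (y j) - t k j| <= \sum_(j < m) (N * m.+1%:R)^-1.
    by apply: ler_sum => j _; exact: kd.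
  rewrite sumr_const card_ord -[_ *+ m]mulr_natl invfM mulrCA => h1.
  have h2 : m%:R / m.+1%:R <= 1 :> R by rewrite ler_pdivrMr// mul1r ler_nat.
  have h3 : N * (\sum_j `|h (y j) - t k j|) <= 1.
    rewrite mulrC -ler_pdivlMr// mul1r (le_trans h1)// ler_piMr//.
    by rewrite invr_ge0 ltW.
  lra.
have hgavg h (c : R) : ideal_hom e h -> \sum_k c * h (g k) = c.
  by move=> hh; rewrite -mulr_sumr hgsum// mulr1.
exists n, t, g; split => //.
- move=> k; apply: (ideal_le e0); rewrite ?rpred0// => h hh.
  by rewrite (hom0 e0 hh) hg0.
- move=> j.
  have Itg : \sum_k t k j *: g k \in I by rewrite rpred_sum// => k _; rewrite rpredZ.
  apply: (ideal_le e0); rewrite ?ideal_labs ?rpredB ?rpredZ// => h hh.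
  rewrite (hom_labs hh) ?rpredB// (homB hh)// (homZ hh)// (hom1 hh) mulr1.
  rewrite (hom_sum e0 hh) => [|k]; last by rewrite rpredZ.
  rewrite -[h (y j)](hgavg h _ hh) -sumrB.
  apply: le_trans (ler_norm_sum _ _ _) _.
  rewrite -[leRHS](hgavg h _ hh); apply: ler_sum => k _.
  rewrite (homZ hh)// -mulrBl normrM (ger0_norm (hg0 h k hh)).
  have := hg0 h k hh; rewrite le_eqVlt => /predU1P[<-|gp]; first by rewrite !mulr0.
  rewrite ler_wpM2r ?(ltW gp)//; apply: le_trans (hgpos h k hh gp).
  by rewrite (bigD1 j)//= lerDl sumr_ge0.
(* The left side averages the [phi k] with weights [h (g k)]; where the weight is positive, the
   penalty is at most [M * (2 / N)]. *)
- move=> phi phi0.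
  have Ipg : \sum_k phi k *: g k \in I by rewrite rpred_sum// => k _; rewrite rpredZ.
  have If k : phi k *: e - M *: loc_err (t k) \in I by rewrite rpredB ?rpredZ.
  have Ib := ideal_bigjoin If.
  apply: (ideal_le e0); rewrite ?rpredD ?rpredZ// => h hh.
  have -> : h (bigjoin (fun k => phi k *: e - M *: loc_err (t k)) + (M * (2 / N)) *: e)
      = h (bigjoin (fun k => phi k *: e - M *: loc_err (t k))) + M * (2 / N).
    case: (hh) => hD _ _ _.
    by rewrite hD ?rpredZ// (homZ hh)// (hom1 hh) mulr1.
  rewrite (hom_sum e0 hh) => [|k]; last by rewrite rpredZ.
  rewrite -[leRHS](hgavg h _ hh); apply: ler_sum => k _.
  rewrite (homZ hh)//.
  have := hg0 h k hh; rewrite le_eqVlt => /predU1P[<-|gp]; first by rewrite !mulr0.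
  rewrite ler_wpM2r ?(ltW gp)// -lerBlDr.
  apply: (@le_trans _ _ (h (phi k *: e - M *: loc_err (t k)))).
    rewrite (homB hh) ?rpredZ// !(homZ hh)// (hom1 hh) mulr1 herr// lerB//.
    by rewrite ler_wpM2l// hgpos.
  by apply: (hom_mono hh) => //; exact: (le_bigjoin (fun k => phi k *: e - M *: loc_err (t k))).
Qed.

End Localization.

Section PositiveFunctionals.
Variables (R : realType) (L : banachLatticeType R).

Definition positive_functional (lam : L -> R) :=
  linear lam /\ forall x, 0 <= x -> 0 <= lam x.

Lemma positive_functional_mono lam x y : positive_functional lam -> x <= y ->
  lam x <= lam y.
Proof.
move=> [ll lp] xy; rewrite -subr_ge0 -(linear_subE ll); apply: lp.
by rewrite -[leLHS]oppr0 -[y - x]opprK opprB bl_lerN2// bl_subr_le0.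
Qed.

Lemma positive_functional_labs lam x : positive_functional lam ->
  `|lam x| <= lam (labs x).
Proof.
move=> lp; rewrite ler_norml lerNl -(linear_oppE lp.1).
by rewrite !(positive_functional_mono lp) ?labs_ge ?labs_geN.
Qed.

(** Hahn-Banach for the norm of the positive part: it vanishes at negative elements, which makes
    every linear minorant positive. *)
Lemma positive_norming (w : L) : 0 <= w ->
  exists lam, [/\ positive_functional lam, lam w = `|w| & forall x, lam x <= `|x|].
Proof.
move=> w0; pose P (x : L) := `|Order.join x 0|.
have Pj (x : L) : 0 <= Order.join x 0 by exact: leUr.
have sP : sublinear P.
  split=> [x y|c x c0].
    apply: le_trans (ler_normD _ _); apply: bl_norm_mono => //.
    rewrite leUx bl_lerD ?leUl//=.
    by rewrite -[leLHS]addr0 bl_lerD ?leUr.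
  rewrite /P -[X in X * _]gtr0_norm// -normrZ; apply: bl_norm_mono => //.
  by rewrite leUx bl_ler_wZ ?leUl ?(ltW c0)//= bl_scale_ge0 ?leUr// ltW.
have [F [lF FP Fw]] := hahn_banach w sP.
exists F; split.
- split=> // x x0; rewrite -lerN2 oppr0 -(linear_oppE lF).
  apply: le_trans (FP _) _; rewrite /P (join_idPr _) ?normr0//.
  by rewrite -oppr0 bl_lerN2.
- by rewrite Fw /P (join_idPl _).
- move=> x; apply: le_trans (FP _) _; rewrite /P -(labs_norm x).
  by apply: bl_norm_mono => //; rewrite leUx labs_ge labs_ge0.
Qed.

(* The Riesz-Kantorovich formula for the value of lam at a finite supremum. *)
Lemma split_functional n lam (f : 'I_n.+1 -> L) : positive_functional lam ->
  exists lamk : 'I_n.+1 -> L -> R,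
  [/\ forall k, positive_functional (lamk k),
      forall x, \sum_k lamk k x = lam x &
      \sum_k lamk k (f k) = lam (bigjoin f)].
Proof.
move=> lp; have ll := lp.1.
(* A linear minorant of [P] is a sum of functionals of the coordinates. Each is positive because [P]
   is at most 0 on nonpositive families, and they add up to [lam] because [P] is [lam] on constant
   families. *)
pose P (f : 'I_n.+1 -> L) := lam (bigjoin f).
have sP : sublinear P.
  split=> [u v|c v c0].
    rewrite /P -(linear_addE ll); apply: positive_functional_mono => //.
    exact: bigjoinD.
  rewrite /P -[c * _]/(c *: _) -(linear_scaleE ll).
  by apply: positive_functional_mono => //; apply: bigjoinZ; exact: ltW.
have [F [lF FP Ff]] := hahn_banach f sP.
pose inj k (x : L) : 'I_n.+1 -> L := fun j => if j == k then x else 0.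
have injE (u : 'I_n.+1 -> L) : u = \sum_k inj k (u k).
  apply/funext => j.
  have -> : (\sum_k inj k (u k)) j = \sum_k (inj k (u k)) j.
    by elim/big_ind2 : _ => // x1 x2 y1 y2 <- <-.
  rewrite (bigD1 j)//= big1 ?addr0 /inj ?eqxx// => k kj.
  by rewrite eq_sym (negbTE kj).
exists (fun k x => F (inj k x)); split.
- move=> k; split.
    move=> c x y; rewrite -lF; congr F; apply/funext => j.
    rewrite -[RHS]/(c *: inj k x j + inj k y j) /inj.
    by case: ifP; rewrite // scaler0 addr0.
  move=> x x0; rewrite -lerN2 oppr0 -(linear_oppE lF).
  apply: le_trans (FP _) _; rewrite /P -[leRHS](_ : lam 0 = 0); last first.
    by rewrite -(scale0r 0) (linear_scaleE ll); exact: scale0r.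
  apply: positive_functional_mono => //; apply/bigjoin_le => j.
  rewrite -[(- inj k x) j]/(- inj k x j) /inj; case: ifP; rewrite ?oppr0//.
  by rewrite -[leRHS]oppr0 bl_lerN2.
- move=> x; rewrite -(linear_sumE lF) -(injE (fun=> x)).
  have jc z : bigjoin (fun=> z : L) = z :> L.
    by apply/le_anti; rewrite (le_bigjoin (fun=> z) ord0) andbT; apply/bigjoin_le.
  apply/le_anti/andP; split; first by apply: le_trans (FP _) _; rewrite /P jc.
  rewrite -lerN2 -(linear_oppE lF) -(linear_oppE ll).
  by apply: le_trans (FP _) _; rewrite /P -[- (fun=> x)]/(fun=> - x) jc.
- by rewrite -(linear_sumE lF) -injE.
Qed.

End PositiveFunctionals.

(** * Finite sums: Hoelder duality *)

Section FiniteLp.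
Variable R : realType.
Implicit Types (r s : R) (p : \bar R).

Lemma hoelder_conjugate_cases p : (1 <= p)%E ->
  [\/ p = +oo%E /\ hoelder_conjugate p = 1%E,
      p = 1%E /\ hoelder_conjugate p = +oo%E |
      exists r s, [/\ p = r%:E, hoelder_conjugate p = s%:E, 1 < r, 1 < s &
        r^-1 + s^-1 = 1]].
Proof.
case: p => [r||//]; last by move=> _; apply: Or31; rewrite hoelder_conjugatey.
rewrite lee_fin le_eqVlt => /predU1P[<-|r1].
  by apply: Or32; rewrite hoelder_conjugate1.
apply: Or33; pose s := r / (r - 1).
have r0 : 0 < r by rewrite (lt_trans ltr01).
have r10 : 0 < r - 1 by rewrite subr_gt0.
exists r, s; split => //.
- rewrite /hoelder_conjugate /= eqe gt_eqF//.
  by rewrite -EFinB inver gt_eqF// -EFinM.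
- by rewrite /s ltr_pdivlMr// mul1r gtrDl ltrN10.
- by rewrite /s invf_div -[X in X + _]mul1r -mulrDl addrC subrK mulfV// gt_eqF.
Qed.

Lemma lpnorm_ge0 p n (a : 'I_n -> R) : 0 <= lpnorm p a.
Proof. by case: p => [r||]; [exact: powR_ge0|exact: bigmax_ge_id..]. Qed.

Lemma sum_powR_ge0 r n (a : 'I_n -> R) : 0 <= \sum_i `|a i| `^ r.
Proof. by apply: sumr_ge0 => i _; exact: powR_ge0. Qed.

Lemma lpnorm_powR r n (a : 'I_n -> R) : 0 < r ->
  lpnorm r%:E a `^ r = \sum_i `|a i| `^ r.
Proof.
by move=> r0; rewrite /lpnorm -powRrM mulVf ?gt_eqF// powRr1// sum_powR_ge0.
Qed.

Lemma lpnorm1 n (a : 'I_n -> R) : lpnorm 1%E a = \sum_i `|a i|.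
Proof.
rewrite /lpnorm invr1; have -> : \sum_i `|a i| `^ 1 = \sum_i `|a i|.
  by apply: eq_bigr => i _; rewrite powRr1.
by rewrite powRr1// sumr_ge0.
Qed.

Lemma eq_lpnorm p n (a b : 'I_n -> R) : (forall i, `|a i| = `|b i|) ->
  lpnorm p a = lpnorm p b.
Proof.
by move=> ab; case: p => [r||] /=; [congr (_ `^ _)|..]; apply: eq_bigr => i _; rewrite ab.
Qed.

Lemma lpnormZ p n c (a : 'I_n -> R) : (1 <= p)%E ->
  lpnorm p (fun i => c * a i) = `|c| * lpnorm p a.
Proof.
case: p => [r|_|//].
  rewrite lee_fin => r1; have r0 : 0 < r by rewrite (lt_le_trans ltr01).
  rewrite /lpnorm -[X in X * _]powRr1// -[X in _ `^ X * _](mulfV (lt0r_neq0 r0)) powRrM.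
  rewrite -powRM ?powR_ge0 ?sum_powR_ge0// mulr_sumr.
  by congr (_ `^ _); apply: eq_bigr => i _; rewrite normrM powRM.
apply/le_anti/andP; split.
  apply: bigmax_le; first by rewrite mulr_ge0// lpnorm_ge0.
  by move=> i _; rewrite normrM ler_wpM2l// (le_bigmax _ (fun i => `|a i|)).
have [->|c0] := eqVneq c 0; first by rewrite normr0 mul0r lpnorm_ge0.
rewrite -ler_pdivlMl ?normr_gt0//; apply: bigmax_le => [|i _].
  by rewrite mulr_ge0 ?lpnorm_ge0// invr_ge0.
rewrite ler_pdivlMl ?normr_gt0// -normrM.
exact: (le_bigmax _ (fun i => `|c * a i|)).
Qed.

Lemma ler_lpnorm p n (a b : 'I_n -> R) : (1 <= p)%E ->
  (forall i, `|a i| <= `|b i|) -> lpnorm p a <= lpnorm p b.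
Proof.
case: p => [r|_|//] => [|ab].
  rewrite lee_fin => r1 ab; have r0 : 0 < r by rewrite (lt_le_trans ltr01).
  rewrite ge0_ler_powR ?nnegrE ?sum_powR_ge0 ?invr_ge0 ?(ltW r0)//.
  by apply: ler_sum => i _; rewrite ge0_ler_powR ?nnegrE// ltW.
by apply: le_bigmax2 => i _; exact: ab.
Qed.

Lemma lpnorm0 p n : (1 <= p)%E -> lpnorm p (fun _ : 'I_n => 0 : R) = 0.
Proof.
move=> p1; transitivity (`|0 : R| * lpnorm p (fun _ : 'I_n => 0 : R)).
  by rewrite -lpnormZ//; apply: eq_lpnorm => i; rewrite mul0r.
by rewrite normr0 mul0r.
Qed.

Let hoelder_real r s n (a b : 'I_n -> R) : 0 < r -> 0 < s -> r^-1 + s^-1 = 1 ->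
  \sum_i `|a i| * `|b i| <= lpnorm r%:E a * lpnorm s%:E b.
Proof.
move=> r0 s0 rs.
have zero t (u : 'I_n -> R) i : 0 < t -> lpnorm t%:E u = 0 -> `|u i| = 0.
  move=> t0 u0; have := lpnorm_powR u t0; rewrite u0 powR0 ?gt_eqF// => /esym/eqP.
  rewrite psumr_eq0; last by move=> j _; exact: powR_ge0.
  by move=> /allP/(_ i (mem_index_enum _)); rewrite powR_eq0 => /andP[/eqP].
have [A0|A0] := eqVneq (lpnorm r%:E a) 0.
  rewrite A0 mul0r big1// => i _; rewrite (zero r)//; exact: mul0r.
have [B0|B0] := eqVneq (lpnorm s%:E b) 0.
  rewrite B0 mulr0 big1// => i _; rewrite (zero s b i)//; exact: mulr0.
have sum1 t (u : 'I_n -> R) : 0 < t -> 0 < lpnorm t%:E u ->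
    \sum_i (`|u i| / lpnorm t%:E u) `^ t = 1.
  move=> t0 up.
  have -> : \sum_i (`|u i| / lpnorm t%:E u) `^ t =
      (\sum_i `|u i| `^ t) * ((lpnorm t%:E u)^-1) `^ t.
    by rewrite mulr_suml; apply: eq_bigr => i _; rewrite powRM// invr_ge0 ltW.
  rewrite -lpnorm_powR// -powRM ?invr_ge0 ?(ltW up)//.
  by rewrite mulfV ?gt_eqF// powR1.
move: A0 B0 (lpnorm_ge0 r%:E a) (lpnorm_ge0 s%:E b) (sum1 r a r0) (sum1 s b s0).
move: (lpnorm r%:E a) (lpnorm s%:E b) => A B A0 B0 Age Bge sA sB {sum1 zero}.
have Ap : 0 < A by rewrite lt_def A0.
have Bp : 0 < B by rewrite lt_def B0.
have fld (x y u v : R) : u != 0 -> v != 0 -> x * y = u * v * (x / u * (y / v)).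
  by move=> u0 v0; field; rewrite ?u0 ?v0.
have -> : \sum_i `|a i| * `|b i| = A * B * \sum_i (`|a i| / A) * (`|b i| / B).
  rewrite mulr_sumr; apply: eq_bigr => i _.
  exact: fld.
rewrite ler_piMr ?mulr_ge0 ?(ltW Ap) ?(ltW Bp)//.
apply: (@le_trans _ _ (\sum_i ((`|a i| / A) `^ r / r + (`|b i| / B) `^ s / s))).
  by apply: ler_sum => i _; rewrite conjugate_powR// divr_ge0// ltW.
by rewrite big_split/= -!mulr_suml sA// sB// !mul1r rs.
Qed.

Lemma hoelder_sum p n (a b : 'I_n -> R) : (1 <= p)%E ->
  `|\sum_i a i * b i| <= lpnorm (hoelder_conjugate p) a * lpnorm p b.
Proof.
move=> p1; apply: le_trans (ler_norm_sum _ _ _) _.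
have -> : \sum_i `|a i * b i| = \sum_i `|a i| * `|b i|.
  by apply: eq_bigr => i _; rewrite normrM.
have max1 (u v : 'I_n -> R) : \sum_i `|u i| * `|v i| <= lpnorm 1%E u * lpnorm +oo%E v.
  rewrite lpnorm1 mulr_suml; apply: ler_sum => i _; rewrite ler_wpM2l//.
  exact: (le_bigmax _ (fun i => `|v i|)).
case: (hoelder_conjugate_cases p1) => [[-> ->]|[-> ->]|[r [s [-> -> r1 s1 rs]]]].
- exact: max1.
- rewrite mulrC; have -> : \sum_i `|a i| * `|b i| = \sum_i `|b i| * `|a i|.
    by apply: eq_bigr => i _; rewrite mulrC.
  exact: max1.
- apply: hoelder_real; rewrite ?(lt_trans ltr01)//.
  by rewrite addrC.
Qed.

(** Extremal vectors: the sign at a largest coordinate for [p = +oo], all signs for [p = 1], and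
    otherwise the normalised [sg b |b|^(r-1)], where [(r - 1) * s = r]. *)
Lemma lpnorm_dual p n (b : 'I_n -> R) : (1 <= p)%E ->
  exists a : 'I_n -> R, lpnorm (hoelder_conjugate p) a <= 1 /\
    \sum_i a i * b i = lpnorm p b.
Proof.
move=> p1.
have sgb i : Num.sg (b i) * b i = `|b i| by rewrite normrEsg.
have zero q : (1 <= q)%E -> lpnorm p b = 0 ->
    exists a : 'I_n -> R, lpnorm q a <= 1 /\ \sum_i a i * b i = lpnorm p b.
  move=> q1 b0; exists (fun=> 0); rewrite lpnorm0// ler01 b0 big1// => i _.
  exact: mul0r.
case: (hoelder_conjugate_cases p1) => [[pE ->]|[-> ->]|[r [s [pE -> r1 s1 rs]]]].
- have : lpnorm p b <= \big[Num.max/0]_i `|b i| by rewrite pE.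
  move=> /bigmax_geP[b0|[i0 _ bi0]].
    by apply: zero => //; apply/le_anti; rewrite b0 lpnorm_ge0.
  exists (fun i => if i == i0 then Num.sg (b i0) else 0); split.
    rewrite lpnorm1 (bigD1 i0)//= eqxx big1 ?addr0; last first.
      by move=> i /negbTE ->; rewrite normr0.
    by rewrite normr_sg lern1 leq_b1.
  rewrite (bigD1 i0)//= eqxx big1 ?addr0; last first.
    by move=> i /negbTE ->; rewrite mul0r.
  rewrite sgb; apply/le_anti; rewrite bi0 andbT pE.
  exact: (le_bigmax _ (fun i => `|b i|)).
- exists (fun i => Num.sg (b i)); split.
    by apply: bigmax_le => // i _; rewrite normr_sg lern1 leq_b1.
  by rewrite lpnorm1; apply: eq_bigr => i _; rewrite sgb.
- have r0 : 0 < r by rewrite (lt_trans ltr01).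
  have s0 : 0 < s by rewrite (lt_trans ltr01).
  have s1' : (1 <= s%:E)%E by rewrite lee_fin ltW.
  have [b0|b0] := eqVneq (lpnorm p b) 0; first exact: zero.
  have Bp : 0 < lpnorm p b by rewrite lt_def b0 lpnorm_ge0.
  have BE := lpnorm_powR b r0.
  move: Bp BE; rewrite -pE; move: (lpnorm p b) => B Bp BE {b0 pE}.
  have nsg i : `|Num.sg (b i)| * `|b i| `^ (r - 1) = `|b i| `^ (r - 1).
    have [->|bi0] := eqVneq (b i) 0.
      by rewrite normr0 powR0 ?mulr0// gt_eqF// subr_gt0.
    by rewrite normr_sg bi0 mul1r.
  have rs1 : (r - 1) * s = r.
    have : r * s * (r^-1 + s^-1) = r * s by rewrite rs mulr1.
    rewrite mulrDr mulrAC mulfV ?gt_eqF// mul1r -mulrA mulfV ?gt_eqF// mulr1.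
    by rewrite mulrBl mul1r; lra.
  exists (fun i => Num.sg (b i) * `|b i| `^ (r - 1) / B `^ (r - 1)); split.
    have -> : lpnorm s%:E (fun i => Num.sg (b i) * `|b i| `^ (r - 1) / B `^ (r - 1))
        = (\sum_i (`|b i| `^ r / B `^ r)) `^ s^-1.
      congr (_ `^ _); apply: eq_bigr => i _.
      rewrite !normrM normfV (ger0_norm (powR_ge0 B _)) (ger0_norm (powR_ge0 `|b i| _)).
      have inv : (B `^ (r - 1))^-1 `^ s = (B `^ r)^-1.
        rewrite -(powRN B (r - 1)) -(powRrM B (- (r - 1)) s) mulNr rs1.
        exact: powRN.
      rewrite nsg powRM ?invr_ge0 ?powR_ge0// inv.
      by rewrite -(powRrM _ (r - 1) s) rs1.
    by rewrite -mulr_suml -BE mulfV ?powR1// gt_eqF// powR_gt0.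
  have -> : \sum_i Num.sg (b i) * `|b i| `^ (r - 1) / B `^ (r - 1) * b i =
      (\sum_i `|b i| `^ r) / B `^ (r - 1).
    rewrite mulr_suml; apply: eq_bigr => i _.
    rewrite mulrAC; congr (_ / _); rewrite mulrAC sgb mulr_powRB1//.
  rewrite -BE -(mulr_powRB1 (ltW Bp) r0) mulfK//.
  by rewrite gt_eqF// powR_gt0.
Qed.

Lemma lpnorm_lub p n (b : 'I_n -> R) (M : R) : (1 <= p)%E ->
  (forall a, lpnorm (hoelder_conjugate p) a <= 1 -> \sum_i a i * b i <= M) ->
  lpnorm p b <= M.
Proof. by move=> p1 bM; have [a [a1 <-]] := lpnorm_dual b p1; exact: bM. Qed.

Lemma hoelder_le p n (a b : 'I_n -> R) : (1 <= p)%E ->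
  lpnorm (hoelder_conjugate p) a <= 1 -> \sum_i a i * b i <= lpnorm p b.
Proof.
move=> p1 a1; apply: le_trans (ler_norm _) _.
apply: le_trans (hoelder_sum _ _ p1) _.
by rewrite ler_piMl// lpnorm_ge0.
Qed.

Lemma ler_lpnormD p n (a b : 'I_n -> R) : (1 <= p)%E ->
  lpnorm p (fun i => a i + b i) <= lpnorm p a + lpnorm p b.
Proof.
move=> p1; apply: lpnorm_lub => // c c1.
under eq_bigr do rewrite mulrDr.
by rewrite big_split/= lerD// hoelder_le.
Qed.

Lemma ler_lpnorm_sum p n (J : Type) (rs : seq J) (a : J -> 'I_n -> R) : (1 <= p)%E ->
  lpnorm p (fun i => \sum_(j <- rs) a j i) <= \sum_(j <- rs) lpnorm p (a j).
Proof.
move=> p1; elim: rs => [|j rs IH].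
  rewrite big_nil (_ : (fun i => _) = fun=> 0) ?lpnorm0//.
  by apply/funext => i; rewrite big_nil.
rewrite big_cons (_ : (fun i => _) = fun i => a j i + \sum_(j <- rs) a j i).
  by rewrite (le_trans (ler_lpnormD _ _ p1))// lerD2l.
by apply/funext => i; rewrite big_cons.
Qed.

End FiniteLp.

(** * Summing norms *)

Section Summing.
Variables (R : realType) (p : \bar R).
Hypothesis p1 : (1 <= p)%E.

Section WeakNorm.
Variable U : normedModType R.

(* weak_lpnorm p u <= W, in dual form *)
Definition weak_bdd n (u : 'I_n -> U) (W : R) :=
  forall a : 'I_n -> R, lpnorm (hoelder_conjugate p) a <= 1 ->
  `|\sum_i a i *: u i| <= W.

Lemma bop_sumE (V : normedModType R) (f : bop U V) n (a : 'I_n -> R) (u : 'I_n -> U) :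
  f (\sum_i a i *: u i) = \sum_i a i *: f (u i).
Proof.
rewrite (linear_sumE (bop_linear f)); apply: eq_bigr => i _.
exact: (linear_scaleE (bop_linear f)).
Qed.

Lemma weak_bdd_dual n (u : 'I_n -> U) W (phi : dual U) : weak_bdd u W ->
  lpnorm p (fun i => phi (u i)) <= `|phi| * W.
Proof.
move=> uW; apply: lpnorm_lub => // a a1.
have <- : phi (\sum_i a i *: u i) = \sum_i a i * phi (u i) by exact: bop_sumE.
apply: le_trans (ler_norm _) _; apply: le_trans (bop_norm_le _ _) _.
by rewrite ler_wpM2l// uW.
Qed.

Lemma weak_lpnormP n (u : 'I_n -> U) :
  exists w : R, [/\ 0 <= w, weak_lpnorm p u = w%:E & weak_bdd u w].
Proof.
have ub : forall phi : dual U, `|phi| <= 1 ->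
    lpnorm p (fun i => phi (u i)) <= \sum_i `|u i|.
  move=> phi phi1; apply: lpnorm_lub => // a a1; apply: ler_sum => i _.
  apply: le_trans (ler_norm _) _; rewrite normrM -[leRHS]mul1r ler_pM//.
    apply: le_trans a1; apply: lpnorm_coord; exact: hoelder_conj_ge1.
  by rewrite (le_trans (bop_norm_le _ _))// ler_piMl.
have s0 : (0 <= weak_lpnorm p u)%E.
  apply: ereal_sup_ubound; exists 0; first by rewrite /= normr0.
  by congr _%:E; exact: lpnorm0.
have s1 : (weak_lpnorm p u <= (\sum_i `|u i|)%:E)%E.
  by apply: ge_ereal_sup => _ [phi phi1 <-]; rewrite lee_fin ub.
have fs : weak_lpnorm p u \is a fin_num.
  by rewrite ge0_fin_numE// (le_lt_trans s1)// ltry.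
exists (fine (weak_lpnorm p u)); split; [exact: fine_ge0|by rewrite fineK|].
move=> a a1; have [phi [phi1 <-]] := norming_functional (\sum_i a i *: u i).
rewrite -lee_fin fineK//; have -> : phi (\sum_i a i *: u i) = \sum_i a i * phi (u i).
  exact: bop_sumE.
apply: (@le_trans _ _ (lpnorm p (fun i => phi (u i)))%:E).
  by rewrite lee_fin hoelder_le.
by apply: ereal_sup_ubound; exists phi.
Qed.

Lemma weak_bddZ n (u : 'I_n -> U) W c : 0 <= c -> weak_bdd u W ->
  weak_bdd (fun i => c *: u i) (c * W).
Proof.
move=> c0 uW a a1.
have -> : \sum_i a i *: (c *: u i) = c *: \sum_i a i *: u i.
  by rewrite scaler_sumr; apply: eq_bigr => i _; rewrite !scalerA mulrC.
by rewrite normrZ ger0_norm// ler_wpM2l// uW.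
Qed.

Lemma weak_bdd_le n (u : 'I_n -> U) W W' : W <= W' -> weak_bdd u W -> weak_bdd u W'.
Proof. by move=> WW uW a /uW/le_trans; apply. Qed.

End WeakNorm.

Section Operator.
Variables (U V : normedModType R).
Implicit Type S : bop U V.

Definition summing_bdd S (P : R) := forall n (u : 'I_n -> U) W,
  weak_bdd u W -> lpnorm p (fun i => `|S (u i)|) <= P * W.

Let summing_norm_real r S : p = r%:E -> summing_norm p S =
  ereal_inf [set K%:E | K in [set K : R | 0 <= K /\
      forall n (u : 'I_n -> U),
        ((lpnorm p (fun i => `|S (u i)|))%:E <= K%:E * weak_lpnorm p u)%E]].
Proof. by move->. Qed.

Let p_cases : p = +oo%E \/ exists r : R, p = r%:E.
Proof. by case: p p1 => [r||//] _; [right; exists r|left]. Qed.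

Lemma weak_bdd_ge0 n (u : 'I_n -> U) W : weak_bdd u W -> 0 <= W.
Proof.
move=> /(_ (fun=> 0)); rewrite lpnorm0 ?hoelder_conj_ge1// => /(_ ler01).
exact: le_trans.
Qed.

Lemma weak_bdd_le_lpnorm n (u : 'I_n -> U) W : weak_bdd u W ->
  (weak_lpnorm p u <= W%:E)%E.
Proof.
move=> uW; apply: ge_ereal_sup => _ [phi phi1 <-]; rewrite lee_fin.
apply: le_trans (weak_bdd_dual phi uW) _.
by rewrite ler_piMl// (weak_bdd_ge0 uW).
Qed.

Lemma weak_bdd_coord n (u : 'I_n -> U) W i : p = +oo%E -> weak_bdd u W -> `|u i| <= W.
Proof.
move=> pE /(_ (fun j => (j == i)%:R)); rewrite (bigD1 i)//= eqxx scale1r big1 ?addr0.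
  apply; rewrite pE hoelder_conjugatey lpnorm1 (bigD1 i)//= eqxx normr1 big1 ?addr0//.
  by move=> j /negbTE ->; rewrite normr0.
by move=> j /negbTE ->; rewrite scale0r.
Qed.

Lemma summing_norm_bdd S P : 0 <= P -> (summing_norm p S <= P%:E)%E ->
  summing_bdd S P.
Proof.
move=> P0 SP n u W uW; have W0 := weak_bdd_ge0 uW.
have [pE|[r pE]] := p_cases.
  have {}SP : `|S| <= P by move: SP; rewrite pE lee_fin.
  rewrite pE; apply: bigmax_le => [|i _]; first exact: mulr_ge0.
  rewrite normr_id (le_trans (bop_norm_le _ _))// ler_pM//.
  exact: weak_bdd_coord.
apply/ler_addgt0Pr => e e0; have W1 : 0 < W + 1 by rewrite ltr_wpDl.
have eW : 0 < e / (W + 1) by rewrite divr_gt0.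
have : (summing_norm p S < (P + e / (W + 1))%:E)%E.
  by rewrite (le_lt_trans SP)// lte_fin ltrDl.
rewrite (summing_norm_real _ pE) => /ereal_inf_lt[_ [K [K0 SK] <-]]; rewrite lte_fin => KP.
rewrite -lee_fin; apply: le_trans (SK _ _) _.
apply: (@le_trans _ _ (K%:E * W%:E)%E).
  by rewrite lee_wpmul2l ?lee_fin// weak_bdd_le_lpnorm.
rewrite -EFinM lee_fin (le_trans (ler_wpM2r W0 (ltW KP)))// mulrDl lerD2l.
by rewrite mulrAC ler_pdivrMr// ler_wpM2l ?(ltW e0)// lerDl.
Qed.

Lemma summing_bdd_norm S P : 0 <= P ->
  (forall n (u : 'I_n -> U), weak_bdd u 1 -> lpnorm p (fun i => `|S (u i)|) <= P) ->
  (summing_norm p S <= P%:E)%E.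
Proof.
move=> P0 SP; have [pE|[r pE]] := p_cases.
  rewrite pE lee_fin; apply: bop_norm_lub => // x.
  have [->|x0] := eqVneq x 0.
    by rewrite linear0 !normr0 mulr0.
  have nx : 0 < `|x| by rewrite normr_gt0.
  have := SP 1%N (fun=> `|x|^-1 *: x); rewrite pE => h.
  have wb : weak_bdd (fun _ : 'I_1 => `|x|^-1 *: x) 1.
    move=> a; rewrite pE hoelder_conjugatey lpnorm1 !big_ord1 => a1.
    by rewrite !normrZ normfV normr_id mulVf ?gt_eqF// mulr1.
  have := le_trans (le_bigmax _ (fun i => `| `|S (`|x|^-1 *: x)| |) ord0) (h wb).
  rewrite normr_id (linear_scaleE (bop_linear S)) normrZ normfV normr_id mulrC.
  by rewrite ler_pdivrMr.
rewrite (summing_norm_real _ pE); apply: ereal_inf_lbound; exists P => //; split=> // n u.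
have [w [w0 -> uw]] := weak_lpnormP u; rewrite -EFinM lee_fin.
apply/ler_addgt0Pr => e e0; have P1 : 0 < P + 1 by rewrite ltr_wpDl.
(* The weak norm [w] may be 0; the small summand makes it invertible. *)
pose w' := w + e / (P + 1).
have w'0 : 0 < w' by rewrite ltr_wpDl// divr_gt0.
have wb : weak_bdd (fun i => w'^-1 *: u i) 1.
  apply: weak_bdd_le (weak_bddZ _ uw); last by rewrite invr_ge0 ltW.
  by rewrite mulrC ler_pdivrMr// mul1r lerDl divr_ge0// ltW.
have := SP _ _ wb.
have -> : lpnorm p (fun i => `|S (w'^-1 *: u i)|) = w'^-1 * lpnorm p (fun i => `|S (u i)|).
  rewrite -[X in X * _]ger0_norm ?invr_ge0 ?(ltW w'0)// -lpnormZ//.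
  apply: eq_lpnorm => i; rewrite (linear_scaleE (bop_linear S)) normrZ.
  by rewrite ger0_norm// invr_ge0 ltW.
rewrite ler_pdivrMl// => /le_trans; apply; rewrite mulrC mulrDr lerD2l.
by rewrite mulrCA ler_piMr ?(ltW e0)// ler_pdivrMr// mul1r lerDl.
Qed.

Lemma summing_witness S K : 0 <= K -> (K%:E < summing_norm p S)%E ->
  exists n (u : 'I_n -> U), weak_bdd u 1 /\ K < lpnorm p (fun i => `|S (u i)|).
Proof.
move=> K0 KS; apply: contrapT => h.
suff : (summing_norm p S <= K%:E)%E by rewrite leNgt KS.
apply: summing_bdd_norm => // n u u1; rewrite leNgt; apply/negP => Ku.
by apply: h; exists n, u.
Qed.

Lemma summing_norm_ge0 S : (0 <= summing_norm p S)%E.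
Proof.
have [pE|[r pE]] := p_cases; first by rewrite pE lee_fin.
rewrite (summing_norm_real _ pE); apply: le_ereal_inf_tmp => _ [K [K0 _] <-].
by rewrite lee_fin.
Qed.

End Operator.

(** A functional [eta j] maps a family of weak norm at most 1 to a sequence of l_p norm at most
    [|eta j|]; by Minkowski's inequality each functional in the pointwise bound costs its norm. *)
Lemma summing_norm_perturb (U V V' : normedModType R) (S : bop U V) (S' : bop U V')
    (J : finType) (eta : J -> dual U) P : 0 <= P ->
  (summing_norm p S <= P%:E)%E ->
  (forall w, `|S' w| <= `|S w| + \sum_j `|eta j w|) ->
  (summing_norm p S' <= (P + \sum_j `|eta j|)%:E)%E.
Proof.
move=> P0 SP S'S; apply: summing_bdd_norm.
  by rewrite addr_ge0// sumr_ge0.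
move=> n u u1.
apply: (@le_trans _ _ (lpnorm p (fun i => `|S (u i)| + \sum_j `|eta j (u i)|))).
  apply: ler_lpnorm => // i; rewrite normr_id ger0_norm// addr_ge0//.
  exact: sumr_ge0.
apply: le_trans (ler_lpnormD _ _ p1) _; apply: lerD.
  by rewrite -[leRHS]mulr1; exact: (summing_norm_bdd P0 SP).
apply: le_trans (ler_lpnorm_sum _ _ p1) _; apply: ler_sum => j _.
rewrite -[leRHS]mulr1 (_ : lpnorm p _ = lpnorm p (fun i => eta j (u i))).
  exact: weak_bdd_dual.
by apply: eq_lpnorm => i; rewrite normr_id.
Qed.

Lemma summing_norm_finite (U V : normedModType R) (S : bop U V)
    (J : finType) (eta : J -> dual U) :
  (forall w, `|S w| <= \sum_j `|eta j w|) ->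
  (summing_norm p S <= (\sum_j `|eta j|)%:E)%E.
Proof.
move=> Seta; rewrite -[X in X%:E]add0r.
apply: (@summing_norm_perturb U V V (0 : bop U V)) => //.
  apply: summing_bdd_norm => // n u u1.
  rewrite (_ : (fun i => _) = fun=> 0) ?lpnorm0//.
  by apply/funext => i; rewrite [X in `|X|](_ : _ = 0 :> V)// normr0.
by move=> w; rewrite [X in `|X| + _](_ : _ = 0 :> V)// normr0 add0r.
Qed.

End Summing.

(** The infimal convolution of [f] with [|f|] times the norm is sublinear on the completion, at most
    [f] on [V], and at most [|f|] times the norm everywhere. A linear minorant is at most [f] at [v]
    and at [- v], hence extends [f]. *)
Lemma dual_extend (R : realType) (V : normedModType R) (f : dual V) :
  exists F : dual (completion V),
    (forall v, F (completion_incl v) = f v) /\ `|F| <= `|f|.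
Proof.
pose E (c : completion V) :=
  [set r | exists v, r = f v + `|f| * `|c - completion_incl v| ].
pose P c := inf (E c).
have E0 c : E c !=set0 by exists (f 0 + `|f| * `|c - completion_incl 0|), 0.
have Elb c : has_lbound (E c).
  exists (- (`|f| * `|c|)) => _ [v ->]; rewrite -lerBlDr -opprD lerNl.
  rewrite -mulrDr -(linear_oppE (bop_linear f)).
  apply: le_trans (ler_norm _) _; apply: le_trans (bop_norm_le _ _) _.
  rewrite ler_wpM2l// normrN -completion_incl_norm.
  by rewrite -[X in `|X| <= _](subKr c) ler_normB.
have Ple c v : P c <= f v + `|f| * `|c - completion_incl v|.
  by apply: ge_inf => //; exists v.
have leP c a : (forall v, a <= f v + `|f| * `|c - completion_incl v|) -> a <= P c.
  by move=> h; apply: lb_le_inf => // _ [v ->].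
have sP : sublinear P.
  split=> [c d|a c a0].
    rewrite -lerBlDr; apply/leP => v; rewrite lerBlDr -lerBlDl.
    apply/leP => w; rewrite lerBlDr.
    apply: le_trans (Ple _ (v + w)) _.
    rewrite (linear_addE (bop_linear f)) linearD/= opprD.
    rewrite [leRHS]addrACA [f w + _]addrC lerD2l -mulrDr ler_wpM2l//.
    by rewrite [_ + `|c - _|]addrC addrACA ler_normD.
  rewrite -ler_pdivrMl//; apply/leP => v; rewrite ler_pdivrMl//.
  apply: le_trans (Ple _ (a *: v)) _.
  rewrite (linear_scaleE (bop_linear f)) linearZ/= -scalerBr normrZ gtr0_norm//.
  by rewrite mulrCA -mulrDr.
have [F [lF FP _]] := hahn_banach 0 sP.
have FPn c : F c <= `|f| * `|c|.
  apply: le_trans (FP c) _; apply: le_trans (Ple c 0) _.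
  by rewrite !linear0 addr0 add0r.
have [|G [GE G1]] := @bop_ex R (completion V) R F `|f| (normr_ge0 _) lF.
  move=> c; rewrite ler_norml FPn andbT lerNl -(linear_oppE lF).
  by rewrite (le_trans (FPn _))// normrN.
exists G; split=> // v; rewrite GE.
have Fv u : F (completion_incl u) <= f u.
  apply: le_trans (FP _) _; apply: le_trans (Ple _ u) _.
  by rewrite subrr normr0 mulr0 addr0.
apply/le_anti; rewrite Fv/=.
by have := Fv (- v); rewrite linearN/= (linear_oppE lF) (linear_oppE (bop_linear f)) lerN2.
Qed.

(** * Disjoint unions of measure spaces *)

Section DisjointUnion.
Variables (d : nat -> measure_display) (S : forall k, measurableType (d k)).

(** Pieces are indexed by all of [nat], whereas [dsum_measure] charges only those below [n]; hence
    the conditions [k < n] in what follows. *)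
Definition dsum : Type := {k : nat & S k}.
HB.instance Definition _ := Choice.on dsum.
HB.instance Definition _ := isPointed.Build dsum
  (existT (fun k => S k : Type) 0%N (point : S 0%N)).

Definition dsum_in k (x : S k) : dsum := existT (fun k => S k : Type) k x.

Definition dsum_measurable : set (set dsum) :=
  [set A | forall k, measurable (@dsum_in k @^-1` A)].

Let dsum_measurable0 : dsum_measurable set0.
Proof. by move=> k; rewrite preimage_set0. Qed.

Let dsum_measurableC A : dsum_measurable A -> dsum_measurable (~` A).
Proof. by move=> mA k; rewrite preimage_setC; exact: measurableC. Qed.

Let dsum_measurable_bigcup (F : (set dsum)^nat) :
  (forall i, dsum_measurable (F i)) -> dsum_measurable (\bigcup_i F i).
Proof.
by move=> mF k; rewrite preimage_bigcup; apply: bigcup_measurable => i _; exact: mF.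
Qed.

HB.instance Definition _ := @isMeasurable.Build default_measure_display dsum
  dsum_measurable dsum_measurable0 dsum_measurableC dsum_measurable_bigcup.

Lemma measurable_dsum_in k : measurable_fun setT (@dsum_in k).
Proof. by move=> _ A mA; rewrite setTI; exact: mA. Qed.

HB.instance Definition _ k := isMeasurableFun.Build _ _ _ _ (@dsum_in k)
  (@measurable_dsum_in k).

Lemma measurable_fun_dsum d' (T : measurableType d') (f : dsum -> T) :
  (forall k, measurable_fun setT (f \o @dsum_in k)) -> measurable_fun setT f.
Proof.
move=> mf _ A mA; rewrite setTI; have mfA k := mf k measurableT A mA.
by rewrite -[measurable _]/(dsum_measurable _) => k; move: (mfA k); rewrite setTI.
Qed.

Variables (R : realType) (mu : forall k, {measure set (S k) -> \bar R}).
Variables (n : nat) (c : nat -> {nonneg R}).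

Definition dsum_push k : set dsum -> \bar R := pushforward (mu k) (@dsum_in k).

Section PushMeasure.
Variable k : nat.

Let dsum_push0 : dsum_push k set0 = 0%E.
Proof. by rewrite /dsum_push /pushforward preimage_set0 measure0. Qed.

Let dsum_push_ge0 A : (0 <= dsum_push k A)%E.
Proof. exact: measure_ge0. Qed.

Let dsum_push_sigma_additive : semi_sigma_additive (dsum_push k).
Proof.
apply: (@measure_semi_sigma_additive _ _ _ (pushforward (mu k) (@dsum_in k))).
exact: measurable_dsum_in.
Qed.

HB.instance Definition _ := isMeasure.Build _ _ _ (dsum_push k)
  dsum_push0 dsum_push_ge0 dsum_push_sigma_additive.

End PushMeasure.

Definition dsum_part (k : nat) : {measure set dsum -> \bar R} :=
  mscale (c k) (dsum_push k).

Definition dsum_measure : {measure set dsum -> \bar R} := msum dsum_part n.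

(** The proof of total mass 1 is an argument, so that the probability structure can be attached to a
    term carrying it; the term unfolds to [dsum_measure]. *)
Definition dsum_prob of dsum_measure setT = 1%E : set dsum -> \bar R := dsum_measure.

HB.instance Definition _ (M1 : dsum_measure setT = 1%E) :=
  Measure.copy (dsum_prob M1) dsum_measure.
HB.instance Definition _ (M1 : dsum_measure setT = 1%E) :=
  Measure_isProbability.Build _ _ _ (dsum_prob M1) M1.

Lemma dsum_measureE A : dsum_measure A =
  (\sum_(k < n) (c k)%:num%:E * mu k (@dsum_in k @^-1` A))%E.
Proof. by []. Qed.

Lemma dsum_integral (f : dsum -> \bar R) : (forall x, 0 <= f x)%E ->
  measurable_fun setT f ->
  (\int[dsum_measure]_x f x =
   \sum_(k < n) (c k)%:num%:E * \int[mu k]_x f (dsum_in x))%E.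
Proof.
move=> f0 mf; rewrite ge0_integral_measure_sum//; apply: eq_bigr => k _.
rewrite ge0_integral_mscale//; congr (_ * _)%E.
by rewrite ge0_integral_pushforward// preimage_setT.
Qed.

Lemma dsum_ae (P : set dsum) :
  (forall k, (k < n)%N -> {ae mu k, forall x, P (dsum_in x)}) ->
  {ae dsum_measure, forall x, P x}.
Proof.
move=> aeP.
have N k : exists A : set (S k), [/\ measurable A, (k < n)%N -> mu k A = 0%E &
    (k < n)%N -> ~` [set x | P (dsum_in x)] `<=` A].
  have [kn|kn] := boolP (k < n)%N; last by exists set0; split.
  by have [A [mA A0 PA]] := aeP k kn; exists A.
pose B k := sval (cid (N k)).
have mB k : measurable (B k) by rewrite /B; case: cid => A [].
have B0 k : (k < n)%N -> mu k (B k) = 0%E by rewrite /B; case: cid => A [].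
have PB k : (k < n)%N -> ~` [set x | P (dsum_in x)] `<=` B k.
  by rewrite /B; case: cid => A [].
pose C : set dsum := [set x | (projT1 x < n)%N -> B (projT1 x) (projT2 x)].
have CE k : @dsum_in k @^-1` C = if (k < n)%N then B k else setT.
  apply/seteqP; split => x /=; rewrite /C/=; case: ifP => // kn; exact.
pose D : set dsum := C `&` [set x | (projT1 x < n)%N].
have DE k : @dsum_in k @^-1` D = if (k < n)%N then B k else set0.
  rewrite preimage_setI CE; case: ifP => kn.
    rewrite [X in _ `&` X](_ : _ = setT) ?setIT//.
    by apply/seteqP; split => x /=.
  rewrite [X in _ `&` X](_ : _ = set0) ?setI0//.
  by apply/seteqP; split => x //=; rewrite kn.
(* The pieces of index at least [n] have no mass and are put into the exceptional set. *)
exists (D `|` [set x | ~~ (projT1 x < n)%N]); split.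
- rewrite -[measurable _]/(dsum_measurable _) => k; rewrite preimage_setU DE.
  case: ifP => kn; rewrite [X in _ `|` X](_ : _ = if (k < n)%N then set0 else setT).
  + by rewrite kn setU0.
  + by apply/seteqP; split => x /=; rewrite kn.
  + by rewrite kn setUT.
  + by apply/seteqP; split => x /=; rewrite kn.
- rewrite dsum_measureE big1// => k _; rewrite preimage_setU DE ltn_ord.
  rewrite [X in _ `|` X](_ : _ = set0) ?setU0 ?B0 ?mule0//.
  by apply/seteqP; split => x //=; rewrite ltn_ord.
- move=> [k x] /= nP; have [kn|kn] := boolP (k < n)%N; [left|right].
    split=> //; rewrite /C/= => _; exact: PB.
  by [].
Qed.

(** A vanishing sum of nonnegative terms vanishes termwise, and a positive weight can be cancelled.
    This is why gluing asks for strictly positive weights. *)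
Lemma dsum_ae_in (P : set dsum) k : (k < n)%N -> 0 < (c k)%:num ->
  {ae dsum_measure, forall x, P x} -> {ae mu k, forall x, P (dsum_in x)}.
Proof.
move=> kn ck [A [mA A0 PA]]; exists (@dsum_in k @^-1` A); split; first exact: mA.
  move: A0; rewrite dsum_measureE => /eqP; rewrite seq_psume_eq0; last first.
    by move=> i _; rewrite mule_ge0// lee_fin.
  move=> /allP/(_ (Ordinal kn) (mem_index_enum _)) /=.
  by rewrite mule_eq0 eqe gt_eqF//= => /eqP.
by move=> x /PA.
Qed.

End DisjointUnion.

(** * Lebesgue spaces on a disjoint union *)

Section LqFacts.
Context d (T : measurableType d) (R : realType) (mu : {measure set T -> \bar R}).

Lemma Lclass_repr (q : \bar R) (q1 : (1 <= q)%E) (a : Lq mu q1) : Lclass (repr a) = a.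
Proof. by rewrite /Lclass/snpi reprK. Qed.

Lemma repr_Lclass_ae (q : \bar R) (q1 : (1 <= q)%E) (f : LfunType mu q1) :
  repr (Lclass f) = f %[ae mu].
Proof. by apply/Lclass_eq; rewrite Lclass_repr. Qed.

Lemma Lclass_linear (q : \bar R) (q1 : (1 <= q)%E) (a : R) (f g : LfunType mu q1) :
  Lclass (a *: f + g) = a *: Lclass f + Lclass g.
Proof. exact: snpi_is_linear. Qed.

Lemma repr_linear_ae (q : \bar R) (q1 : (1 <= q)%E) (a : R) (u v : Lq mu q1) :
  repr (a *: u + v) = (a *: repr u + repr v : LfunType mu q1) %[ae mu].
Proof. by apply/Lclass_eq; rewrite Lclass_linear !Lclass_repr. Qed.

Lemma ae_null (P : set T) : ~~ (0 < mu setT)%E -> {ae mu, forall x, P x}.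
Proof.
rewrite -leNgt => mu0; exists setT; split => //.
by apply/le_anti; rewrite mu0 measure_ge0.
Qed.

Lemma Linfty_leP (f : T -> R) (M : R) : 0 <= M ->
  (Lnorm mu +oo (EFin \o f) <= M%:E)%E <-> {ae mu, forall x, `|f x| <= M}.
Proof.
move=> M0; rewrite unlock /Lnorm; case: ifPn => mu0.
  by split => [/ess_supP|fM]; [|apply/ess_supP].
by split => [_|_]; [exact: ae_null|rewrite lee_fin].
Qed.

Lemma Linfty_norm_leP (u : Lq mu (leey 1)) (M : R) : 0 <= M ->
  `|u| <= M <-> {ae mu, forall x, `|repr u x| <= M}.
Proof.
move=> M0; rewrite -Linfty_leP//.
by rewrite -{1}(Lclass_repr u) -lee_fin Lclass_norm.
Qed.

Lemma Lq_powR (r : R) (r1 : (1 <= r%:E)%E) (u : Lq mu r1) :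
  ((`|u| `^ r)%:E = \int[mu]_x (`|repr u x| `^ r)%:E)%E.
Proof.
have r0 : r != 0 by rewrite gt_eqF// (lt_le_trans ltr01).
rewrite -poweR_EFin -{1}(Lclass_repr u) Lclass_norm poweR_Lnorm//.
Qed.

Lemma Lfun_real (r : R) (f : T -> R) : (1 <= r%:E)%E -> measurable_fun setT f ->
  f \in Lfun mu r%:E <-> (\int[mu]_x (`|f x| `^ r)%:E < +oo)%E.
Proof.
move=> r1 mf; have r0 : 0 < r by rewrite (lt_le_trans ltr01).
have NE : (\int[mu]_x (`|f x| `^ r)%:E = Lnorm mu r%:E (EFin \o f) `^ r)%E.
  by rewrite poweR_Lnorm// gt_eqF.
rewrite NE; split => [/andP[_ /[!inE] /= f1]|f1].
  exact: poweR_lty.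
apply/andP; split; rewrite inE//=.
by apply: (@lty_poweRy _ _ r) => //; rewrite gt_eqF.
Qed.

End LqFacts.

Section Glue.
Variables (R : realType) (d : nat -> measure_display).
Variables (S : forall k, measurableType (d k)) (mu : forall k, {measure set (S k) -> \bar R}).
Variables (n : nat) (c : nat -> {nonneg R}).
Hypothesis c0 : forall k, 0 < (c k)%:num.
Local Notation M := (dsum_measure mu n c).
Local Notation inj := (@dsum_in d S _).

Section Restrict.
Variables (q : \bar R) (q1 : (1 <= q)%E).

Lemma measurable_dsum_comp k (f : dsum S -> R) : measurable_fun setT f ->
  measurable_fun setT (f \o @dsum_in d S k).
Proof. by move=> mf; apply: measurableT_comp => //; exact: measurable_dsum_in. Qed.

Lemma dsum_Lnormr (r : R) (f : dsum S -> R) : measurable_fun setT f ->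
  (\int[M]_x (`|f x| `^ r)%:E =
   \sum_(k < n) (c k)%:num%:E * \int[mu k]_x (`|f (dsum_in x)| `^ r)%:E)%E.
Proof.
move=> mf; rewrite dsum_integral//.
apply/measurable_EFinP/(measurableT_comp (measurable_powR _)) => //.
exact: measurableT_comp.
Qed.

Let Lfun_restrict_fun k (f : dsum S -> R) : (k < n)%N -> measurable_fun setT f ->
  f \in Lfun M q -> (f \o @dsum_in d S k) \in Lfun (mu k) q.
Proof.
move=> kn mf; have mfk := measurable_dsum_comp (k := k) mf.
case: q q1 => [r r1|_|//]; last first.
  move=> /andP[_ /[!inE] /=]; rewrite /finite_norm => foo.
  apply/andP; split; rewrite inE//= /finite_norm.
  set N := Lnorm M +oo (EFin \o f) in foo.
  have N0 : (0 <= N)%E by exact: Lnorm_ge0.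
  have Nfin : N \is a fin_num by rewrite ge0_fin_numE.
  rewrite (@le_lt_trans _ _ N)//= -(fineK Nfin).
  apply/(Linfty_leP (mu k) (f \o @dsum_in d S k) (fine_ge0 N0)).
  apply: (@dsum_ae_in _ _ _ _ n c (fun x => `|f x| <= fine N) k) => //.
  by apply/(Linfty_leP M f (fine_ge0 N0)); rewrite fineK.
move=> /(Lfun_real M r1 mf); rewrite dsum_Lnormr// => foo.
apply/(Lfun_real (mu k) r1 mfk); rewrite -(@lte_pmul2l _ (c k)%:num%:E)//.
  rewrite gt0_muley ?lte_fin//; apply: le_lt_trans foo.
  rewrite (bigD1 (Ordinal kn))//= leeDl// sume_ge0// => i _.
  by rewrite mule_ge0 ?lee_fin// integral_ge0// => x _; rewrite lee_fin powR_ge0.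
by rewrite lte_fin.
Qed.

Lemma Lfun_restrict k (f : LfunType M q1) : (k < n)%N ->
  (f \o @dsum_in d S k) \in Lfun (mu k) q.
Proof. by move=> kn; apply: Lfun_restrict_fun => //; exact: LfunP. Qed.

(** The default 0 of [insubd] is never taken for [k < n], by [Lfun_restrict]; independence of the
    representative is [dsum_restrictE]. *)
Definition dsum_restrict k (u : Lq M q1) : Lq (mu k) q1 :=
  Lclass (insubd (0 : LfunType (mu k) q1) (repr u \o @dsum_in d S k)).

Lemma dsum_restrictE k (f : LfunType M q1) (g : LfunType (mu k) q1) : (k < n)%N ->
  {ae mu k, forall x, f (dsum_in x) = g x} -> dsum_restrict k (Lclass f) = Lclass g.
Proof.
move=> kn fg; apply/Lclass_eq.
have := repr_Lclass_ae f => rf.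
have {}rf : {ae mu k, forall x, repr (Lclass f) (@dsum_in d S k x) = f (dsum_in x)}.
  apply: (@dsum_ae_in _ _ _ _ n c (fun x => repr (Lclass f) x = f x)) => //.
  by apply: filterS rf => x /(_ I).
have vE : insubd (0 : LfunType (mu k) q1) (repr (Lclass f) \o @dsum_in d S k) =
    repr (Lclass f) \o @dsum_in d S k :> (S k -> R).
  by rewrite -[LHS]/(val _) insubdK// Lfun_restrict.
by apply: filterS2 rf fg => x rfx fgx _; rewrite vE /= rfx.
Qed.

Lemma dsum_restrict_repr_ae k (u : Lq M q1) : (k < n)%N ->
  {ae mu k, forall x, repr (dsum_restrict k u) x = repr u (dsum_in x)}.
Proof.
move=> kn.
have vE : insubd (0 : LfunType (mu k) q1) (repr u \o @dsum_in d S k) =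
    repr u \o @dsum_in d S k :> (S k -> R).
  by rewrite -[LHS]/(val _) insubdK// Lfun_restrict.
have := repr_Lclass_ae (insubd (0 : LfunType (mu k) q1) (repr u \o @dsum_in d S k)).
by apply: filterS => x /(_ I); rewrite -/(dsum_restrict k u) vE.
Qed.

Lemma dsum_restrict_linear k : (k < n)%N -> linear (dsum_restrict k).
Proof.
move=> kn a u v; rewrite -{1}(Lclass_repr u) -{1}(Lclass_repr v) -Lclass_linear.
rewrite -(Lclass_repr (dsum_restrict k u)) -(Lclass_repr (dsum_restrict k v)) -Lclass_linear.
apply: dsum_restrictE => //.
apply: filterS2 (dsum_restrict_repr_ae u kn) (dsum_restrict_repr_ae v kn) => x ux vx.
rewrite -[LHS]/(a * repr u (dsum_in x) + repr v (dsum_in x)) -ux -vx.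
by [].
Qed.

End Restrict.

Lemma dsum_restrict_norm_real (r : R) (r1 : (1 <= r%:E)%E) (u : Lq M r1) :
  `|u| `^ r = \sum_(k < n) (c k)%:num * `|dsum_restrict k u| `^ r.
Proof.
apply: EFin_inj; rewrite Lq_powR dsum_Lnormr//.
rewrite -sumEFin; apply: eq_bigr => k _; rewrite EFinM Lq_powR; congr (_ * _)%E.
apply: ae_eq_integral => //.
- apply/measurable_EFinP/(measurableT_comp (measurable_powR _)) => //.
  by apply: measurableT_comp => //; exact: measurable_dsum_comp.
- apply/measurable_EFinP/(measurableT_comp (measurable_powR _)) => //.
  exact: measurableT_comp.
- have := dsum_restrict_repr_ae u (ltn_ord k).
  by apply: filterS => x /= -> _.
Qed.

Lemma dsum_restrict_norm_infty k (u : Lq M (leey 1)) : (k < n)%N ->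
  `|dsum_restrict k u| <= `|u|.
Proof.
move=> kn; apply/Linfty_norm_leP => //.
have /(Linfty_norm_leP u (normr_ge0 _)) ae1 := lexx `|u|.
have := dsum_ae_in kn (c0 k) ae1.
by apply: filterS2 (dsum_restrict_repr_ae u kn) => x ->.
Qed.

Section GlueMap.
Variable Z : normedModType R.
Variable A : forall k, bop Z (Lq (mu k) (leey 1)).
Hypothesis A1 : forall k, `|A k| <= 1.

Definition dsum_glue_fun (z : Z) (x : dsum S) : R :=
  if (projT1 x < n)%N then repr (A (projT1 x) z) (projT2 x) else 0.

Lemma measurable_glue z : measurable_fun setT (dsum_glue_fun z).
Proof.
apply: measurable_fun_dsum => k.
rewrite (_ : dsum_glue_fun z \o @dsum_in d S k =
  if (k < n)%N then (repr (A k z) : S k -> R) else cst 0); first by case: ifP.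
by apply/funext => x; rewrite /dsum_glue_fun/=; case: ifP.
Qed.

Lemma dsum_glue_ae z : {ae M, forall x, `|dsum_glue_fun z x| <= `|z| }.
Proof.
apply: dsum_ae => k kn.
have /(Linfty_norm_leP (A k z) (normr_ge0 _)) : `|A k z| <= `|z|.
  by rewrite (le_trans (bop_norm_le _ _))// ler_piMl.
by apply: filterS => x; rewrite /dsum_glue_fun/= kn.
Qed.

Lemma dsum_glue_Lfun z : dsum_glue_fun z \in Lfun M +oo.
Proof.
have mg := measurable_glue z.
apply/andP; split; rewrite inE//= /finite_norm.
rewrite (@le_lt_trans _ _ `|z|%:E) ?ltry//.
by apply/(Linfty_leP M (dsum_glue_fun z) (normr_ge0 z)); exact: dsum_glue_ae.
Qed.

Definition dsum_glue (z : Z) : Lq M (leey 1) := Lclass (Lfun_Sub (leey 1) (dsum_glue_Lfun z)).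

Lemma dsum_glue_linear : linear dsum_glue.
Proof.
move=> a z w; rewrite /dsum_glue -Lclass_linear; apply/Lclass_eq.
suff : {ae M, forall x, dsum_glue_fun (a *: z + w) x = a * dsum_glue_fun z x + dsum_glue_fun w x}.
  by apply: filterS.
apply: dsum_ae => k kn; rewrite /dsum_glue_fun/= kn.
have := repr_linear_ae a (A k z) (A k w).
rewrite -(bop_linear (A k)).
by apply: filterS => x /(_ I).
Qed.

Lemma dsum_glue_norm z : `|dsum_glue z| <= 1 * `|z|.
Proof.
rewrite mul1r -lee_fin Lclass_norm.
by apply/(Linfty_leP M (dsum_glue_fun z) (normr_ge0 z)); exact: dsum_glue_ae.
Qed.

Lemma dsum_restrict_glue k z : (k < n)%N -> dsum_restrict k (dsum_glue z) = A k z.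
Proof.
move=> kn; rewrite -(Lclass_repr (A k z)); apply: dsum_restrictE => //.
by apply: nearW => x /=; rewrite /dsum_glue_fun/= kn.
Qed.

End GlueMap.
End Glue.

(** * Gluing factorizations *)

Section Factorizations.
Variables (R : realType) (q : \bar R) (q1 : (1 <= q)%E) (Z X : normedModType R).

(** Factorizations are packaged with their measure spaces so that [choice] can select one for every
    [k]. *)
Record fact_infty := FactInfty {
  fi_d : measure_display; fi_S : measurableType fi_d;
  fi_mu : {measure set fi_S -> \bar R};
  fi_A : bop Z (Lq fi_mu (leey 1)); fi_B : bop (Lq fi_mu (leey 1)) X }.

Record fact_real := FactReal {
  fr_d : measure_display; fr_S : measurableType fr_d;
  fr_mu : probability fr_S R;
  fr_A : bop Z (Lq fr_mu (leey 1)); fr_B : bop (Lq fr_mu q1) X }.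

(** An attained factorization with [A] scaled into the unit ball, so that the whole constant sits on
    [B]. *)
Definition factors (T : bop Z X) (D : R) : Prop :=
  if q == +oo%E then
    exists F, [/\ forall z, T z = fi_B F (fi_A F z), `|fi_A F| <= 1 & `|fi_B F| <= D]
  else
    exists F, [/\ forall z, T z = fr_B F (formal_incl q1 (fr_A F z)),
                  `|fr_A F| <= 1 & `|fr_B F| <= D].

End Factorizations.

Section Factors.
Variables (R : realType) (q : \bar R) (q1 : (1 <= q)%E).

Lemma formal_incl_linear d (S : measurableType d) (mu : probability S R) :
  linear (@formal_incl d S R mu q q1).
Proof.
move=> a u v; rewrite /formal_incl -Lclass_linear; apply/Lclass_eq.
by have := repr_linear_ae a u v; apply: filterS => x /(_ I).
Qed.

Lemma integral_norm_factors (Z X : normedModType R) (T : bop Z X) (D : R) :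
  (integral_norm q1 T < D%:E)%E -> factors q1 T D.
Proof.
rewrite /integral_norm /factors; case: ifPn => _.
  move=> /ereal_inf_lt[_ [d [S [mu [A [B [TE ->]]]]]]]; rewrite lte_fin => ABD.
  (* For [A = 0] rescaling is impossible, but then [T = 0]. *)
  have [A0|A0] := eqVneq A 0.
    exists (@FactInfty R Z X d S mu 0 0) => /=; rewrite !normr0 ler01; split => //; last first.
      by rewrite (le_trans _ (ltW ABD))// mulr_ge0.
    by move=> z; rewrite TE A0 [X in B X](_ : _ = 0)// linear0.
  have An : 0 < `|A| by rewrite normr_gt0.
  exists (@FactInfty R Z X d S mu (`|A|^-1 *: A) (`|A| *: B)); split => /=.
  - move=> z; rewrite TE -[RHS]/(`|A| *: B (`|A|^-1 *: A z)).
    by rewrite linearZ/= scalerA mulfV ?gt_eqF// scale1r.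
  - by rewrite normrZ normfV normr_id mulVf// gt_eqF.
  - by rewrite normrZ normr_id ltW.
move=> /ereal_inf_lt[_ [d [S [mu [A [B [TE ->]]]]]]]; rewrite lte_fin => ABD.
have l0 : formal_incl q1 (0 : Lq mu (leey 1)) = 0.
  by rewrite -(scale0r 0) (linear_scaleE (formal_incl_linear (mu := mu))) scale0r.
have [A0|A0] := eqVneq A 0.
  exists (@FactReal R q q1 Z X d S mu 0 0) => /=; rewrite !normr0 ler01; split => //; last first.
    by rewrite (le_trans _ (ltW ABD))// mulr_ge0.
  move=> z; rewrite TE A0 [X in formal_incl q1 X](_ : _ = 0)// l0 linear0.
  by [].
have An : 0 < `|A| by rewrite normr_gt0.
exists (@FactReal R q q1 Z X d S mu (`|A|^-1 *: A) (`|A| *: B)); split => /=.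
- move=> z; rewrite TE -[RHS]/(`|A| *: B (formal_incl q1 (`|A|^-1 *: A z))).
  rewrite (linear_scaleE (formal_incl_linear (mu := mu))).
  by rewrite linearZ/= scalerA mulfV ?gt_eqF// scale1r.
- by rewrite normrZ normfV normr_id mulVf// gt_eqF.
- by rewrite normrZ normr_id ltW.
Qed.

Lemma factors_integral_norm (Z X : normedModType R) (T : bop Z X) (D : R) :
  factors q1 T D -> (integral_norm q1 T <= D%:E)%E.
Proof.
rewrite /integral_norm /factors; case: ifPn => _.
  move=> [[d S mu A B] /= [TE A1 BD]].
  apply: (@le_trans _ _ (`|A| * `|B|)%:E).
    by apply: ereal_inf_lbound; exists d, S, mu, A, B.
  by rewrite lee_fin (le_trans _ BD)// ler_piMl.
move=> [[d S mu A B] /= [TE A1 BD]].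
apply: (@le_trans _ _ (`|A| * `|B|)%:E).
  by apply: ereal_inf_lbound; exists d, S, mu, A, B.
by rewrite lee_fin (le_trans _ BD)// ler_piMl.
Qed.

(** For nonnegative [t] and [tau]: the norm of [t] in the weighted space l_q^n(c) is at most
    [tau]. *)
Definition weighted_le n (c t : nat -> R) (tau : R) : Prop :=
  match q with
  | r%:E => \sum_(k < n) c k * t k `^ r <= tau `^ r
  | _ => forall k, (k < n)%N -> t k <= tau
  end.

(** On the disjoint union with weights [c], [A] is the direct sum of the [A_k], still of norm at
    most 1, and [B u = \sum_k J_k (B_k u_k)] with [u_k] the restriction of [u]. The numbers
    [t_k = |u_k|] satisfy [weighted_le] with [tau = |u|], so the hypothesis on [J] bounds [B] by
    [D]. *)
Lemma factors_glue (Z X Y : normedModType R) n (T_ : nat -> bop Z X) (b : nat -> R)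
    (J : nat -> bop X Y) (c : nat -> R) (D : R) (T : bop Z Y) :
  (forall k, 0 < c k) -> \sum_(k < n) c k = 1 -> 0 <= D ->
  (forall k, factors q1 (T_ k) (b k)) ->
  (forall (x : nat -> X) (t : nat -> R) (tau : R), (forall k, 0 <= t k) -> 0 <= tau ->
     (forall k, `|x k| <= b k * t k) -> weighted_le n c t tau ->
     `|\sum_(k < n) J k (x k)| <= D * tau) ->
  (forall z, T z = \sum_(k < n) J k (T_ k z)) ->
  factors q1 T D.
Proof.
move=> c0 c1 D0 FT JD TE; rewrite /factors.
pose cn k : {nonneg R} := NngNum (ltW (c0 k)).
have cn0 k : 0 < (cn k)%:num by exact: c0.
case: ifPn => [/eqP qE|qE].
  have {}FT k : exists F : fact_infty Z X,
      [/\ forall z, T_ k z = fi_B F (fi_A F z), `|fi_A F| <= 1 & `|fi_B F| <= b k].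
    by have := FT k; rewrite /factors ifT//; exact/eqP.
  have [F FP] := choice FT.
  pose d k := fi_d (F k); pose S k : measurableType (d k) := fi_S (F k).
  pose mu k : {measure set (S k) -> \bar R} := fi_mu (F k).
  pose A k : bop Z (Lq (mu k) (leey 1)) := fi_A (F k).
  pose B k : bop (Lq (mu k) (leey 1)) X := fi_B (F k).
  have TBA k z : T_ k z = B k (A k z) by have [+ _ _] := FP k; apply.
  have A1 k : `|A k| <= 1 by have [_ + _] := FP k.
  have Bb k : `|B k| <= b k by have [_ _] := FP k.
  have [AA [AAE AA1]] := bop_ex ler01 (dsum_glue_linear n cn A1) (dsum_glue_norm n cn A1).
  pose BF (u : Lq (dsum_measure mu n cn) (leey 1)) : Y :=
    \sum_(k < n) J k (B k (dsum_restrict k u)).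
  have lBF : linear BF.
    move=> a u v; rewrite /BF scaler_sumr -big_split/=; apply: eq_bigr => k _.
    rewrite (dsum_restrict_linear cn0 (ltn_ord k)).
    by rewrite (bop_linear (B k)) (bop_linear (J k)).
  have BFD u : `|BF u| <= D * `|u|.
    apply: (JD (fun k => B k (dsum_restrict k u)) (fun k => `|dsum_restrict k u|)) => //.
    - by move=> k; rewrite (le_trans (bop_norm_le _ _))// ler_wpM2r.
    - by rewrite /weighted_le qE => k kn; exact: dsum_restrict_norm_infty.
  have [BB [BBE BBD]] := bop_ex D0 lBF BFD.
  exists (@FactInfty R Z Y _ (dsum S) (dsum_measure mu n cn) AA BB).
  split=> //= z; rewrite TE BBE AAE /BF; apply: eq_bigr => k _.
  by rewrite dsum_restrict_glue// TBA.
have [r qr] : exists r : R, q = r%:E.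
  by case: (q) q1 qE => [r||//] _; [exists r|].
have {}FT k : exists F : fact_real q1 Z X,
    [/\ forall z, T_ k z = fr_B F (formal_incl q1 (fr_A F z)),
        `|fr_A F| <= 1 & `|fr_B F| <= b k].
  by have := FT k; rewrite /factors (negbTE qE).
have [F FP] := choice FT.
pose d k := fr_d (F k); pose S k : measurableType (d k) := fr_S (F k).
pose mu k : probability (S k) R := fr_mu (F k).
pose A k : bop Z (Lq (mu k) (leey 1)) := fr_A (F k).
pose B k : bop (Lq (mu k) q1) X := fr_B (F k).
have TBA k z : T_ k z = B k (formal_incl q1 (A k z)) by have [+ _ _] := FP k; apply.
have A1 k : `|A k| <= 1 by have [_ + _] := FP k.
have Bb k : `|B k| <= b k by have [_ _] := FP k.
pose M := dsum_measure (fun k => mu k : {measure set (S k) -> \bar R}) n cn.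
have M1 : M setT = 1%:E.
  rewrite dsum_measureE -c1 -sumEFin; apply: eq_bigr => k _.
  rewrite preimage_setT [X in (_ * X)%E](_ : _ = 1%:E) ?mule1//.
  exact: probability_setT.
pose PM : probability (dsum S) R := dsum_prob M1.
have [AA [AAE AA1]] := bop_ex ler01 (dsum_glue_linear n cn A1) (dsum_glue_norm n cn A1).
pose BF (u : Lq M q1) : Y :=
  \sum_(k < n) J k (B k (dsum_restrict k u)).
have lBF : linear BF.
  move=> a u v; rewrite /BF scaler_sumr -big_split/=; apply: eq_bigr => k _.
  rewrite (dsum_restrict_linear cn0 (ltn_ord k)).
  by rewrite (bop_linear (B k)) (bop_linear (J k)).
have BFD u : `|BF u| <= D * `|u|.
  apply: (JD (fun k => B k (dsum_restrict k u)) (fun k => `|dsum_restrict k u|)) => //.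
  - by move=> k; rewrite (le_trans (bop_norm_le _ _))// ler_wpM2r.
  - move: (q1) u; rewrite /weighted_le qr => r1 u.
    by rewrite (dsum_restrict_norm_real cn0).
have [BB [BBE BBD]] := bop_ex D0 lBF BFD.
(* [PM] unfolds to [M], so the operators may be read over either measure; [formal_incl] requires the
   probability. *)
pose AA' : bop Z (Lq PM (leey 1)) := AA.
pose BB' : bop (Lq PM q1) Y := BB.
exists (@FactReal R q q1 Z Y _ (dsum S) PM AA' BB'); split=> //= z.
have gq : dsum_glue_fun n A z \in Lfun PM q.
  apply: (Lfun_subset q1 (leey 1) _ (leey q) (dsum_glue_Lfun n cn A1 z)).
  by rewrite M1.
pose G : LfunType PM q1 := Lfun_Sub q1 gq.
have AG : formal_incl q1 (AA' z) = Lclass G.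
  have -> : AA' z = Lclass (Lfun_Sub (leey 1) (dsum_glue_Lfun n cn A1 z)) :> Lq PM (leey 1).
    exact: AAE.
  exact: formal_inclE.
rewrite AG -[BB' _]/(BB (Lclass (G : LfunType M q1))) BBE TE /BF.
apply: eq_bigr => k _; rewrite TBA; congr (J k (B k _)).
rewrite {1}/formal_incl; apply/esym/(dsum_restrictE cn0) => //.
by apply: nearW => x /=; rewrite /dsum_glue_fun/= ltn_ord.
Qed.

End Factors.

(** * The integral norm is a norm *)

Section IntegralNormTheory.
Variables (R : realType) (q : \bar R) (q1 : (1 <= q)%E).

(** The mean is at most the power mean, by Young's inequality for [t k / s] and 1, with [s] slightly
    above [tau] to be invertible. *)
Lemma weighted_le_mean n (c t : nat -> R) (tau : R) :
  (forall k, 0 <= c k) -> \sum_(k < n) c k = 1 -> (forall k, 0 <= t k) -> 0 <= tau ->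
  weighted_le q n c t tau -> \sum_(k < n) c k * t k <= tau.
Proof.
move=> c0 c1 t0 tau0; rewrite /weighted_le; case: q q1 => [r||//] r1; last first.
  move=> tk; rewrite -[leRHS]mul1r -c1 mulr_suml; apply: ler_sum => k _.
  by rewrite ler_wpM2l// tk.
move=> ct; have r0 : 0 < r by rewrite (lt_le_trans ltr01).
move: r1; rewrite lee_fin le_eqVlt => /predU1P[rE|r1].
  move: ct; rewrite -rE powRr1//; congr (_ <= _); apply: eq_bigr => k _.
  by rewrite powRr1.
apply/ler_addgt0Pr => e e0; pose s := tau + e.
have s0 : 0 < s by rewrite ltr_wpDl.
have cs : \sum_(k < n) c k * t k `^ r <= s `^ r.
  by rewrite (le_trans ct)// ge0_ler_powR ?nnegrE ?(ltW r0) ?(ltW s0)// lerDl ltW.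
pose r' := (1 - r^-1)^-1.
have rV : r^-1 < 1 by rewrite invf_lt1.
have r'0 : 0 < r' by rewrite invr_gt0 subr_gt0.
have young k : t k / s <= (t k / s) `^ r / r + 1 / r'.
  have := @conjugate_powR R (t k / s) 1 r r'.
  rewrite mulr1 powR1; apply; rewrite ?divr_ge0 ?(ltW s0)//.
  by rewrite invrK addrC subrK.
rewrite -[leRHS]mulr1 -/s mulrC -ler_pdivrMr// mulr_suml.
apply: (@le_trans _ _ (\sum_(k < n) (c k * t k `^ r / s `^ r / r + c k / r'))).
  apply: ler_sum => k _; rewrite -[_ * t k / s]mulrA.
  apply: le_trans (ler_wpM2l (c0 k) (young k)) _.
  rewrite mulrDr mul1r powRM ?invr_ge0 ?(ltW s0)// -!mulrA.
  by rewrite -powR_inv1 ?(ltW s0)// powRAC powR_inv1 ?powR_ge0.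
rewrite big_split/= -!mulr_suml c1.
apply: (@le_trans _ _ (1 / r + 1 / r')).
  rewrite lerD2r ler_wpM2r ?invr_ge0 ?(ltW r0)// ler_pdivrMr ?powR_gt0//.
  by rewrite mul1r.
by rewrite !div1r /r' invrK addrC subrK.
Qed.

(** Both factorizations are glued with weights [c_i = E_i / (E1 + E2)] and [J] the identity:
    [\sum_i E_i t_i] is [E1 + E2] times the weighted mean of the [t_i], which is at most [tau]. The
    slack makes the weights positive and the factorizations attained. *)
Lemma integral_normD (Z X : normedModType R) (T T1 T2 : bop Z X) (D1 D2 : R) :
  0 <= D1 -> 0 <= D2 ->
  (integral_norm q1 T1 <= D1%:E)%E -> (integral_norm q1 T2 <= D2%:E)%E ->
  (forall z, T z = T1 z + T2 z) -> (integral_norm q1 T <= (D1 + D2)%:E)%E.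
Proof.
move=> D10 D20 T1D T2D TE; apply/lee_addgt0Pr => e e0; rewrite -EFinD.
pose E1 := D1 + e / 2; pose E2 := D2 + e / 2.
have e2 : 0 < e / 2 by rewrite divr_gt0.
have E10 : 0 < E1 by rewrite ltr_wpDl.
have E20 : 0 < E2 by rewrite ltr_wpDl.
have -> : D1 + D2 + e = E1 + E2 by rewrite /E1 /E2; lra.
have E0 : 0 < E1 + E2 by rewrite addr_gt0.
have F1 : factors q1 T1 E1.
  by apply: integral_norm_factors; rewrite (le_lt_trans T1D)// lte_fin ltrDl.
have F2 : factors q1 T2 E2.
  by apply: integral_norm_factors; rewrite (le_lt_trans T2D)// lte_fin ltrDl.
have [I [IE _]] : exists I : bop X X, (forall x, I x = id x) /\ `|I| <= 1.
  by apply: bop_ex => // x; rewrite mul1r.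
have fld (a b x y s : R) : s != 0 -> a * x + b * y = s * (a / s * x + b / s * y).
  by move=> s0; field.
pose E (k : nat) := if k is 0%N then E1 else E2.
pose Ti (k : nat) := if k is 0%N then T1 else T2.
pose c k := E k / (E1 + E2).
have c0 k : 0 < c k by rewrite divr_gt0//; case: k.
have c1 : \sum_(k < 2) c k = 1.
  by rewrite 2!big_ord_recl big_ord0 addr0 -mulrDl mulfV ?gt_eqF.
apply: factors_integral_norm.
apply: (factors_glue (T_ := Ti) (b := E) (J := fun=> I) c0 c1 (ltW E0)).
- by case.
- move=> x t tau t0 tau0 xt /(weighted_le_mean (fun k => ltW (c0 k)) c1 t0 tau0).
  rewrite !big_ord_recl !big_ord0 !addr0 !IE => ct.
  apply: le_trans (ler_normD _ _) _.
  apply: le_trans (lerD (xt 0%N) (xt 1%N)) _.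
  have -> : E 0%N * t 0%N + E 1%N * t 1%N =
      (E1 + E2) * (c 0%N * t 0%N + c 1%N * t 1%N).
    by apply: fld; rewrite gt_eqF.
  by rewrite ler_pM2l.
- by move=> z; rewrite !big_ord_recl big_ord0 addr0 !IE TE.
Qed.

End IntegralNormTheory.

(** * Rank one operators and perturbation of the integral norm *)

Section Dirac.
Variables (R : realType) (q : \bar R) (q1 : (1 <= q)%E).

Lemma dirac_ae d (S : measurableType d) (a : S) (P : set S) :
  {ae (\d_a : {measure set S -> \bar R}), forall x, P x} -> P a.
Proof.
move=> [A [mA A0 PA]]; apply: contrapT => nP.
have := A0; rewrite -[_ A]/(\d_a A) diracE mem_set; last exact: PA.
by move=> /eqP; rewrite eqe oner_eq0.
Qed.

Lemma dirac_norm_ge (a : unit) (u : Lq (\d_a : probability unit R) q1) :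
  `|repr u a| <= `|u|.
Proof.
have [qE|[r qE]] : q = +oo%E \/ exists r : R, q = r%:E.
    by case: (q) q1 => [r||//] _; [right; exists r|left].
  move: u; move: (q1); rewrite qE => q1' u.
  rewrite (bool_irrelevance q1' (leey 1)) in u *.
  by have /(Linfty_norm_leP u (normr_ge0 _))/dirac_ae := lexx `|u|.
move: u; move: (q1); rewrite qE => r1 u.
have r0 : 0 < r by rewrite (lt_le_trans ltr01).
have := Lq_powR u; rewrite integral_dirac//.
rewrite diracT mul1e => -[] /(congr1 (fun x => x `^ r^-1)).
by rewrite -!powRrM mulfV ?gt_eqF// !powRr1// => ->.
Qed.

End Dirac.

Section IntegralNormPerturb.
Variables (R : realType) (q : \bar R) (q1 : (1 <= q)%E).

Lemma rank1_ex (Z X : normedModType R) (zeta : dual Z) (x : X) :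
  exists T : bop Z X, forall z, T z = zeta z *: x.
Proof.
have [|||T [TE _]] := @bop_ex R Z X (fun z => zeta z *: x) (`|zeta| * `|x|).
- exact: mulr_ge0.
- by move=> a z w; rewrite (bop_linear zeta) scalerDl scalerA.
- by move=> z; rewrite normrZ mulrAC ler_wpM2r// bop_norm_le.
- by exists T.
Qed.

Let cst_Lfun (a : unit) (x : R) : (cst x : unit -> R) \in Lfun (\d_a : probability unit R) +oo.
Proof.
apply/andP; split; rewrite inE//= /finite_norm.
rewrite (@le_lt_trans _ _ `|x|%:E) ?ltry//.
by apply/(Linfty_leP _ (cst x : unit -> R) (normr_ge0 x)); exact: nearW.
Qed.

(** The operator factors through a one point probability space: [A z] is the constant [zeta z], and
    [B] multiplies [x] by the value at the point. *)
Lemma integral_norm_rank1 (Z X : normedModType R) (T : bop Z X) (zeta : dual Z) (x : X) :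
  (forall z, T z = zeta z *: x) -> (integral_norm q1 T <= (`|zeta| * `|x|)%:E)%E.
Proof.
move=> TE; pose mu : probability unit R := \d_tt.
pose AF (z : Z) : Lq mu (leey 1) := Lclass (Lfun_Sub (leey 1) (cst_Lfun tt (zeta z))).
have [|z|A [AE A1]] := @bop_ex R Z _ AF `|zeta| (normr_ge0 _).
- move=> a z w; rewrite /AF -Lclass_linear; apply/Lclass_eq.
  by apply: nearW => y _; rewrite /= (bop_linear zeta).
- rewrite -lee_fin Lclass_norm.
  apply/(Linfty_leP mu (cst (zeta z) : unit -> R)); first exact: mulr_ge0.
  by apply: nearW => y /=; exact: bop_norm_le.
have BX (s : \bar R) (s1 : (1 <= s)%E) : exists B : bop (Lq mu s1) X,
    (forall u, B u = repr u tt *: x) /\ `|B| <= `|x|.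
  apply: bop_ex => //.
  - move=> a u v; rewrite scalerA -scalerDl; congr (_ *: _).
    have := repr_linear_ae a u v => h.
    apply: (@dirac_ae R _ unit tt (fun y => repr (a *: u + v) y = a * repr u y + repr v y)).
    by apply: filterS h => y /(_ I).
  - by move=> u; rewrite normrZ mulrC ler_wpM2l// dirac_norm_ge.
have rA z : repr (A z) tt = zeta z.
  apply: (@dirac_ae R _ unit tt (fun y => repr (A z) y = zeta z)).
  have := repr_Lclass_ae (Lfun_Sub (leey 1) (cst_Lfun tt (zeta z))).
  by rewrite -/(AF z) -AE; apply: filterS => y /(_ I).
rewrite /integral_norm; case: ifPn => _.
  have [B [BE B1]] := BX _ (leey 1).
  apply: (@le_trans _ _ (`|A| * `|B|)%:E); last by rewrite lee_fin ler_pM.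
  apply: ereal_inf_lbound; exists _, unit, mu, A, B; split => // z.
  by rewrite BE rA TE.
have [B [BE B1]] := BX _ q1.
apply: (@le_trans _ _ (`|A| * `|B|)%:E); last by rewrite lee_fin ler_pM.
apply: ereal_inf_lbound; exists _, unit, mu, A, B; split => // z.
rewrite BE TE -rA; congr (_ *: _).
apply/esym/(@dirac_ae R _ unit tt (fun y => repr (formal_incl q1 (A z)) y = repr (A z) y)).
rewrite /formal_incl; set f := Lfun_Sub q1 _.
by have := repr_Lclass_ae f; apply: filterS => y /(_ I).
Qed.

Lemma integral_norm_perturb (Z X : normedModType R) m (T T' : bop Z X)
    (zeta : 'I_m -> dual Z) (r : 'I_m -> X) (D : R) : 0 <= D ->
  (integral_norm q1 T <= D%:E)%E ->
  (forall z, T' z = T z + \sum_j zeta j z *: r j) ->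
  (integral_norm q1 T' <= (D + \sum_j `|zeta j| * `|r j|)%:E)%E.
Proof.
move=> D0 TD; elim: m zeta r T' => [|m IH] zeta r T' T'E.
  have -> : T' = T by apply: bopE => z; rewrite T'E big_ord0 addr0.
  by rewrite big_ord0 addr0.
have [U UE] := rank1_ex (zeta ord_max) (r ord_max).
have := IH (fun j => zeta (widen_ord (leqnSn m) j))
  (fun j => r (widen_ord (leqnSn m) j)) (T' - U).
move=> /(_ _)IHU; rewrite big_ord_recr/= addrA.
apply: (integral_normD (T1 := T' - U) (T2 := U)) => //.
- by rewrite addr_ge0// sumr_ge0.
- apply: IHU => z; rewrite -[LHS]/(T' z - U z) T'E UE big_ord_recr/=.
  by rewrite addrA addrK.
- exact: integral_norm_rank1.
- by move=> z; rewrite -[(T' - U) z]/(T' z - U z) subrK.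
Qed.

End IntegralNormPerturb.

(** * Upper bound for the integral norm *)

Section LatticeLp.
Variables (R : realType) (L : banachLatticeType R).

Lemma lattice_lp_le (r : R) n (x : 'I_n -> L) z : 1 <= r ->
  (forall a : 'I_n -> R, lpnorm (hoelder_conjugate r%:E) a <= 1 ->
     \sum_i a i *: x i <= z) -> lattice_lp r%:E x <= z.
Proof.
move=> r1 xz; have r1' : (1 <= r%:E)%E by rewrite lee_fin.
by apply: (lattice_lp_supremums x r1').2 => _ [a a1 <-]; exact: xz.
Qed.

Lemma le_lattice_lp (r : R) n (x : 'I_n -> L) (a : 'I_n -> R) : 1 <= r ->
  lpnorm (hoelder_conjugate r%:E) a <= 1 -> \sum_i a i *: x i <= lattice_lp r%:E x.
Proof.
move=> r1 a1; have r1' : (1 <= r%:E)%E by rewrite lee_fin.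
by apply: (lattice_lp_supremums x r1').1; exists a.
Qed.

Lemma lattice_lp_ge0 (r : R) n (x : 'I_n -> L) : 1 <= r -> 0 <= lattice_lp r%:E x.
Proof.
move=> r1; have r1' : (1 <= r%:E)%E by rewrite lee_fin.
have := @le_lattice_lp r n x (fun=> 0) r1; rewrite lpnorm0 ?hoelder_conj_ge1//.
by rewrite big1 ?ler01 => [/(_ isT)//|i _]; rewrite scale0r.
Qed.

Lemma concavity_infty_ge (K : R) (x : L) : concavity_bound +oo L K ->
  `|x| <= K * `|x|.
Proof.
move=> [_ /(_ 1%N (fun=> x))] /=; rewrite !big_ord_recl !big_ord0.
by rewrite normr_id (join_idPl _) ?labs_ge0// labs_norm (max_idPl _).
Qed.

End LatticeLp.

Section TensorNorm.
Variables (R : realType) (L : banachLatticeType R) (X : normedModType R).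

Lemma tensor_norm_le (u : tensor L X) (w : L) :
  (forall phi : dual X, `|phi| <= 1 -> labs (u phi) <= w) -> `|u| <= `|w|.
Proof.
move=> uw; rewrite -[`|u|]/(`|tensor_sup u|).
have s0 : 0 <= tensor_sup u.
  apply: le_trans (labs_ge0 (u 0)) _; apply: (tensor_supremums u).1.
  by exists 0; rewrite //= normr0.
apply: bl_norm_mono => //; apply: (tensor_supremums u).2 => _ [phi /= phi1 <-].
exact: uw.
Qed.

Lemma tensor_labs_le (u : tensor L X) (phi : dual X) :
  labs (u phi) <= `|phi| *: tensor_sup u.
Proof.
have up phi' : `|phi'| <= 1 -> labs (u phi') <= tensor_sup u.
  by move=> p1; apply: (tensor_supremums u).1; exists phi'.
have uZ (a : R) psi : u (a *: psi) = a *: u psi.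
  have [n [x [y ->]]] := tensorE u; rewrite !tens_sumE scaler_sumr.
  by apply: eq_bigr => j _; rewrite bop_scaleE scalerA.
have [->|p0] := eqVneq phi 0.
  by have := uZ 0 0; rewrite !scale0r => ->; rewrite normr0 scale0r ger0_labs.
have np : 0 < `|phi| by rewrite normr_gt0.
have uE : u phi = `|phi| *: u (`|phi|^-1 *: phi).
  by rewrite -uZ scalerA mulfV ?gt_eqF// scale1r.
rewrite uE; apply: le_trans (labsZ_le _ _) _; rewrite normr_id.
by rewrite bl_ler_wZ// up// normrZ normfV normr_id mulVf// gt_eqF.
Qed.

Lemma tensor_sup_ge0 (u : tensor L X) : 0 <= tensor_sup u.
Proof.
apply: le_trans (labs_ge0 (u 0)) _; apply: (tensor_supremums u).1.
by exists 0; rewrite //= normr0.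
Qed.

Lemma tens_linear (y : L) : linear (fun x : X => tens x y).
Proof.
move=> a x x'; apply/val_inj/funext => phi /=.
rewrite -[RHS]/(a *: (phi x *: y) + phi x' *: y).
by rewrite (bop_linear phi) scalerDl scalerA.
Qed.

Lemma tens_sum_norm n (x : 'I_n -> X) (g : 'I_n -> L) (s : 'I_n -> R) :
  (forall k, 0 <= g k) -> (forall k, `|x k| <= s k) ->
  `|\sum_k tens (x k) (g k)| <= `|\sum_k s k *: g k|.
Proof.
move=> g0 xs; apply: tensor_norm_le => phi phi1; rewrite tens_sumE.
apply: le_trans (ler_labs_sum _ _) _; apply: bl_ler_sum => k.
rewrite ger0_labs// bl_lerZr// (le_trans (bop_norm_le _ _))//.
by rewrite (le_trans _ (xs k))// ler_piMl.
Qed.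

Lemma tens_norm (x : X) (y : L) : `|tens x y| <= `|x| * `|y|.
Proof.
rewrite -(labs_norm y) -[`|x|]normr_id -normrZ; apply: tensor_norm_le => phi phi1.
rewrite (le_trans (labsZ_le (phi x) y))// bl_lerZr ?labs_ge0//.
by rewrite (le_trans (bop_norm_le _ _))// ler_piMl.
Qed.

End TensorNorm.

Lemma exists_argmax (R : realType) n (f : 'I_n.+1 -> R) :
  exists k, forall j, f j <= f k.
Proof.
by case: (@arg_maxP _ _ _ ord0 xpredT f isT) => k _ h; exists k => j; exact: h.
Qed.

Section UpperBound.
Variables (R : realType) (q : \bar R) (q1 : (1 <= q)%E).
Variables (L : banachLatticeType R) (X Z : normedModType R) (K : R).
Hypothesis LK : concavity_bound q L K.
Variables (n : nat) (phi : 'I_n.+1 -> R) (g : 'I_n.+1 -> L).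
Hypotheses (phi0 : forall k, 0 < phi k) (g0 : forall k, 0 <= g k).

Let w (t : 'I_n.+1 -> R) : L := \sum_k (phi k * `|t k|) *: g k.
Let D := K * `|\sum_k phi k *: g k|.

Let w_ge0 t : 0 <= w t.
Proof. by apply: bl_sumr_ge0 => k; rewrite bl_scale_ge0// mulr_ge0// ltW. Qed.

Let w_le t tau : (forall k, `|t k| <= tau) -> `|w t| <= `|\sum_k phi k *: g k| * tau.
Proof.
move=> tt; have tau0 : 0 <= tau := le_trans (normr_ge0 _) (tt ord0).
rewrite mulrC -[X in X * _]ger0_norm// -normrZ; apply: bl_norm_mono => //.
rewrite scaler_sumr; apply: bl_ler_sum => k; rewrite scalerA bl_lerZr//.
by rewrite mulrC ler_wpM2r// ltW.
Qed.

(* Maurey factorization of the positive operator t |-> w t from l_oo^n to L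
   through a weighted l_q^n. *)
Let maurey (r : R) : q = r%:E -> exists c : 'I_n.+1 -> R,
  [/\ forall k, 0 <= c k, \sum_k c k = 1 &
   forall t, `|w t| `^ r <= D `^ r * \sum_k c k * `|t k| `^ r].
Proof.
move=> qE; have r1' : (1 <= r%:E)%E by rewrite -qE.
have r1 : 1 <= r by rewrite -lee_fin.
have r0 : 0 < r by rewrite (lt_le_trans ltr01).
have K0 : 0 <= K by case: LK.
have D0 : 0 <= D by rewrite mulr_ge0.
pose v (t : 'I_n.+1 -> R) : 'I_n.+1 -> R := fun k => D `^ r * `|t k| `^ r - `|w t| `^ r.
(* Finite sums of the functions [v t] already form a cone: [v] is homogeneous of degree [r], so a
   factor [a] is absorbed into [t] as [a^(1/r)]. *)
pose C := [set u : 'I_n.+1 -> R | exists s : seq ('I_n.+1 -> R),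
  u = fun k => \sum_(t <- s) v t k].
have wZ (a : R) t : `|w (a *: t)| = `|a| * `|w t|.
  rewrite -[`|a|]normr_id -normrZ; congr `|_|; rewrite scaler_sumr.
  apply: eq_bigr => k _; rewrite scalerA; congr (_ *: _).
  by rewrite -[(a *: t) k]/(a * t k) normrM mulrCA.
have [|u u'|a u a0|u|c [c0 c1 cC]] := @cone_weights R 'I_n.+1 C.
- by exists [::]; apply/funext => k; rewrite big_nil.
- by move=> [s ->] [s' ->]; exists (s ++ s'); apply/funext => k; rewrite big_cat.
- move=> [s ->]; exists (map (fun t => a `^ r^-1 *: t) s); apply/funext => k.
  rewrite big_map -[LHS]/(a * _) mulr_sumr; apply: eq_bigr => t _.
  have ar : (a `^ r^-1) `^ r = a by rewrite -powRrM mulVf ?gt_eqF// powRr1// ltW.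
  rewrite /v wZ -[(_ *: t) k]/(a `^ r^-1 * t k) normrM (ger0_norm (powR_ge0 _ _)).
  by rewrite !powRM ?powR_ge0// ar mulrBr mulrCA.
- move=> [s ->]; pose t (l : 'I_(size s)) := nth (fun=> 0) s l.
  have sE (F : ('I_n.+1 -> R) -> R) : \sum_(t <- s) F t = \sum_l F (t l).
    by rewrite (big_nth (fun=> 0)) big_mkord.
  (* Concavity bounds the l_r norm of the numbers [|w (t l)|] by [K] times the norm of the lattice
     l_r sum of the [w (t l)], which is at most [w tau] by Krivine's formula. A coordinate where
     [tau] is largest then has the required sign. *)
  pose tau k := lpnorm r%:E (fun l => t l k).
  have [k taumax] := exists_argmax tau.
  exists k; rewrite sE /v sumrB -mulr_sumr subr_ge0.
  have -> : \sum_l `|t l k| `^ r = tau k `^ r by rewrite lpnorm_powR.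
  have -> : \sum_l `|w (t l)| `^ r = lpnorm r%:E (fun l => `|w (t l)|) `^ r.
    by rewrite lpnorm_powR//; apply: eq_bigr => l _; rewrite normr_id.
  rewrite -powRM ?lpnorm_ge0//.
  rewrite ge0_ler_powR ?nnegrE ?lpnorm_ge0 ?mulr_ge0 ?(ltW r0) ?lpnorm_ge0//.
  have [_ /(_ _ (fun l => w (t l)))] := LK; rewrite qE => /le_trans; apply.
  rewrite /D -mulrA ler_wpM2l//.
  have tk0 : 0 <= tau k by exact: lpnorm_ge0.
  have tmax j : `|tau j| <= tau k by rewrite ger0_norm ?lpnorm_ge0.
  apply: le_trans (w_le tmax); apply: bl_norm_mono; first exact: lattice_lp_ge0.
  apply: lattice_lp_le => // a a1.
  have -> : \sum_l a l *: w (t l) = \sum_j (phi j * \sum_l a l * `|t l j|) *: g j.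
    under eq_bigr do rewrite scaler_sumr; rewrite exchange_big/=.
    apply: eq_bigr => j _; rewrite mulr_sumr scaler_suml; apply: eq_bigr => l _.
    by rewrite scalerA mulrCA.
  apply: bl_ler_sum => j; rewrite bl_lerZr// ler_wpM2l ?(ltW (phi0 j))//.
  rewrite (ger0_norm (lpnorm_ge0 _ _)); apply: le_trans (hoelder_le _ r1' a1) _.
  by rewrite le_eqVlt; apply/orP; left; apply/eqP/eq_lpnorm => l; rewrite normr_id.
exists c; split => // t.
have /cC : C (v t) by exists [:: t]; apply/funext => k; rewrite big_seq1.
under eq_bigr do rewrite mulrBr mulrCA.
by rewrite sumrB -mulr_sumr -mulr_suml c1 mul1r subr_ge0.
Qed.

Variables (T_ : 'I_n.+1 -> bop Z X) (T : bop Z (lattice_ext L X)).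
Hypothesis FT : forall k, factors q1 (T_ k) (phi k).
Hypothesis TE : forall z, T z = \sum_k completion_incl (tens (T_ k z) (g k)).

(** The maps J_k x = x (x) g_k are fed to [factors_glue]; the norm of \sum_k x_k (x) g_k is at most
    [|w t|], which the Maurey weights bound by [D * tau]. *)
Lemma integral_norm_lattice :
  (integral_norm q1 T <= (K * `|\sum_k phi k *: g k|)%:E)%E.
Proof.
rewrite -/D; have K0 : 0 <= K by case: LK.
have D0 : 0 <= D by rewrite mulr_ge0.
have JE k : exists J : bop X (lattice_ext L X),
    forall x, J x = completion_incl (tens x (g k)).
  have [|||J [JE _]] := @bop_ex R X (lattice_ext L X)
    (fun x => completion_incl (tens x (g k))) `|g k|.
  - by [].
  - by move=> a x y; rewrite tens_linear linearP.
  - by move=> x; rewrite completion_incl_norm mulrC tens_norm.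
  - by exists J.
have [J {}JE] := choice JE.
have JN (x : nat -> X) (t : nat -> R) : (forall k, 0 <= t k) ->
    (forall k : 'I_n.+1, `|x k| <= phi k * t k) ->
    `|\sum_(k < n.+1) J k (x k)| <= `|w (fun k : 'I_n.+1 => t k)|.
  move=> t0 xt.
  have -> : \sum_(k < n.+1) J k (x k) = completion_incl (\sum_(k < n.+1) tens (x k) (g k)).
    by rewrite linear_sum; apply: eq_bigr => k _; rewrite JE.
  rewrite completion_incl_norm; apply: tens_sum_norm => // k.
  by rewrite (ger0_norm (t0 k)).
pose inn (k : nat) : 'I_n.+1 := inord k.
have innE (k : 'I_n.+1) : inn k = k by exact: inord_val.
have main (c : nat -> R) (E : R) : (forall k, 0 < c k) -> \sum_(k < n.+1) c k = 1 ->
    0 <= E ->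
    (forall (t : nat -> R) (tau : R), (forall k, 0 <= t k) -> 0 <= tau ->
       weighted_le q n.+1 c t tau -> `|w (fun k : 'I_n.+1 => t k)| <= E * tau) ->
    (integral_norm q1 T <= E%:E)%E.
  move=> c0 c1 E0 wE; apply: factors_integral_norm.
  apply: (factors_glue (T_ := fun k => T_ (inn k)) (b := fun k => phi (inn k))
    (J := fun k => J (inn k)) c0 c1 E0).
  - by move=> k; exact: FT.
  - move=> x t tau t0 tau0 xt /(wE t tau t0 tau0); apply: le_trans.
    under eq_bigr do rewrite innE.
    by apply: JN => // k; have := xt k; rewrite innE.
  - by move=> z; rewrite TE; apply: eq_bigr => k _; rewrite innE JE.
have n0 : 0 < n.+1%:R :> R by rewrite ltr0n.
have [qE|[r qE]] : q = +oo%E \/ exists r : R, q = r%:E.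
    by case: (q) q1 => [r||//] _; [right; exists r|left].
  (* For [q = +oo] the weights do not enter [weighted_le]; any positive ones of sum 1 will do. *)
  apply: (main (fun=> n.+1%:R^-1)) => //.
  - by rewrite sumr_const card_ord -[_ *+ n.+1]mulr_natl mulfV// gt_eqF.
  - move=> t tau t0 tau0; rewrite /weighted_le qE => tt.
    apply: (@le_trans _ _ (`|\sum_k phi k *: g k| * tau)).
      by apply: w_le => k; rewrite ger0_norm// tt.
    by rewrite ler_wpM2r// concavity_infty_ge// -qE.
have [c [c0 c1 cw]] := maurey qE.
have r1 : 1 <= r by rewrite -lee_fin -qE.
have r0 : 0 < r by rewrite (lt_le_trans ltr01).
apply/lee_addgt0Pr => e e0; rewrite -EFinD.
(* Maurey's weights may vanish, whereas gluing needs positive ones. Adding [d] to each and dividing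
   by [s] costs at most a factor [s], and [d] is chosen so that [D * s <= D + e]. *)
pose d := e / (D + 1) / n.+1%:R.
have d0 : 0 < d by rewrite !divr_gt0// ltr_wpDl.
pose s := 1 + n.+1%:R * d.
have s1 : 1 < s by rewrite ltrDl mulr_gt0.
have s0 : 0 < s by rewrite (lt_trans ltr01).
have De : D * s <= D + e.
  rewrite /s mulrDr mulr1 lerD2l /d [n.+1%:R * _]mulrC divfK ?gt_eqF//.
  by rewrite mulrCA ler_piMr ?(ltW e0)// ler_pdivrMr ?ltr_wpDl// mul1r lerDl.
apply: (@le_trans _ _ (D * s)%:E); last by rewrite lee_fin.
apply: (main (fun k => (c (inn k) + d) / s)).
- by move=> k; rewrite divr_gt0// ltr_wpDl.
- under eq_bigr do rewrite innE.
  rewrite -mulr_suml big_split/= c1 sumr_const card_ord -[_ *+ n.+1]mulr_natl.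
  by rewrite -/s mulfV// gt_eqF.
- by rewrite mulr_ge0// ltW.
- move=> t tau t0 tau0; rewrite /weighted_le qE => tt.
  have wr : `|w (fun k : 'I_n.+1 => t k)| `^ r <= D `^ r * (s * tau `^ r).
    apply: le_trans (cw _) _; rewrite ler_wpM2l ?powR_ge0//.
    rewrite -ler_pdivrMl// mulr_sumr; apply: le_trans tt; apply: ler_sum => k _.
    rewrite innE (ger0_norm (t0 k)) mulrA ler_wpM2r ?powR_ge0//.
    by rewrite mulrC ler_wpM2r ?invr_ge0 ?(ltW s0)// lerDl ltW.
  have sr : s <= s `^ r by rewrite le1r_powR ?(ltW s1).
  have : `|w (fun k : 'I_n.+1 => t k)| `^ r <= (D * s * tau) `^ r.
    have -> : (D * s * tau) `^ r = D `^ r * (s `^ r * tau `^ r).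
      by rewrite !powRM ?mulr_ge0 ?(ltW s0)// mulrA.
    apply: le_trans wr _; rewrite ler_wpM2l ?powR_ge0//.
    by rewrite ler_wpM2r ?powR_ge0.
  apply: contraLR; rewrite -!ltNge => h.
  by rewrite gt0_ltr_powR ?nnegrE ?mulr_ge0 ?(ltW s0).
Qed.

End UpperBound.

(** * Lower bound for the summing norm of the adjoint *)

Section CompletionFunctionals.
Variables (R : realType) (V : normedModType R).

Lemma completion_functional_le (W : dual (completion V)) (M : R) :
  (forall v, `|v| <= 1 -> W (completion_incl v) <= M) -> `|W| <= M.
Proof.
move=> WM; have M0 : 0 <= M.
  by have := WM 0; rewrite normr0 ler01 !linear0 => /(_ isT).
have WMv v : `|W (completion_incl v)| <= M * `|v|.
  have [->|v0] := eqVneq v 0; first by rewrite !linear0 !normr0 mulr0.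
  have nv : 0 < `|v| by rewrite normr_gt0.
  have WMv u : u != 0 -> W (completion_incl u) <= M * `|u|.
    move=> u0; have nu : 0 < `|u| by rewrite normr_gt0.
    have := WM (`|u|^-1 *: u); rewrite normrZ normfV normr_id mulVf ?gt_eqF//.
    rewrite lexx => /(_ isT); rewrite linearZ/= (linear_scaleE (bop_linear W)).
    by rewrite -[_ *: _]/(`|u|^-1 * _) mulrC ler_pdivrMr.
  rewrite ler_norml lerNl -(linear_oppE (bop_linear W)) -linearN/= -{1}(normrN v).
  by rewrite !WMv// oppr_eq0.
apply: bop_norm_lub => // c; apply/ler_addgt0Pr => e e0.
have We : 0 < M + `|W| + 1 by rewrite ltr_wpDl// addr_ge0.
have [v cv] := completion_approx c (divr_gt0 e0 We).
set d := e / _ in cv.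
have vc : `|v| <= `|c| + d.
  rewrite -completion_incl_norm -[X in `|X|](subKr c).
  by rewrite (le_trans (ler_normB _ _))// lerD2l.
have -> : W c = W (c - completion_incl v) + W (completion_incl v).
  by rewrite -(linear_addE (bop_linear W)) subrK.
rewrite (le_trans (ler_normD _ _))// addrC.
apply: (@le_trans _ _ (M * (`|c| + d) + `|W| * d)).
  rewrite lerD//; first by rewrite (le_trans (WMv v))// ler_wpM2l.
  by rewrite (le_trans (bop_norm_le _ _))// ler_wpM2l.
rewrite mulrDr -addrA lerD2l -mulrDl /d mulrCA ler_piMr ?(ltW e0)//.
by rewrite ler_pdivrMr// mul1r lerDl.
Qed.

End CompletionFunctionals.

Section TensorFunctionals.
Variables (R : realType) (L : banachLatticeType R) (X : normedModType R).

Definition bounded_positive (lam : L -> R) :=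
  positive_functional lam /\ forall y, lam y <= `|y|.

Lemma bounded_positive_tensor lam (phi : dual X) (u : tensor L X) :
  positive_functional lam -> `|lam (u phi)| <= `|phi| * lam (tensor_sup u).
Proof.
move=> lp; apply: le_trans (positive_functional_labs _ lp) _.
rewrite -[leRHS]/(`|phi| *: lam (tensor_sup u)) -(linear_scaleE lp.1).
exact/(positive_functional_mono lp)/tensor_labs_le.
Qed.

(** The functional phi (x) lam, extended to L(X); it is bounded because |u phi| <= |phi|
    [tensor_sup u] in [L]. *)
Lemma tensor_functional lam (phi : dual X) : bounded_positive lam ->
  exists W : dual (lattice_ext L X),
    forall u : tensor L X, W (completion_incl u) = lam (u phi).
Proof.
move=> [lp lb].
have [|||f [fE _]] := @bop_ex R (tensor L X) R (fun u => lam (u phi)) `|phi|.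
- by [].
- by move=> a u v; rewrite -lp.1.
- move=> u; apply: le_trans (bounded_positive_tensor _ _ lp) _.
  by rewrite ler_wpM2l// lb.
by have [W [WE _]] := dual_extend f; exists W => u; rewrite WE fE.
Qed.

End TensorFunctionals.

Lemma lpnorm_le_powR (R : realType) (r M : R) n (a : 'I_n -> R) : 0 < r -> 0 <= M ->
  \sum_i `|a i| `^ r <= M `^ r -> lpnorm r%:E a <= M.
Proof.
move=> r0 M0; rewrite -lpnorm_powR//; apply: contraLR; rewrite -!ltNge => h.
by rewrite gt0_ltr_powR ?nnegrE ?lpnorm_ge0.
Qed.

Lemma powR_superadd (R : realType) (r a b : R) : 1 <= r -> 0 <= a -> 0 <= b ->
  a `^ r + b `^ r <= (a + b) `^ r.
Proof.
move=> r1 a0 b0; have r0 : 0 < r by rewrite (lt_le_trans ltr01).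
have ab0 : 0 <= a + b by rewrite addr_ge0.
rewrite -(mulr_powRB1 a0 r0) -(mulr_powRB1 b0 r0) -(mulr_powRB1 ab0 r0) mulrDl.
by rewrite lerD// ler_wpM2l// ge0_ler_powR ?nnegrE ?subr_ge0 ?lerDl ?lerDr.
Qed.

Lemma bop_eval_sum (R : realType) (U V : normedModType R) (I : Type) (s : seq I)
    (f : I -> bop U V) (v : U) : (\sum_(i <- s) f i) v = \sum_(i <- s) f i v.
Proof. exact: (big_morph (fun g : bop U V => g v)). Qed.

Lemma tensor_apply_sum (R : realType) (L : banachLatticeType R) (X : normedModType R)
    (u : tensor L X) n (a : 'I_n -> R) (phi : 'I_n -> dual X) :
  u (\sum_i a i *: phi i) = \sum_i a i *: u (phi i).
Proof.
have [m [x [y ->]]] := tensorE u; rewrite tens_sumE.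
under [RHS]eq_bigr do rewrite tens_sumE scaler_sumr.
rewrite exchange_big/=; apply: eq_bigr => j _; rewrite bop_eval_sum scaler_suml.
by apply: eq_bigr => i _; rewrite bop_scaleE scalerA.
Qed.

(** Summing norms are defined by families over ordinals, so a double family is enumerated as a
    single one. *)
Lemma sum_enum_sig (V : nmodType) m (N : 'I_m -> nat)
    (F : forall k, 'I_(N k) -> V) :
  \sum_(j < #|{: {k : 'I_m & 'I_(N k)}}|) F (tag (enum_val j)) (tagged (enum_val j)) =
  \sum_k \sum_(i < N k) F k i.
Proof.
rewrite sig_big_dep/=.
rewrite (reindex (fun j : 'I_#|{: {k : 'I_m & 'I_(N k)}}| => enum_val j))//=.
by apply: onW_bij; exact: enum_val_bij.
Qed.

Section LowerBound.
Variables (R : realType) (p : \bar R) (p1 : (1 <= p)%E).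
Variables (L : banachLatticeType R) (X V : normedModType R) (K P : R).
Hypotheses (LK : convexity_bound p L K) (P0 : 0 < P).
Variable S : bop (dual (lattice_ext L X)) V.
Hypothesis SP : summing_bdd p S P.
Variables (n : nat) (N : 'I_n.+1 -> nat) (x : forall k, 'I_(N k) -> dual X).
Hypothesis x1 : forall k, weak_bdd p (@x k) 1.
Variable lam : 'I_n.+1 -> L -> R.
Hypothesis lamP : forall k, bounded_positive (lam k).
Variable W : forall k, 'I_(N k) -> dual (lattice_ext L X).
Hypothesis WE : forall k i u, W i (completion_incl u) = lam k (u (@x k i)).

Local Notation T := {k : 'I_n.+1 & 'I_(N k)}.

(** A minimax by contradiction. If some combination of the vectors [b - eta - A u], [|u| <= 1], with
    coefficients c_l >= 0 is negative in all coordinates, it gives G = (\sum_l (c_l / \sum c) P^r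
    |u_l|^r)^(1/r), and [|G| <= K * P] by p-convexity. Otherwise [cone_weights] gives weights [beta]
    for which the family beta_k^(1/r) W_ki violates the summing bound of [S]. *)
Let lower_real (r eta : R) : p = r%:E -> 0 < eta ->
  exists2 G : L, `|G| <= K * P &
    forall k, 0 <= lam k G /\ \sum_i `|S (@W k i)| `^ r <= lam k G `^ r + eta.
Proof.
move=> pE eta0; have r1 : 1 <= r by rewrite -lee_fin -pE.
have r1' : (1 <= r%:E)%E by rewrite lee_fin.
have r0 : 0 < r by rewrite (lt_le_trans ltr01).
have K0 : 0 <= K by case: LK.
have rVK (y : R) : 0 <= y -> (y `^ r^-1) `^ r = y.
  by move=> y0; rewrite -powRrM mulVf ?gt_eqF// powRr1.
pose A (u : tensor L X) k := P `^ r * \sum_i `|@W k i (completion_incl u)| `^ r.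
pose b k := \sum_i `|S (@W k i)| `^ r.
pose C := [set v : 'I_n.+1 -> R | exists2 s : seq (R * tensor L X),
  all (fun cu => (0 <= cu.1) && (`|cu.2| <= 1)) s &
  v = fun k => \sum_(cu <- s) cu.1 * (b k - eta - A cu.2 k)].
apply: contrapT => noG.
have [|c d|a c a0|v0 [s sP ->]|beta [be0 be1 beC]] := @cone_weights R 'I_n.+1 C.
- by exists [::] => //; apply/funext => k; rewrite big_nil.
- move=> [s sP ->] [s' s'P ->]; exists (s ++ s'); first by rewrite all_cat sP.
  by apply/funext => k; rewrite big_cat.
- move=> [s sP ->]; exists (map (fun cu => (a * cu.1, cu.2)) s).
    apply/allP => _ /mapP[cu cus ->] /=; have /andP[c0 ->] := allP sP _ cus.
    by rewrite mulr_ge0// ltW.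
  apply/funext => k; rewrite big_map -[LHS]/(a * _) mulr_sumr.
  by apply: eq_bigr => cu _; rewrite mulrA.
- apply: contrapT => neg; apply: noG.
  pose m := size s; pose c (l : 'I_m) : R := (nth (0, 0) s l).1.
  pose u (l : 'I_m) : tensor L X := (nth (0, 0) s l).2.
  have c0 l : 0 <= c l by have /andP[] := allP sP _ (mem_nth (0, 0) (ltn_ord l)).
  have u1 l : `|u l| <= 1 by have /andP[] := allP sP _ (mem_nth (0, 0) (ltn_ord l)).
  have sumE k : \sum_(cu <- s) cu.1 * (b k - eta - A cu.2 k) =
      (\sum_l c l) * (b k - eta) - \sum_l c l * A (u l) k.
    rewrite (big_nth (0, 0)) big_mkord mulr_suml -sumrB.
    by apply: eq_bigr => l _; rewrite mulrBr.
  have neg' k : (\sum_l c l) * (b k - eta) < \sum_l c l * A (u l) k.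
    by rewrite -subr_lt0 -sumE ltNge; apply/negP => h; apply: neg; exists k.
  have s0 : 0 <= \sum_l c l by exact: sumr_ge0.
  have sp : 0 < \sum_l c l.
    rewrite lt_def s0 andbT; apply/eqP => c00; have := neg' ord0.
    have cz l : c l = 0.
      have /eqP := c00; rewrite psumr_eq0//.
      by move=> /allP/(_ l (mem_index_enum _))/eqP.
    rewrite c00 mul0r big1 ?ltxx// => l _; rewrite cz; exact: mul0r.
  pose ga l := (c l / \sum_l c l) `^ r^-1 * P.
  have ga0 l : 0 <= ga l by rewrite mulr_ge0 ?powR_ge0// ltW.
  have gar l : ga l `^ r = c l / (\sum_l c l) * P `^ r.
    by rewrite powRM ?powR_ge0 ?(ltW P0)// rVK// divr_ge0.
  exists (lattice_lp r%:E (fun l => ga l *: tensor_sup (u l))).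
    have [_ LKn] := LK; have := LKn _ (fun l => ga l *: tensor_sup (u l)).
    rewrite pE => /le_trans; apply; rewrite ler_wpM2l//.
    apply: lpnorm_le_powR => //; first exact: ltW.
    apply: (@le_trans _ _ (\sum_l c l / (\sum_l c l) * P `^ r)).
      apply: ler_sum => l _; rewrite normr_id normrZ (ger0_norm (ga0 l)) powRM//.
      rewrite gar ler_piMr ?mulr_ge0 ?powR_ge0 ?invr_ge0//.
      have <- : 1 `^ r = 1 :> R by rewrite powR1.
      rewrite ge0_ler_powR ?nnegrE ?(ltW r0)//; exact: u1.
    by rewrite -!mulr_suml mulfV ?gt_eqF// mul1r.
  move=> k; split.
    by have [[_ lp] _] := lamP k; apply: lp; exact: lattice_lp_ge0.
  rewrite -lerBlDr -/(b k).
  pose tau l := lpnorm r%:E (fun i => @W k i (completion_incl (u l))).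
  have tau0 l : 0 <= tau l by exact: lpnorm_ge0.
  have taur l : tau l `^ r = \sum_i `|@W k i (completion_incl (u l))| `^ r.
    exact: lpnorm_powR.
  have bk : b k - eta <= lpnorm r%:E (fun l => ga l * tau l) `^ r.
    rewrite lpnorm_powR//.
    have -> : \sum_l `|ga l * tau l| `^ r = (\sum_l c l * A (u l) k) / \sum_l c l.
      rewrite mulr_suml; apply: eq_bigr => l _.
      rewrite (ger0_norm (mulr_ge0 (ga0 l) (tau0 l))) powRM// gar taur /A.
      by rewrite -!mulrA; congr (_ * _); rewrite mulrC -mulrA.
    by rewrite ler_pdivlMr// mulrC ltW.
  apply: le_trans bk _; rewrite ge0_ler_powR ?nnegrE ?lpnorm_ge0 ?(ltW r0)//.
    by have [[_ lp] _] := lamP k; apply: lp; exact: lattice_lp_ge0.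
  apply: lpnorm_lub => // de de1.
  have [lamp _] := lamP k.
  (* By duality the l_r norm over [i] is the value at [u l] of one functional x^* (x) lam_k, where
     x^* = [\sum_i al i *: x k i] has norm at most 1. *)
  have tau_le l : tau l <= lam k (tensor_sup (u l)).
    rewrite /tau; have [al [al1 <-]] := lpnorm_dual (fun i => @W k i (completion_incl (u l))) r1'.
    have -> : \sum_i al i * W i (completion_incl (u l)) =
        lam k (u l (\sum_i al i *: @x k i)).
      rewrite tensor_apply_sum (linear_sumE lamp.1); apply: eq_bigr => i _.
      by rewrite (linear_scaleE lamp.1) WE.
    apply: le_trans (ler_norm _) _; apply: le_trans (bounded_positive_tensor _ _ lamp) _.
    have /x1 : lpnorm (hoelder_conjugate p) al <= 1 by rewrite pE.
    by move=> /ler_piMl; apply; apply: lamp.2; exact: tensor_sup_ge0.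
  apply: (@le_trans _ _ (lam k (\sum_l `|de l| *: (ga l *: tensor_sup (u l))))).
    rewrite (linear_sumE lamp.1); apply: ler_sum => l _.
    rewrite !(linear_scaleE lamp.1) -[leRHS]/(`|de l| * (ga l * lam k (tensor_sup (u l)))).
    apply: (@le_trans _ _ (`|de l| * (ga l * tau l))).
      by rewrite ler_wpM2r ?ler_norm// mulr_ge0.
    by rewrite ler_wpM2l// ler_wpM2l.
  apply: (positive_functional_mono lamp); apply: le_lattice_lp => //.
  by rewrite (_ : lpnorm _ _ = lpnorm (hoelder_conjugate r%:E) de)//;
    apply: eq_lpnorm => l; rewrite normr_id.
pose M := \sum_k beta k * b k - eta.
have AM u : `|u| <= 1 -> \sum_k beta k * A u k <= M.
  move=> u1; have /beC : C (fun k => b k - eta - A u k).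
    exists [:: (1, u)]; first by rewrite /= ler01 u1.
    by apply/funext => k; rewrite big_seq1 mul1r.
  under eq_bigr do rewrite !mulrBr.
  by rewrite !sumrB -mulr_suml be1 mul1r subr_ge0.
have A0 u k : 0 <= A u k by rewrite mulr_ge0 ?powR_ge0// sumr_ge0// => i _; exact: powR_ge0.
have M0 : 0 <= M.
  apply: le_trans (AM 0 _); last by rewrite normr0.
  by apply: sumr_ge0 => k _; rewrite mulr_ge0.
pose om := (M / P `^ r) `^ r^-1.
have Pr0 : 0 < P `^ r by rewrite powR_gt0.
have omr : om `^ r = M / P `^ r by rewrite rVK// divr_ge0// ltW.
(* The weighted family over all pairs [(k, i)]. Its weak norm is at most [om], and (P om)^r = M is
   smaller than [\sum_k beta k * b k] by [eta]: this is the contradiction. *)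
pose U (j : 'I_#|{: T}|) := beta (tag (enum_val j)) `^ r^-1 *: W (tagged (enum_val j)).
have wU : weak_bdd p U om.
  move=> a a1; apply: completion_functional_le => u u1.
  rewrite bop_eval_sum.
  apply: (@le_trans _ _ (lpnorm p (fun j => U j (completion_incl u)))).
    exact: hoelder_le.
  rewrite pE; apply: lpnorm_le_powR => //; first exact: powR_ge0.
  rewrite omr ler_pdivlMr//.
  have -> : \sum_j `|U j (completion_incl u)| `^ r =
      \sum_k \sum_(i < N k) beta k * `|@W k i (completion_incl u)| `^ r.
    rewrite -sum_enum_sig; apply: eq_bigr => j _.
    rewrite bop_scaleE -[_ *: _]/(_ * _) normrM powRM// (ger0_norm (powR_ge0 _ _)).
    by rewrite rVK.
  apply: le_trans (AM u u1); rewrite mulr_suml; apply: ler_sum => k _.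
  by rewrite -mulr_sumr -mulrA [X in _ * X]mulrC.
have := SP wU; rewrite pE => h.
have : lpnorm r%:E (fun j => `|S (U j)|) `^ r <= (P * om) `^ r.
  by rewrite ge0_ler_powR ?nnegrE ?lpnorm_ge0 ?mulr_ge0 ?powR_ge0 ?(ltW r0) ?(ltW P0).
rewrite lpnorm_powR// powRM ?powR_ge0 ?(ltW P0)// omr mulrCA mulfV ?gt_eqF// mulr1.
have -> : \sum_j `| `|S (U j)| | `^ r = \sum_k \sum_(i < N k) beta k * `|S (@W k i)| `^ r.
  rewrite -sum_enum_sig; apply: eq_bigr => j _.
  rewrite normr_id (linear_scaleE (bop_linear S)) normrZ powRM//.
  by rewrite (ger0_norm (powR_ge0 _ _)) rVK.
have -> : \sum_k \sum_(i < N k) beta k * `|S (@W k i)| `^ r = \sum_k beta k * b k.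
  by apply: eq_bigr => k _; rewrite mulr_sumr.
by rewrite /M lerBrDr gerDl leNgt eta0.
Qed.

(** For [p = +oo] each [W k i] is nearly normed by some [u] in the unit ball, and [G] is the join of
    the [P *: tensor_sup u]. For finite [p], [lower_real] is used with [eta^r], since a^r + eta^r <=
    (a + eta)^r. *)
Lemma lower_bound (eta : R) : 0 < eta -> exists2 G : L, `|G| <= K * P &
  forall k, lpnorm p (fun i => `|S (@W k i)|) <= lam k G + eta.
Proof.
move=> eta0.
have [pE|[r pE]] : p = +oo%E \/ exists r : R, p = r%:E.
    by case: (p) p1 => [r||//] _; [right; exists r|left].
  have uex (k : 'I_n.+1) (i : 'I_(N k)) : exists u : tensor L X,
      `|u| <= 1 /\ P * `|W i| <= P * W i (completion_incl u) + eta.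
    apply: contrapT => nu.
    have : `|W i| <= `|W i| - eta / P.
      apply: completion_functional_le => u u1; rewrite leNgt; apply/negP => h.
      apply: nu; exists u; split => //.
      rewrite -lerBlDr -ler_pdivrMl// mulrBr mulKf ?gt_eqF//.
      by rewrite mulrC ltW.
    by rewrite lerBrDr gerDl leNgt divr_gt0.
  pose uu (t : T) : tensor L X := sval (cid (uex (tag t) (tagged t))).
  have uu1 t : `|uu t| <= 1 by rewrite /uu; case: cid => u [].
  have uuW t : P * `|W (tagged t)| <= P * W (tagged t) (completion_incl (uu t)) + eta.
    by rewrite /uu; case: cid => u [].
  exists (lattice_lp +oo (fun j : 'I_#|{: T}| => P *: tensor_sup (uu (enum_val j)))).
    have [K0 LKn] := LK; move: (LKn _ (fun j : 'I_#|{: T}| => P *: tensor_sup (uu (enum_val j)))).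
    rewrite pE => /le_trans; apply; rewrite ler_wpM2l//.
    apply: bigmax_le; first exact: ltW.
    move=> j _; rewrite normr_id normrZ gtr0_norm// ler_piMr ?(ltW P0)//.
    exact: uu1.
  move=> k; have [lamp _] := lamP k.
  set G := lattice_lp _ _.
  have Gle (t : T) : P *: tensor_sup (uu t) <= G.
    rewrite -(enum_rankK t).
    have : enum_rank t \in index_enum 'I_#|{: T}| by rewrite mem_index_enum.
    rewrite /G /=; elim: (index_enum _) => //= j s IH; rewrite inE big_cons.
    move=> /predU1P[<-|/IH]; last by move=> /le_trans; apply; exact: leUr.
    by apply: le_trans (labs_ge _) _; exact: leUl.
  have G0 : 0 <= G.
    rewrite /G /=; elim/big_rec : _ => // j y _ _.
    by apply: le_trans (labs_ge0 _) _; exact: leUl.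
  rewrite pE; apply: bigmax_le => [|i _].
    by rewrite addr_ge0 ?(ltW eta0)//; apply: lamp.2.
  rewrite normr_id.
  have Si : `|S (@W k i)| <= P * `|W i|.
    have w1 : weak_bdd p (fun _ : 'I_1 => @W k i) `|@W k i|.
      move=> a; rewrite pE hoelder_conjugatey lpnorm1 !big_ord1 => a1.
      by rewrite normrZ ler_piMl.
    have := SP w1; rewrite pE => /(le_trans _); apply.
    apply: le_trans (le_bigmax _ (fun _ : 'I_1 => `| `|S (@W k i)| |) ord0).
    by rewrite normr_id.
  pose t : T := Tagged (fun k => 'I_(N k)) i.
  apply: le_trans Si _; apply: le_trans (uuW t) _; rewrite lerD2r /=.
  apply: le_trans (positive_functional_mono lamp (Gle t)).
  rewrite (linear_scaleE lamp.1) ler_pM2l// WE.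
  apply: le_trans (ler_norm _) _; apply: le_trans (bounded_positive_tensor _ _ lamp) _.
  apply: ler_piMl; first by apply: lamp.2; exact: tensor_sup_ge0.
  have h := weak_bdd_coord i pE (@x1 k); exact h.
have r1 : 1 <= r by rewrite -lee_fin -pE.
have [G GK GS] := lower_real pE (powR_gt0 r eta0).
exists G => // k; have [G0 {}GS] := GS k.
rewrite pE; apply: lpnorm_le_powR; first by rewrite (lt_le_trans ltr01).
  by rewrite addr_ge0// ltW.
apply: le_trans (powR_superadd r1 G0 (ltW eta0)).
by under eq_bigr do rewrite normr_id.
Qed.

End LowerBound.

(** * Operators with values in elementary tensors *)

(** Evaluations are the functionals on the dual by which adjoints of finite rank operators are
    dominated in [summing_norm_perturb] and [summing_norm_finite]. *)
Lemma eval_ex (R : realType) (X : normedModType R) (x : X) (c : R) : 0 <= c ->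
  exists ev : dual (dual X), (forall w : dual X, ev w = c * w x) /\ `|ev| <= c * `|x|.
Proof.
move=> c0; apply: bop_ex; first exact: mulr_ge0.
- by move=> a v w; rewrite -[(a *: v + w) x]/(a * v x + w x) mulrDr mulrCA.
- move=> w; rewrite normrM ger0_norm// -mulrA ler_wpM2l//.
  by rewrite mulrC; exact: bop_norm_le.
Qed.

Lemma summing_witness_real (R : realType) (p : \bar R) (U V : normedModType R)
    (S : bop U V) (s ka : R) : (1 <= p)%E -> summing_norm p S = s%:E -> ka < s ->
  exists n (u : 'I_n -> U), weak_bdd p u 1 /\ ka < lpnorm p (fun i => `|S (u i)|).
Proof.
move=> p1 Ss kas; have [ka0|ka0] := leP 0 ka.
  by apply: summing_witness => //; rewrite Ss lte_fin.
exists 0%N, (fun=> 0); split; last by rewrite (lt_le_trans ka0)// lpnorm_ge0.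
by move=> a _; rewrite big_ord0 normr0.
Qed.

Section ElementaryTensors.
Variables (R : realType) (Z X : normedModType R) (m : nat).
Variables (zeta : 'I_m -> dual Z) (x : 'I_m -> X).

Lemma elementary_op_ex (t : 'I_m -> R) :
  exists T : bop Z X, forall z, T z = \sum_j (t j * zeta j z) *: x j.
Proof.
have /choice[T1 T1E] j := rank1_ex (zeta j) (t j *: x j).
exists (\sum_j T1 j) => z; rewrite bop_eval_sum; apply: eq_bigr => j _.
by rewrite T1E scalerA mulrC.
Qed.

Variables (t : 'I_m -> R) (T : bop Z X).
Hypothesis TE : forall z, T z = \sum_j (t j * zeta j z) *: x j.

Lemma elementary_op_finite_rank : finite_rank T.
Proof. by exists m, x => z; exists (fun j => t j * zeta j z). Qed.

Lemma elementary_op_adjoint (w : dual X) z :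
  adjoint T w z = \sum_j t j * w (x j) * zeta j z.
Proof.
rewrite -[LHS]/(w (T z)) TE (linear_sumE (bop_linear w)); apply: eq_bigr => j _.
by rewrite (linear_scaleE (bop_linear w)) -[_ *: _]/(_ * _) mulrAC.
Qed.

(** The bound does not involve [t]: the summing norms of the adjoints of the T_k stay bounded
    however fine the partition is. *)
Lemma elementary_op_summing (p : \bar R) : (1 <= p)%E -> (forall j, `|t j| <= 1) ->
  exists s : R, [/\ 0 <= s, summing_norm p (adjoint T) = s%:E &
    s <= \sum_j `|zeta j| * `|x j|].
Proof.
move=> p1 t1; have /choice[ev evP] j := eval_ex (x j) (normr_ge0 (zeta j)).
have sle : (summing_norm p (adjoint T) <= (\sum_j `|zeta j| * `|x j|)%:E)%E.
  apply: (@le_trans _ _ (\sum_j `|ev j|)%:E); last first.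
    by rewrite lee_fin; apply: ler_sum => j _; exact: (evP j).2.
  apply: summing_norm_finite => // w.
  have evw0 j : 0 <= `|ev j w| by [].
  apply: bop_norm_lub; first exact: sumr_ge0.
  move=> z; rewrite elementary_op_adjoint mulr_suml.
  apply: le_trans (ler_norm_sum _ _ _) _; apply: ler_sum => j _.
  rewrite (evP j).1 !normrM normr_id -mulrA.
  apply: le_trans (ler_piMl _ (t1 j)) _; first exact: mulr_ge0.
  by rewrite [`|zeta j| * _]mulrC -mulrA ler_wpM2l// bop_norm_le.
have s0 := summing_norm_ge0 p1 (adjoint T).
have sf : summing_norm p (adjoint T) \is a fin_num.
  by rewrite ge0_fin_numE// (le_lt_trans sle)// ltry.
exists (fine (summing_norm p (adjoint T))); split; rewrite ?fine_ge0 ?fineK//.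
by rewrite -lee_fin fineK.
Qed.

End ElementaryTensors.

(** * Combination of the two bounds for sums of elementary tensors *)

Section Assembly.
Variables (R : realType) (p q : \bar R) (p1 : (1 <= p)%E) (q1 : (1 <= q)%E).
Variables (X Z : completeNormedModType R) (L : banachLatticeType R) (C K K' P : R).
Hypotheses (XC : GL_bound p q1 X C) (LK : convexity_bound p L K).
Hypotheses (LK' : concavity_bound q L K') (P0 : 0 < P).
Variables (m : nat) (zeta : 'I_m -> dual Z) (x : 'I_m -> X) (y : 'I_m -> L).
Variable T : bop Z (lattice_ext L X).
Hypothesis TE : forall z, T z = \sum_j zeta j z *: completion_incl (tens (x j) (y j)).
Hypothesis TP : (summing_norm p (adjoint T) <= P%:E)%E.

Let e : L := \sum_j labs (y j).
Let Gam : R := \sum_j `|zeta j| * `|x j|.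

Let e0 : 0 <= e. Proof. by apply: bl_sumr_ge0 => j; exact: labs_ge0. Qed.

Let ye j : labs (y j) <= e.
Proof.
rewrite /e (bigD1 j)//= -[leLHS]addr0 bl_lerD//.
by elim/big_ind : _ => // [u v u0 v0|i _]; [rewrite -[leLHS]addr0 bl_lerD|exact: labs_ge0].
Qed.

Let Gam0 : 0 <= Gam. Proof. by apply: sumr_ge0 => j _; exact: mulr_ge0. Qed.

Section Pieces.
Variables (n : nat) (t : 'I_n.+1 -> 'I_m -> R) (g : 'I_n.+1 -> L).
Variables (pik : 'I_n.+1 -> R) (Tk : 'I_n.+1 -> bop Z X).
Hypothesis TkE : forall k z, Tk k z = \sum_j (t k j * zeta j z) *: x j.
Hypothesis Tkpi : forall k, summing_norm p (adjoint (Tk k)) = (pik k)%:E.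

(* The lower bound for pi_p(T^* ), tested on the functionals x^* (x) lam k. *)
Lemma pieces_lower (eta : R) (lam : 'I_n.+1 -> L -> R) : 0 < eta ->
  (forall k, bounded_positive (lam k)) ->
  exists2 G : L, `|G| <= K * P & forall k,
    lam k e * (pik k - eta) <= lam k G + eta + Gam * lam k (loc_err e y (t k)).
Proof.
move=> eta0 lamP.
have wit k : exists n (u : 'I_n -> dual X), weak_bdd p u 1 /\
    pik k - eta < lpnorm p (fun i => `|adjoint (Tk k) (u i)|).
  by apply: (summing_witness_real p1 (Tkpi k)); rewrite ltrBlDr ltrDl.
pose N k := sval (cid (wit k)).
pose u k : 'I_(N k) -> dual X := sval (cid (svalP (cid (wit k)))).
have uP k : weak_bdd p (@u k) 1 /\
    pik k - eta < lpnorm p (fun i => `|adjoint (Tk k) (@u k i)|).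
  exact: svalP (cid (svalP (cid (wit k)))).
have Wex (k : 'I_n.+1) (i : 'I_(N k)) := tensor_functional (@u k i) (lamP k) (X := X).
pose W k (i : 'I_(N k)) : dual (lattice_ext L X) := sval (cid (Wex k i)).
have WE k (i : 'I_(N k)) v : @W k i (completion_incl v) = lam k (v (@u k i)).
  by rewrite /W; case: cid.
have SP := summing_norm_bdd p1 (ltW P0) TP.
have [G GK GP] := lower_bound p1 LK P0 SP (fun k => (uP k).1) lamP WE eta0.
exists G => // k; have [lamp lamb] := lamP k.
have lame : 0 <= lam k e by exact: lamp.2.
have err0 : 0 <= loc_err e y (t k) by apply: bl_sumr_ge0 => j; exact: labs_ge0.
have lerr : 0 <= lam k (loc_err e y (t k)) by exact: lamp.2.
(* Up to the localization error, [lam k] sees [y j] as the multiple [t k j] of [e]. *)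
have lyt j : `|lam k (y j) - t k j * lam k e| <= lam k (loc_err e y (t k)).
  rewrite -[t k j * _]/(t k j *: lam k e) -(linear_scaleE lamp.1) -(linear_subE lamp.1).
  apply: le_trans (positive_functional_labs _ lamp) _.
  apply: positive_functional_mono => //; rewrite /loc_err (bigD1 j)//= -[leLHS]addr0.
  rewrite bl_lerD//.
  by elim/big_ind : _ => // [a b a0 b0|i _]; [rewrite -[leLHS]addr0 bl_lerD|exact: labs_ge0].
have TW (i : 'I_(N k)) z : adjoint T (@W k i) z =
    \sum_j zeta j z * (u k i (x j) * lam k (y j)).
  rewrite -[LHS]/(W k i (T z)) TE (linear_sumE (bop_linear (W k i))).
  apply: eq_bigr => j _; rewrite (linear_scaleE (bop_linear (W k i))) WE.
  by rewrite -[tens _ _ _]/(u k i (x j) *: y j) (linear_scaleE lamp.1).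
(* Consequently the adjoint of [T] maps x^* (x) lam_k nearly to [lam k e] times the image of x^*
   under the adjoint of [Tk k]. *)
have TTW (i : 'I_(N k)) : lam k e * `|adjoint (Tk k) (u k i)| <=
    `|adjoint T (@W k i)| + \sum_j `|zeta j| * lam k (loc_err e y (t k)) * `|u k i (x j)|.
  rewrite -[X in X * _]ger0_norm// -normrZ.
  have -> : lam k e *: adjoint (Tk k) (u k i) = adjoint T (@W k i) +
      (lam k e *: adjoint (Tk k) (u k i) - adjoint T (@W k i)).
    by rewrite addrCA subrr addr0.
  apply: le_trans (ler_normD _ _) _; rewrite lerD2l.
  apply: bop_norm_lub; first by apply: sumr_ge0 => j _; rewrite !mulr_ge0.
  move=> z; rewrite [X in `|X|](_ : _ =
    lam k e * adjoint (Tk k) (u k i) z - adjoint T (@W k i) z); last by [].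
  rewrite TW (elementary_op_adjoint (TkE k)) mulr_sumr -sumrB mulr_suml.
  apply: le_trans (ler_norm_sum _ _ _) _; apply: ler_sum => j _.
  have -> : lam k e * (t k j * u k i (x j) * zeta j z) -
      zeta j z * (u k i (x j) * lam k (y j)) =
      - (zeta j z * (u k i (x j) * (lam k (y j) - t k j * lam k e))).
    by ring.
  rewrite normrN !normrM.
  apply: (@le_trans _ _ ((`|zeta j| * `|z|) * (`|u k i (x j)| * lam k (loc_err e y (t k))))).
    by rewrite ler_pM ?mulr_ge0// ?ler_wpM2l// bop_norm_le.
  by rewrite mulrACA mulrAC [`|z| * _]mulrC; lra.
have lpT : lam k e * lpnorm p (fun i => `|adjoint (Tk k) (u k i)|) <=
    lpnorm p (fun i => `|adjoint T (@W k i)|) + Gam * lam k (loc_err e y (t k)).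
  rewrite -[X in X * _]ger0_norm// -lpnormZ//.
  apply: (@le_trans _ _ (lpnorm p (fun i => `|adjoint T (@W k i)| +
      \sum_j `|zeta j| * lam k (loc_err e y (t k)) * `|u k i (x j)|))).
    apply: ler_lpnorm => // i; rewrite ger0_norm ?mulr_ge0//.
    by apply: le_trans (TTW i) _; exact: ler_norm.
  apply: le_trans (ler_lpnormD _ _ p1) _; rewrite lerD2l.
  apply: le_trans (ler_lpnorm_sum _ _ p1) _; rewrite /Gam mulr_suml.
  apply: ler_sum => j _; rewrite lpnormZ// ger0_norm ?mulr_ge0//.
  rewrite mulrAC ler_wpM2r// ler_wpM2l//.
  have [ev [evE ev1]] := eval_ex (x j) (@ler01 R).
  have := weak_bdd_dual p1 ev (uP k).1; rewrite mulr1 => h.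
  rewrite (_ : lpnorm p _ = lpnorm p (fun i => ev (u k i))).
    by rewrite (le_trans h)// (le_trans ev1)// mul1r.
  by apply: eq_lpnorm => i; rewrite normr_id evE mul1r.
apply: (@le_trans _ _ (lam k e * lpnorm p (fun i => `|adjoint (Tk k) (u k i)|))).
  by rewrite ler_wpM2l// ltW// (uP k).2.
by rewrite (le_trans lpT)// lerD2r GP.
Qed.

End Pieces.

Let E : R := `|e|.
(** The coefficient of [eta] in the final error, independent of [eta] and of the partition. The
    bracket is the error of [assembly_weights], multiplied by the concavity constant;
    [Gam * (2 * E)] pays for replacing each [y j] by [\sum_k t k j *: g k]. *)
Definition assembly_const : R :=
  K' * (C * (1 + E + Gam * (C * Gam + 3) * E) + 3 * E) + Gam * (2 * E).

Let C0 : 0 <= C. Proof. by case: XC. Qed.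

(** A norming functional of the weighted sum is split along the penalised elements, and
    [pieces_lower] is applied to its parts. The summand [eta] in the weights makes them positive and
    leaves room for attained factorizations of the pieces. *)
Lemma assembly_weights (eta : R) : 0 < eta -> eta <= 1 ->
  exists n (t : 'I_n.+1 -> 'I_m -> R) (g : 'I_n.+1 -> L) (pik : 'I_n.+1 -> R)
    (Tk : 'I_n.+1 -> bop Z X),
  [/\ forall k, 0 <= g k,
      forall j, labs (y j - \sum_k t k j *: g k) <= (2 * eta ^+ 2) *: e,
      forall k z, Tk k z = \sum_j (t k j * zeta j z) *: x j,
      forall k, 0 <= pik k /\ summing_norm p (adjoint (Tk k)) = (pik k)%:E &
      `|\sum_k (C * pik k + eta) *: g k| <=
        C * (K * P) + eta * (C * (1 + E + Gam * (C * Gam + 3) * E) + 3 * E)].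
Proof.
(* The penalty [M] must be large to force concentration, yet [M * (2 / N)] must be small: here it is
   [2 * eta]. *)
move=> eta0 eta1; pose M := eta^-1; pose N := eta ^- 2.
have N0 : 0 < N by rewrite invr_gt0 exprn_gt0.
have M0 : 0 < M by rewrite invr_gt0.
have N2 : 2 / N = 2 * eta ^+ 2 by rewrite /N invrK.
have MN : M * (2 / N) = 2 * eta.
  by rewrite N2 mulrCA /M expr2 mulKf// gt_eqF.
have [n [t [g [t1 g0 yg gphi]]]] := localization e0 ye N0 (ltW M0).
rewrite N2 in yg; rewrite MN in gphi.
have /choice[Tk TkE] k := elementary_op_ex zeta x (t k).
have /choice[pik pikP] k := elementary_op_summing (TkE k) p1 (t1 k).
exists n, t, g, pik, Tk; split => //; first by move=> k; have [] := pikP k.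
pose phi k := C * pik k + eta.
have pik0 k : 0 <= pik k by have [] := pikP k.
have phi0 k : 0 <= phi k by rewrite addr_ge0 ?mulr_ge0// ltW.
pose w := \sum_k phi k *: g k.
have w0 : 0 <= w by apply: bl_sumr_ge0 => k; exact: bl_scale_ge0.
rewrite -/w.
have [lam [lamp lamw lamb]] := positive_norming w0.
have [lamk [lamkp lamks lamkj]] := split_functional
  (fun k => phi k *: e - M *: loc_err e y (t k)) lamp.
have lamkle k v : 0 <= v -> lamk k v <= lam v.
  move=> v0; rewrite -lamks (bigD1 k)//= lerDl sumr_ge0// => j _.
  by have [_] := lamkp j; apply.
have lamkb k : bounded_positive (lamk k).
  split => // v; apply: le_trans (ler_norm _) _.
  apply: le_trans (positive_functional_labs _ (lamkp k)) _.
  apply: le_trans (lamkle k _ (labs_ge0 v)) _.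
  by apply: le_trans (lamb _) _; rewrite labs_norm.
have n0 : 0 < n.+1%:R :> R by rewrite ltr0n.
(* The slack of [pieces_lower] occurs once for each of the [n.+1] pieces and has to add up to
   [eta]. *)
have eta'0 : 0 < eta / n.+1%:R by rewrite divr_gt0.
have [G GK GP] := pieces_lower TkE (fun k => let: And3 _ h _ := pikP k in h) eta'0 lamkb.
set rr := \sum_k lamk k (loc_err e y (t k)).
have err0 k : 0 <= loc_err e y (t k) by apply: bl_sumr_ge0 => j; exact: labs_ge0.
have rr0 : 0 <= rr.
  by apply: sumr_ge0 => k _; have [_] := lamkp k; apply.
have a0 k : 0 <= lamk k e by have [_] := lamkp k; apply.
have leE : lam e <= E by exact: lamb.
have le0 : 0 <= lam e by have [_] := lamp; apply.
have H1 : lam w <= \sum_k phi k * lamk k e - M * rr + 2 * eta * lam e.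
  have := positive_functional_mono lamp (gphi phi phi0).
  rewrite (linear_addE lamp.1) (linear_scaleE lamp.1) -lamkj => /le_trans; apply.
  rewrite lerD2r /rr mulr_sumr -sumrB; apply: ler_sum => k _.
  by rewrite (linear_subE (lamkp k).1) !(linear_scaleE (lamkp k).1).
have phile k : phi k <= C * Gam + 1.
  by rewrite lerD// ler_wpM2l//; have [] := pikP k.
have lamw0 : 0 <= lam w by rewrite lamw.
(* In [H1] the left side is nonnegative and the positive terms are bounded independently of [M], so
   the total localization error is of order [1 / M = eta]. *)
have rle : rr <= eta * ((C * Gam + 3) * E).
  have : \sum_k phi k * lamk k e <= (C * Gam + 1) * lam e.
    by rewrite -lamks mulr_sumr; apply: ler_sum => k _; rewrite ler_wpM2r.
  have : 2 * eta * lam e <= 2 * lam e.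
    by rewrite ler_wpM2r// ler_piMr.
  have : (C * Gam + 3) * lam e <= (C * Gam + 3) * E.
    by apply: ler_wpM2l => //; apply: addr_ge0 => //; exact: mulr_ge0.
  by move=> h1 h2 h3; rewrite -ler_pdivrMl// -/M; lra.
have H2 : \sum_k pik k * lamk k e <=
    K * P + eta * (1 + E + Gam * (C * Gam + 3) * E).
  have : \sum_k lamk k e * (pik k - eta / n.+1%:R) <=
      \sum_k (lamk k G + eta / n.+1%:R + Gam * lamk k (loc_err e y (t k))).
    by apply: ler_sum => k _; exact: GP.
  rewrite !big_split/= lamks sumr_const card_ord -mulr_sumr -/rr.
  have -> : (eta / n.+1%:R) *+ n.+1 = eta.
    by rewrite -[_ *+ n.+1]mulr_natr divfK// gt_eqF.
  have -> : \sum_k lamk k e * (pik k - eta / n.+1%:R) =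
      \sum_k pik k * lamk k e - eta / n.+1%:R * lam e.
    rewrite -lamks mulr_sumr -sumrB; apply: eq_bigr => k _.
    by rewrite mulrBr ![lamk k e * _]mulrC.
  have : lam G <= K * P by exact: le_trans (lamb G) GK.
  have : eta / n.+1%:R * lam e <= eta * E.
    rewrite ler_pM ?(ltW eta'0)// ler_pdivrMr// ler_peMr ?(ltW eta0)//.
    by rewrite ler1n.
  have := ler_wpM2l Gam0 rle.
  move: (eta / n.+1%:R * lam e) (Gam * rr) (lam G) (\sum_k pik k * lamk k e) => a1 a2 a3 a4.
  lra.
rewrite -lamw; apply: le_trans H1 _.
have -> : \sum_k phi k * lamk k e = C * (\sum_k pik k * lamk k e) + eta * lam e.
  rewrite -lamks !mulr_sumr -big_split/=; apply: eq_bigr => k _.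
  by rewrite mulrDl mulrA.
have := ler_wpM2l C0 H2; have := ler_wpM2l (ltW eta0) leE.
have : 0 <= M * rr by rewrite mulr_ge0// ltW.
lra.
Qed.

(** Replacing [y j] by [\sum_k t k j *: g k] turns [T] into \sum_k T_k (x) g_k, to which
    [integral_norm_lattice] applies; the difference is a sum of rank one operators, of total size at
    most [eta * (Gam * (2 * E))]. *)
Lemma assembly_bound (eta : R) : 0 < eta -> eta <= 1 ->
  (integral_norm q1 T <= (C * (K * P) * K' + eta * assembly_const)%:E)%E.
Proof.
move=> eta0 eta1.
have [n [t [g [pik [Tk [g0 yg TkE pikP wle]]]]]] := assembly_weights eta0 eta1.
have phi0 k : 0 < C * pik k + eta.
  by rewrite ltr_wpDl// mulr_ge0//; have [] := pikP k.
have FT k : factors q1 (Tk k) (C * pik k + eta).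
  apply: integral_norm_factors.
  apply: (@le_lt_trans _ _ (C * pik k)%:E); last by rewrite lte_fin ltrDl.
  have [_ XCb] := XC; have := XCb Z (Tk k) (elementary_op_finite_rank (TkE k)).
  by have [_ ->] := pikP k.
pose s j := \sum_k t k j *: g k.
pose r j : lattice_ext L X := completion_incl (tens (x j) (y j - s j)).
have /choice[T1 T1E] j := rank1_ex (zeta j) (r j).
pose T2 := T - \sum_j T1 j.
have T2E z : T2 z = T z - \sum_j zeta j z *: r j.
  rewrite -[LHS]/(T z - (\sum_j T1 j) z) bop_eval_sum; congr (_ - _).
  by apply: eq_bigr => j _; rewrite T1E.
have T2g z : T2 z = \sum_k completion_incl (tens (Tk k z) (g k)).
  rewrite T2E TE -sumrB.
  transitivity (completion_incl (\sum_j zeta j z *: (tens (x j) (y j) - tens (x j) (y j - s j)))).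
    have il := @completion_incl_linear R (tensor L X).
    rewrite (linear_sumE il); apply: eq_bigr => j _.
    by rewrite (linear_scaleE il) (linear_subE il) scalerBr.
  rewrite -[RHS]linear_sum; congr completion_incl; apply/val_inj/funext => phi /=.
  rewrite tens_sumE.
  have ev (f : 'I_m -> tensor L X) : (\sum_j f j) phi = \sum_j f j phi.
    exact: (big_morph (fun u : tensor L X => u phi)).
  rewrite ev.
  transitivity (\sum_j (zeta j z * phi (x j)) *: s j).
    apply: eq_bigr => j _.
    rewrite -[LHS]/(zeta j z *: (phi (x j) *: y j - phi (x j) *: (y j - s j))).
    by rewrite -scalerBr subKr scalerA.
  under eq_bigr do rewrite scaler_sumr.
  rewrite exchange_big/=; apply: eq_bigr => k _.
  rewrite TkE (linear_sumE (bop_linear phi)) scaler_suml; apply: eq_bigr => j _.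
  rewrite (linear_scaleE (bop_linear phi)) scalerA -[_ *: phi _]/(_ * phi _).
  by congr (_ *: _); ring.
have up := integral_norm_lattice LK' phi0 g0 FT T2g.
have K'0 : 0 <= K' by case: LK'.
have TT2 z : T z = T2 z + \sum_j zeta j z *: r j by rewrite T2E subrK.
apply: le_trans (integral_norm_perturb _ up TT2) _; first exact: mulr_ge0.
rewrite lee_fin /assembly_const mulrDr addrA; apply: lerD.
  have := ler_wpM2l K'0 wle.
  by move=> /le_trans; apply; rewrite mulrDr [K' * (C * _)]mulrC lerD2l mulrCA.
rewrite /Gam mulrCA mulr_suml; apply: ler_sum => j _.
rewrite -mulrA ler_wpM2l// completion_incl_norm.
apply: le_trans (tens_norm _ _) _; rewrite ler_wpM2l//.
rewrite -labs_norm; apply: (@le_trans _ _ `|(2 * eta ^+ 2) *: e|).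
  by apply: bl_norm_mono (yg j); exact: labs_ge0.
rewrite normrZ ger0_norm ?mulr_ge0 ?exprn_ge0 ?(ltW eta0)// -/E.
have -> : 2 * eta ^+ 2 * E = eta * (eta * (2 * E)).
  by move: E => E1; ring.
by rewrite ler_wpM2l ?(ltW eta0)// ler_piMl// mulr_ge0// normr_ge0.
Qed.

End Assembly.

(** * Finite rank operators *)

Section FiniteRank.
Variable R : realType.

(* There is a bounded projection P onto the span of e; the induction step adds
   to P the component along w = e_0 - P e_0. *)
Lemma span_projection (V : normedModType R) n (e : 'I_n -> V) :
  exists m (f : 'I_m -> V) (eta : 'I_m -> dual V),
  (forall j, exists c : 'I_n -> R, f j = \sum_i c i *: e i) /\
  forall c : 'I_n -> R,
    \sum_j eta j (\sum_i c i *: e i) *: f j = \sum_i c i *: e i.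
Proof.
elim: n e => [|n IH] e.
  exists 0%N, (fun=> 0), (fun=> 0); split=> [[]//|c].
  by rewrite !big_ord0.
have [m [f [eta [fe fE]]]] := IH (fun i => e (lift ord0 i)).
have {}fe j : exists c : 'I_n.+1 -> R, f j = \sum_i c i *: e i.
  have [c cE] := fe j; exists (fun i => if unlift ord0 i is Some i' then c i' else 0).
  rewrite big_ord_recl unlift_none scale0r add0r cE.
  by apply: eq_bigr => i _; rewrite liftK.
pose Pr v := \sum_j eta j v *: f j.
have lPr : linear Pr.
  move=> a u v; rewrite /Pr scaler_sumr -big_split/=; apply: eq_bigr => j _.
  by rewrite (bop_linear (eta j)) scalerDl scalerA.
pose w := e ord0 - Pr (e ord0).
have PrE c : Pr (\sum_i c i *: e i) = \sum_i c i *: e i - c ord0 *: w.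
  rewrite big_ord_recl (linear_addE lPr) (linear_scaleE lPr) /Pr.
  rewrite (fE (fun i => c (lift ord0 i))) -/(Pr _) /w scalerBr opprB.
  by rewrite [RHS]addrC addrA subrK.
have [w0|w0] := eqVneq w 0.
  exists m, f, eta; split => // c.
  by rewrite -/(Pr _) PrE w0 scaler0 subr0.
have [phi [_ phiw]] := norming_functional w.
have nw : `|w| != 0 by rewrite normr_eq0.
pose eta' : dual V := `|w|^-1 *: (phi - \sum_j phi (f j) *: eta j).
have eta'E v : eta' v = `|w|^-1 * phi (v - Pr v).
  rewrite -[LHS]/(`|w|^-1 * (phi v - (\sum_j phi (f j) *: eta j) v)).
  rewrite bop_eval_sum (linear_subE (bop_linear phi)) /Pr.
  rewrite (linear_sumE (bop_linear phi)); congr (_ * (_ - _)).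
  apply: eq_bigr => j _; rewrite (linear_scaleE (bop_linear phi)) bop_scaleE.
  by rewrite -[LHS]/(_ * _) -[RHS]/(_ * _) mulrC.
exists m.+1, (fun j => if unlift ord0 j is Some j' then f j' else w),
  (fun j => if unlift ord0 j is Some j' then eta j' else eta'); split.
  move=> j; case: unliftP => [j' _|_]; first exact: fe.
  have /choice[c cE] := fe.
  exists (fun i => (i == ord0)%:R - \sum_j eta j (e ord0) * c j i).
  under eq_bigr do rewrite scalerBl.
  rewrite sumrB (bigD1 ord0)//= scale1r big1 ?addr0; last first.
    by move=> i /negbTE ->; rewrite scale0r.
  rewrite /w; congr (_ - _); under [RHS]eq_bigr do rewrite scaler_suml.
  rewrite exchange_big/=; apply: eq_bigr => k _; rewrite cE scaler_sumr.
  by apply: eq_bigr => i _; rewrite scalerA.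
move=> c; rewrite big_ord_recl unlift_none eta'E PrE subKr.
rewrite (linear_scaleE (bop_linear phi)) phiw -[_ *: `|w|]/(_ * `|w|).
rewrite mulrC mulfK// addrC.
have -> : \sum_(j < m) (if unlift ord0 (lift ord0 j) is Some j' then eta j' else eta')
      (\sum_i c i *: e i) *:
      (if unlift ord0 (lift ord0 j) is Some j' then f j' else w) =
    Pr (\sum_i c i *: e i).
  by apply: eq_bigr => j _; rewrite liftK.
by rewrite PrE subrK.
Qed.

(** The coefficients in [finite_rank] are arbitrary functions of [z]; composing [T] with the bounded
    coordinates of a projection onto the span of [e] makes them continuous and linear. *)
Lemma finite_rank_decomp (Z W : normedModType R) (T : bop Z W) : finite_rank T ->
  exists m (zeta : 'I_m -> dual Z) (f : 'I_m -> W),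
  forall z, T z = \sum_j zeta j z *: f j.
Proof.
move=> [n [e Te]]; have [m [f [eta [_ fE]]]] := span_projection e.
exists m, (fun j => adjoint T (eta j)), f => z.
by have [c Tz] := Te z; rewrite Tz -fE -Tz.
Qed.

End FiniteRank.

(** Serves to pull the optimal constants out of a product one at a time. Finiteness of [b] matters:
    for [b = +oo] and infimum 0 the product would be 0. *)
Lemma le_ereal_inf_mul (R : realType) (A : set R) (b a : \bar R) : A !=set0 ->
  (forall r, A r -> 0 <= r) -> (0 <= b)%E -> b \is a fin_num ->
  (forall r, A r -> (a <= r%:E * b)%E) -> (a <= ereal_inf [set r%:E | r in A] * b)%E.
Proof.
move=> [r0 Ar0] A0 b0 bfin aA; have bE := fineK bfin.
set I := ereal_inf _.
have I0 : (0 <= I)%E by apply: le_ereal_inf_tmp => _ [r /A0 r0' <-]; rewrite lee_fin.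
have Ifin : I \is a fin_num.
  rewrite ge0_fin_numE//; apply: (@le_lt_trans _ _ r0%:E); last exact: ltry.
  by apply: ereal_inf_lbound; exists r0.
have IE := fineK Ifin.
apply/lee_addgt0Pr => e e0.
have bb : 0 < fine b + 1 by rewrite ltr_wpDl// fine_ge0.
have : (I < (fine I + e / (fine b + 1))%:E)%E.
  by rewrite -[ltLHS]IE lte_fin ltrDl divr_gt0.
move=> /ereal_inf_lt[_ [r Ar <-]]; rewrite lte_fin => rI.
apply: le_trans (aA r Ar) _; rewrite -IE -bE -!EFinM -EFinD lee_fin.
apply: (@le_trans _ _ ((fine I + e / (fine b + 1)) * fine b)).
  by rewrite ler_wpM2r ?fine_ge0// ltW.
rewrite mulrDl lerD2l mulrAC ler_pdivrMr// ler_wpM2l ?(ltW e0)//.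
by rewrite lerDl.
Qed.

(** * Arbitrary finite rank operators and the optimal constants *)

Section MainBound.
Variables (R : realType) (p q : \bar R) (p1 : (1 <= p)%E) (q1 : (1 <= q)%E).
Variables (X Z : completeNormedModType R) (L : banachLatticeType R) (C K K' : R).
Hypotheses (XC : GL_bound p q1 X C) (LK : convexity_bound p L K).
Hypothesis LK' : concavity_bound q L K'.

Let C0 : 0 <= C. Proof. by case: XC. Qed.
Let K0 : 0 <= K. Proof. by case: LK. Qed.
Let K'0 : 0 <= K'. Proof. by case: LK'. Qed.

Lemma elementary_bound m (zeta : 'I_m -> dual Z) (x : 'I_m -> X) (y : 'I_m -> L)
    (T : bop Z (lattice_ext L X)) (P : R) : 0 < P ->
  (forall z, T z = \sum_j zeta j z *: completion_incl (tens (x j) (y j))) ->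
  (summing_norm p (adjoint T) <= P%:E)%E ->
  (integral_norm q1 T <= (C * K * K' * P)%:E)%E.
Proof.
move=> P0 TE TP; apply/lee_addgt0Pr => e e0; rewrite -EFinD.
set B := assembly_const C K' zeta x y.
have B1 : 0 < `|B| + 1 by rewrite ltr_wpDl.
pose eta := Num.min 1 (e / (`|B| + 1)).
have eta0 : 0 < eta by rewrite lt_min ltr01 divr_gt0.
have eta1 : eta <= 1 by rewrite ge_min lexx.
apply: le_trans (assembly_bound p1 XC LK LK' P0 TE TP eta0 eta1) _.
rewrite lee_fin -/B [C * (K * P) * K'](_ : _ = C * K * K' * P); last by ring.
rewrite lerD2l (le_trans (ler_wpM2l (ltW eta0) (ler_norm B)))//.
apply: (@le_trans _ _ (e / (`|B| + 1) * `|B|)).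
  by rewrite ler_wpM2r// ge_min lexx orbT.
by rewrite mulrAC ler_pdivrMr// ler_wpM2l ?(ltW e0)// lerDl.
Qed.

(** The vectors [f j] lie in the completion only; they are replaced within [d] by elements [v j] of
    X (x) L. The two perturbation lemmas control the change of both norms by multiples of [d]. *)
Lemma finite_rank_bound (T : bop Z (lattice_ext L X)) : finite_rank T ->
  (integral_norm q1 T <= (C * K * K')%:E * summing_norm p (adjoint T))%E.
Proof.
move=> /finite_rank_decomp[m [zeta [f TE]]].
have adE (w : dual (lattice_ext L X)) : `|adjoint T w| <= \sum_j `|zeta j| * `|w (f j)|.
  apply: bop_norm_lub; first by apply: sumr_ge0 => j _; exact: mulr_ge0.
  move=> z; rewrite -[adjoint T w z]/(w (T z)) TE (linear_sumE (bop_linear w)).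
  rewrite mulr_suml; apply: le_trans (ler_norm_sum _ _ _) _; apply: ler_sum => j _.
  rewrite (linear_scaleE (bop_linear w)) normrM mulrAC ler_wpM2r//.
  exact: bop_norm_le.
have /choice[ev evP] j := eval_ex (f j) (normr_ge0 (zeta j)).
have Pfin : summing_norm p (adjoint T) \is a fin_num.
  rewrite ge0_fin_numE ?summing_norm_ge0//.
  apply: (@le_lt_trans _ _ (\sum_j `|ev j|)%:E); last exact: ltry.
  apply: summing_norm_finite => // w; apply: le_trans (adE w) _.
  by apply: ler_sum => j _; rewrite (evP j).1 normrM normr_id.
have P0 : 0 <= fine (summing_norm p (adjoint T)) by rewrite fine_ge0// summing_norm_ge0.
rewrite -(fineK Pfin); set P := fine _ in P0 *.
have TP : (summing_norm p (adjoint T) <= P%:E)%E by rewrite fineK.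
rewrite -EFinM; apply/lee_addgt0Pr => e e0; rewrite -EFinD.
pose sg := \sum_j `|zeta j|.
have sg0 : 0 <= sg by exact: sumr_ge0.
(* Coefficient of [d] in the total error: [C * K * K' * (sg + 1)] from the summing norm and [sg]
   from the integral norm; the last 1 keeps [D] positive. *)
pose D := C * K * K' * (sg + 1) + sg + 1.
have CKK0 : 0 <= C * K * K' by rewrite !mulr_ge0.
have D0 : 0 < D by rewrite ltr_wpDl// addr_ge0// mulr_ge0// addr_ge0.
pose d := e / D; have d0 : 0 < d by rewrite divr_gt0.
have /choice[v vP] j := completion_approx (f j) d0.
have /choice[N NP] j : exists n, exists (a : 'I_n -> X) (b : 'I_n -> L),
    v j = \sum_i tens (a i) (b i).
  by have [n [a [b E]]] := tensorE (v j); exists n, a, b.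
pose a j : 'I_(N j) -> X := sval (cid (NP j)).
have NP2 j : exists b : 'I_(N j) -> L, v j = \sum_i tens (a j i) (b i).
  exact: svalP (cid (NP j)).
pose b j : 'I_(N j) -> L := sval (cid (NP2 j)).
have vE j : v j = \sum_i tens (a j i) (b j i) by exact: svalP (cid (NP2 j)).
have /choice[T1 T1E] j := rank1_ex (zeta j) (f j - completion_incl (v j)).
pose T2 := T - \sum_j T1 j.
have T2E z : T z = T2 z + \sum_j zeta j z *: (f j - completion_incl (v j)).
  have -> : T2 z = T z - \sum_j zeta j z *: (f j - completion_incl (v j)).
    rewrite -[LHS]/(T z - (\sum_j T1 j) z) bop_eval_sum; congr (_ - _).
    by apply: eq_bigr => j _; rewrite T1E.
  by rewrite subrK.
have T2v z : T2 z = \sum_j zeta j z *: completion_incl (v j).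
  apply: (addIr (\sum_j zeta j z *: (f j - completion_incl (v j)))).
  rewrite -T2E TE -big_split/=; apply: eq_bigr => j _.
  by rewrite -scalerDr addrC subrK.
pose J := {k : 'I_m & 'I_(N k)}.
have T2t z : T2 z = \sum_(l < #|{: J}|) zeta (tag (enum_val l)) z *:
    completion_incl (tens (a _ (tagged (enum_val l))) (b _ (tagged (enum_val l)))).
  rewrite (sum_enum_sig (fun k i => zeta k z *: completion_incl (tens (a k i) (b k i)))).
  rewrite T2v; apply: eq_bigr => j _; rewrite vE.
  have il := @completion_incl_linear R (tensor L X).
  by rewrite (linear_sumE il) scaler_sumr.
have /choice[ev' ev'P] j := eval_ex (completion_incl (v j) - f j) (normr_ge0 (zeta j)).
have T2P : (summing_norm p (adjoint T2) <= (P + \sum_j `|ev' j|)%:E)%E.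
  apply: (summing_norm_perturb p1 P0 TP) => w.
  have -> : adjoint T2 w = adjoint T w + (adjoint T2 w - adjoint T w).
    by rewrite addrCA subrr addr0.
  apply: le_trans (ler_normD _ _) _; rewrite lerD2l.
  apply: bop_norm_lub; first exact: sumr_ge0.
  move=> z; rewrite [X in `|X|](_ : _ = w (T2 z) - w (T z)); last by [].
  have -> : w (T z) = w (T2 z) + w (\sum_j zeta j z *: (f j - completion_incl (v j))).
    by rewrite {1}T2E; exact: (linear_addE (bop_linear w)).
  rewrite opprD addrA subrr add0r normrN.
  rewrite (linear_sumE (bop_linear w)) mulr_suml.
  apply: le_trans (ler_norm_sum _ _ _) _; apply: ler_sum => j _.
  rewrite (ev'P j).1 (linear_scaleE (bop_linear w)) !normrM normr_id.
  rewrite -opprB (linear_oppE (bop_linear w)) normrN mulrAC ler_wpM2r//.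
  exact: bop_norm_le.
have evd : \sum_j `|ev' j| <= d * sg.
  rewrite mulr_sumr; apply: ler_sum => j _; apply: le_trans (ev'P j).2 _.
  by rewrite mulrC ler_wpM2r// distrC vP.
(* [sg + 1] in place of [sg] gives a positive bound even when [P] and [sg] vanish, as
   [elementary_bound] demands. *)
have T2P' : (summing_norm p (adjoint T2) <= (P + d * (sg + 1))%:E)%E.
  apply: le_trans T2P _; rewrite lee_fin lerD2l (le_trans evd)//.
  by rewrite ler_wpM2l ?(ltW d0)// lerDl.
have PP0 : 0 < P + d * (sg + 1) by rewrite ltr_wpDl// mulr_gt0// ltr_wpDl.
have h := elementary_bound PP0 T2t T2P'.
have := integral_norm_perturb (q1 := q1) _ h T2E; rewrite mulr_ge0 ?(ltW PP0)//.
move=> /(_ isT) /le_trans; apply; rewrite lee_fin.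
have : \sum_j `|zeta j| * `|f j - completion_incl (v j)| <= d * sg.
  by rewrite mulr_sumr; apply: ler_sum => j _; rewrite mulrC ler_wpM2r.
have : d * D = e by rewrite /d divfK// gt_eqF.
rewrite /D mulrDr mulrDr => dE h2.
apply: le_trans (lerD (lexx _) h2) _; rewrite -dE mulrDr.
rewrite [C * K * K' * (d * _)]mulrCA mulr1.
by rewrite -!addrA !lerD2l lerDl ltW.
Qed.

End MainBound.

Theorem theorem1p9 (R : realType) (p q : \bar R)
    (p1 : (1 <= p)%E) (q1 : (1 <= q)%E) (pq : (p <= q)%E)
    (X : completeNormedModType R) (L : banachLatticeType R) :
  has_GL p q1 X -> convex_lattice p L -> concave_lattice q L ->
  has_GL p q1 (lattice_ext L X) /\
  (GL_const p q1 (lattice_ext L X)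
     <= GL_const p q1 X * convexity_const p L * concavity_const q L)%E.
Proof.
move=> [C0 XC0] [K0 LK0] [K'0 LK'0].
have main C K K' : GL_bound p q1 X C -> convexity_bound p L K ->
    concavity_bound q L K' -> GL_bound p q1 (lattice_ext L X) (C * K * K').
  move=> XC LK LK'; split; last by move=> Z T; exact: finite_rank_bound.
  by rewrite !mulr_ge0//; [case: XC|case: LK|case: LK'].
split; first by exists (C0 * K0 * K'0); exact: main.
set G := GL_const p q1 (lattice_ext L X).
have fin (A : set R) r : A r -> (forall s, A s -> 0 <= s) ->
    (0 <= ereal_inf [set s%:E | s in A])%E /\ ereal_inf [set s%:E | s in A] \is a fin_num.
  move=> Ar A0; have I0 : (0 <= ereal_inf [set s%:E | s in A])%E.
    by apply: le_ereal_inf_tmp => _ [s /A0 s0 <-]; rewrite lee_fin.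
  split=> //; rewrite ge0_fin_numE//; apply: (@le_lt_trans _ _ r%:E); last exact: ltry.
  by apply: ereal_inf_lbound; exists r.
have Gle C K K' : GL_bound p q1 X C -> convexity_bound p L K ->
    concavity_bound q L K' -> (G <= C%:E * (K%:E * K'%:E))%E.
  move=> XC LK LK'; apply: ereal_inf_lbound; exists (C * K * K'); first exact: main.
  by rewrite -!EFinM mulrA.
have [X0 Xf] := fin _ _ XC0 (fun s => @proj1 _ _).
have [c0 cf] := fin _ _ LK0 (fun s => @proj1 _ _).
have [k0 kf] := fin _ _ LK'0 (fun s => @proj1 _ _).
rewrite -muleA; apply: le_ereal_inf_mul.
- by exists C0.
- by move=> r [].
- exact: mule_ge0.
- exact: fin_numM.
move=> C XC; rewrite muleCA; apply: le_ereal_inf_mul.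
- by exists K0.
- by move=> r [].
- by rewrite mule_ge0// lee_fin; case: XC.
- exact: fin_numM.
move=> K LK; rewrite muleA muleC; apply: le_ereal_inf_mul.
- by exists K'0.
- by move=> r [].
- by rewrite -EFinM lee_fin mulr_ge0//; [case: LK|case: XC].
- by [].
move=> K' LK'; rewrite muleC -muleA muleCA; exact: Gle.
Qed.
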